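(* Let $G=(V,E)$ be a quasi-transitive graph and let $\mathbf{P}_p$ be Bernoulli$(p)$ bond percolation on $G$, $p\in[0,1]$. If there is almost surely more than one infinite cluster under $\mathbf{P}_p$, then $$\inf\{\mathbf{P}_p(x\leftrightarrow y): x,y\in V\}=0 .$$ In particular, $$p_u(G)=\overline{p}_{\mathrm{conn}} .$$
   Context: All graphs are connected, locally finite and infinite; multiple edges and loops are allowed. $G$ is quasi-transitive if its automorphism group $\mathrm{Aut}(G)$ has finitely many orbits on $V$. Under Bernoulli$(p)$ bond percolation $\mathbf{P}_p$ each edge is open independently with probability $p$; clusters are the connected components of the open subgraph. The event $x\leftrightarrow y$ is that there is an open path connecting $x$ and $y$. The uniqueness threshold is $$p_u(G):=\inf\{p\in[0,1]:\ \mathbf{P}_p\text{-a.s. there exists a unique infinite open cluster}\},$$ and, for a fixed $o\in V$ (the definition does not depend on the choice of $o$), $$\overline{p}_{\mathrm{conn}}:=\inf\Big\{p\in[0,1]:\ \inf_{x\in V}\mathbf{P}_p(o\leftrightarrow x)>0\Big\}.$$ *)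

(* Defs.v *)
From HB Require Import structures.
From mathcomp Require Import all_boot all_order all_algebra.
From mathcomp Require Import all_classical all_reals all_analysis.
Set Implicit Arguments.
Unset Strict Implicit.
Unset Printing Implicit Defensive.
Import Order.TTheory GRing.Theory Num.Theory.
Import numFieldNormedType.Exports.
Local Open Scope classical_set_scope.
Local Open Scope ring_scope.

(* Undirected graphs with loops and multiple edges. The pair [ends e] lists the
   endpoints of [e] in an arbitrary order; only [joins] below, which forgets
   this order, is used. *)
Record multigraph := Multigraph {
  vertex : choiceType;
  edge : choiceType;
  ends : edge -> vertex * vertex }.

Section graphs.
Variable G : multigraph.
Implicit Types (x y z : vertex G) (e : edge G) (w : edge G -> bool).

Definition joins e x y := ends e = (x, y) \/ ends e = (y, x).

(* A step (e, z) of a walk crosses the edge e and arrives at z. *)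
Fixpoint open_walk w x (s : seq (edge G * vertex G)) y : Prop :=
  if s is (e, z) :: s' then [/\ w e, joins e x z & open_walk w z s' y]
  else x = y.

Definition open_connected w x y := exists s, open_walk w x s y.

Definition cluster w x : set (vertex G) := [set y | open_connected w x y].

Definition infinite_cluster w (C : set (vertex G)) :=
  (exists x, C = cluster w x) /\ infinite_set C.

Definition unique_infinite_cluster w := exists! C, infinite_cluster w C.

Definition many_infinite_clusters w :=
  exists C1 C2, [/\ infinite_cluster w C1, infinite_cluster w C2 & C1 <> C2].

Definition connected_graph := forall x y, open_connected (fun=> true) x y.

Definition locally_finite :=
  forall x, finite_set [set e | exists y, joins e x y].

Definition infinite_graph := infinite_set [set: vertex G].

Definition automorphism (f : vertex G -> vertex G) (g : edge G -> edge G) :=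
  [/\ bijective f, bijective g &
      forall e x y, joins e x y <-> joins (g e) (f x) (f y)].

Definition aut_orbit x : set (vertex G) :=
  [set y | exists f g, automorphism f g /\ f x = y].

Definition quasi_transitive := finite_set (range aut_orbit).

End graphs.

(* The space {0,1}^I with its product sigma-algebra. *)
Definition config (I : choiceType) :=
  g_sigma_algebraType (range (fun i : I => [set w : I -> bool | w i])).

(* P is the product over I of the Bernoulli(p) laws. *)
Definition bernoulli_product (R : realType) (I : choiceType) (p : R)
    (P : probability (config I) R) :=
  forall (J : seq I) (v : I -> bool), uniq J ->
    P [set w | forall i, i \in J -> w i = v i] =
    (\prod_(i <- J) (if v i then p else 1 - p))%:E.

Section existence.
Variables (R : realType) (p : R).
Hypothesis p01 : 0 <= p <= 1.
Local Notation mu := (@lebesgue_measure R).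

(* Bits of x in [a, a + l[, obtained by repeatedly cutting the current interval
   in proportions p and 1 - p. *)
Fixpoint bit (n : nat) (a l x : R) : bool :=
  if n is n'.+1 then
    if x < a + p * l then bit n' a (p * l) x
    else bit n' (a + p * l) ((1 - p) * l) x
  else x < a + p * l.

Lemma measurable_ltc (c : R) : measurable_fun setT (fun x : R => x < c).
Proof.
apply: (measurable_fun_bool true); rewrite setTI.
rewrite (_ : _ @^-1` _ = `]-oo, c[%classic); first exact: measurable_itv.
by apply/seteqP; split => x /=; rewrite in_itv.
Qed.

Lemma measurable_bit n a l : measurable_fun setT (bit n a l).
Proof.
elim: n a l => [|n IH] a l /=.
  exact: measurable_ltc.
by apply: measurable_fun_ifT => //; exact: measurable_ltc.
Qed.

Definition bit_cylinder n (D v : nat -> bool) a l : set R :=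
  [set x | forall i, (i < n)%N -> D i -> bit i a l x = v i].

Lemma measurable_bit_cylinder n D v a l : measurable (bit_cylinder n D v a l).
Proof.
have -> : bit_cylinder n D v a l =
    \bigcap_(i in [set i | (i < n)%N && D i]) (bit i a l @^-1` [set v i]).
  apply/seteqP; split => [x h i /= /andP[ni Di]|x h i ni Di]; first exact: h.
  by apply: (h i) => /=; rewrite ni.
apply: bigcap_measurableType => i _.
by rewrite -[X in measurable X]setTI; apply: measurable_bit.
Qed.

Lemma mu_itvco (a l : R) : 0 <= l -> mu `[a, (a + l)%R[ = l%:E.
Proof.
move=> l0; rewrite lebesgue_measure_itv/= lte_fin ltrDl.
case: ifPn => [_|]; first by rewrite -EFinB addrAC subrr add0r.
by rewrite -leNgt => l0'; congr EFin; apply/eqP; rewrite eq_le l0 l0'.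
Qed.

Lemma mu_bit_cylinder n D v a l : 0 <= l ->
  mu (`[a, (a + l)%R[ `&` bit_cylinder n D v a l) =
  (l * \prod_(i < n | D i) (if v i then p else 1 - p))%:E.
Proof.
have /andP[p0 p1] := p01.
elim: n D v a l => [|n IH] D v a l l0.
  have -> : bit_cylinder 0 D v a l = setT by apply/seteqP; split.
  by rewrite setIT big_ord0 mulr1 mu_itvco.
pose D' i := D i.+1; pose v' i := v i.+1.
pose A := `[a, (a + p * l)%R[ `&` bit_cylinder n D' v' a (p * l).
pose B := `[(a + p * l)%R, (a + p * l + (1 - p) * l)%R[ `&`
          bit_cylinder n D' v' (a + p * l) ((1 - p) * l).
have pl0 : 0 <= p * l by exact: mulr_ge0.
have ql0 : 0 <= (1 - p) * l by rewrite mulr_ge0// subr_ge0.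
have E : a + p * l + (1 - p) * l = a + l by rewrite -addrA -mulrDl subrKC mul1r.
have mA : measurable A.
  by apply: measurableI => //; exact: measurable_bit_cylinder.
have mB : measurable B.
  by apply: measurableI => //; exact: measurable_bit_cylinder.
have -> : `[a, (a + l)%R[ `&` bit_cylinder n.+1 D v a l =
    (if D 0%N && ~~ v 0%N then set0 else A) `|`
    (if D 0%N && v 0%N then set0 else B).
  apply/seteqP; split.
    move=> x [/=]; rewrite in_itv/= => /andP[ax xl] h.
    have [xp|xp] := ltP x (a + p * l).
      left; case: ifPn => [/andP[D0 v0]|_].
        by have := h 0%N isT D0; rewrite /= xp => /esym; apply/negP.
      split; first by rewrite /= in_itv/= ax.
      by move=> i ni Di; have := h i.+1 ni Di; rewrite /= xp.
    right; case: ifPn => [/andP[D0 v0]|_].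
      by have := h 0%N isT D0; rewrite /= ltNge xp v0.
    split; first by rewrite /= in_itv/= xp E.
    by move=> i ni Di; have := h i.+1 ni Di; rewrite /= ltNge xp.
  move=> x []; case: ifPn => // hD [/=]; rewrite in_itv/= => /andP[ax xl] h.
    split; first by rewrite /= in_itv/= ax (lt_le_trans xl)// -E lerDl.
    move=> [|i] ni Di /=; rewrite xl; last exact: h.
    by move: hD; rewrite Di /= negbK.
  split.
    by rewrite /= in_itv/= (le_trans _ ax) ?lerDl//= -E.
  move=> [|i] ni Di /=; rewrite ltNge ax/=; last exact: h.
  by move: hD; rewrite Di /=; case: (v 0%N).
have AB : A `&` B = set0.
  rewrite -subset0 => x [[/= + _] [/= + _]].
  rewrite !in_itv/= => /andP[_ xp] /andP[px _].
  by have := lt_le_trans xp px; rewrite ltxx.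
rewrite big_mkcond big_ord_recl -big_mkcond/=.
have muA : mu A = ((p * l) * \prod_(i < n | D' i) (if v' i then p else 1 - p))%:E.
  exact: IH.
have muB : mu B =
    (((1 - p) * l) * \prod_(i < n | D' i) (if v' i then p else 1 - p))%:E.
  exact: IH.
have muAB : mu (A `|` B) = (mu A + mu B)%E by exact: measureU.
case: (D 0%N); case: (v 0%N) => /=.
- by rewrite setU0; apply: (etrans muA); rewrite [p * l]mulrC -mulrA.
- rewrite (_ : set0 `|` B = B) ?set0U//; apply: (etrans muB).
  by rewrite [(1 - p) * l]mulrC -mulrA.
- apply: (etrans muAB); rewrite [X in (X + _)%E]muA.
  by rewrite [X in (_ + X)%E]muB -EFinD -!mulrDl subrKC !mul1r.
- apply: (etrans muAB); rewrite [X in (X + _)%E]muA.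
  by rewrite [X in (_ + X)%E]muB -EFinD -!mulrDl subrKC !mul1r.
Qed.

Let m01 : measurable (`[0, (0 + 1)%R[ : set (measurableTypeR R)).
Proof. exact: measurable_itv. Qed.

Let uniform01 := mrestr mu m01.

Let uniform01_setT : uniform01 setT = 1%E.
Proof. by rewrite /uniform01 /mrestr setTI mu_itvco. Qed.

HB.instance Definition _ := Measure.on uniform01.
HB.instance Definition _ :=
  Measure_isProbability.Build _ _ _ uniform01 uniform01_setT.

Variables (I : choiceType) (f : I -> nat).
Hypothesis f_inj : injective f.

Let code (x : measurableTypeR R) : config I := fun i => bit (f i) 0 1 x.

Let measurable_code : measurable_fun setT code.
Proof.
pose C := range (fun i : I => [set w : I -> bool | w i]).
apply: (@measurability _ _ _ (config I) setT code C) => // _ [_ [i _ <-] <-].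
exact: (@measurable_bit (f i) 0 1 measurableT [set true] Logic.I).
Qed.

HB.instance Definition _ := isMeasurableFun.Build _ _ _ _ code measurable_code.

Lemma bernoulli_product_exists_inj :
  exists P : probability (config I) R, bernoulli_product p P.
Proof.
exists (distribution uniform01 code) => J v uJ.
pose D n := n \in map f J.
pose u n := has (fun i => (f i == n) && v i) J.
have uf i : i \in J -> u (f i) = v i.
  move=> iJ; apply/hasP/idP => [[j _ /andP[/eqP/f_inj->//]]|vi].
  by exists i => //; rewrite eqxx.
pose n := (\max_(i <- J) f i).+1.
have fn i : i \in J -> (f i < n)%N by move=> iJ; rewrite ltnS leq_bigmax_seq.
have codeE : code @^-1` [set w | forall i, i \in J -> w i = v i] =
    bit_cylinder n D u 0 1.
  apply/seteqP; split => [x h k _ /mapP[i iJ ->]|x h i iJ].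
    by rewrite uf//; exact: h.
  by rewrite -uf//; apply: h; [exact: fn|exact: map_f].
transitivity (mu (bit_cylinder n D u 0 1 `&` `[0, (0 + 1)%R[)).
  by rewrite -codeE.
rewrite setIC; apply: (etrans (mu_bit_cylinder _ _ _ _ _)) => //.
rewrite mul1r; congr EFin.
rewrite -(big_mkord D (fun i => if u i then p else 1 - p)) -big_filter.
rewrite (perm_big (map f J)).
  by rewrite big_map; apply: eq_big_seq => i iJ; rewrite uf.
apply: uniq_perm; rewrite ?filter_uniq ?iota_uniq ?map_inj_uniq//.
move=> k; rewrite mem_filter mem_index_iota /D /=.
case: (boolP (k \in _)) => //= /mapP[i iJ ->].
exact: fn.
Qed.

End existence.

Lemma bernoulli_product_exists (R : realType) (I : choiceType) (p : R) :
  exists P : probability (config I) R,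
    countable [set: I] -> 0 <= p <= 1 -> bernoulli_product p P.
Proof.
have [[/countable_injP[f fi] p01]|h] :=
    pselect (countable [set: I] /\ 0 <= p <= 1).
  have f_inj : injective f by move=> i j; apply: fi; rewrite inE.
  by have [P hP] := bernoulli_product_exists_inj p01 f_inj; exists P.
by exists (dirac (point : config I)) => cI p01; case: h.
Qed.

(* Bernoulli(p) bond percolation on G. The choice is immaterial when E is
   countable and p is in [0, 1], as bernoulli_product then determines the
   measure; see bond_percolationP. *)
Definition bond_percolation (R : realType) (G : multigraph) (p : R) :
    probability (config (edge G)) R :=
  sval (cid (bernoulli_product_exists (edge G) p)).

Lemma countable_edges (G : multigraph) :
  connected_graph G -> locally_finite G -> countable [set: edge G].
Proof.
move=> cG lfG.
have [[x0 _]|noV] := pselect (exists x0 : vertex G, True); last first.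
  have -> : [set: edge G] = set0.
    by rewrite -subset0 => e _; apply: noV; exists (ends e).1.
  by apply: finite_set_countable; exact: finite_set0.
pose inc (x : vertex G) := [set e | exists y, joins e x y].
pose sphere := fix S n : set (vertex G) := if n is n'.+1 then
  \bigcup_(x in S n') \bigcup_(e in inc x) [set (ends e).1; (ends e).2]
  else [set x0].
have cinc x : countable (inc x).
  by apply: finite_set_countable; exact: lfG.
have cS n : countable (sphere n).
  elim: n => [|n IH] /=.
    by apply: finite_set_countable; exact: finite_set1.
  apply: bigcup_countable => // x _; apply: bigcup_countable => // e _.
  by apply: finite_set_countable; exact: finite_set2.
have walkS s : forall n x y, sphere n x -> open_walk (fun=> true) x s y ->
    exists m, sphere m y.
  elim: s => [n x y Sx /= <-|[e z] s IH n x y Sx /= [_ exz]]; first by exists n.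
  apply: (IH n.+1); exists x => //; exists e; first by exists z.
  by case: exz => -> /=; [right|left].
have -> : [set: edge G] = \bigcup_n \bigcup_(x in sphere n) inc x.
  apply/seteqP; split => // e _.
  have [s] := cG x0 (ends e).1.
  move=> /(walkS _ 0%N) => /(_ erefl)[m Sm]; exists m => //.
  exists (ends e).1 => //; exists (ends e).2; left.
  exact: surjective_pairing.
apply: bigcup_countable => // n _; exact: bigcup_countable.
Qed.

Lemma bond_percolationP (R : realType) (G : multigraph) (p : R) :
  connected_graph G -> locally_finite G -> 0 <= p <= 1 ->
  bernoulli_product p (bond_percolation G p).
Proof.
move=> cG lfG; rewrite /bond_percolation; case: cid => P /= hP.
exact: hP (countable_edges cG lfG).
Qed.

Section thresholds.
Variables (R : realType) (G : multigraph).
Local Notation P_ p := (@bond_percolation R G p).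

(* The probability, in \bar R, that x and y are joined by an open path. *)
Definition two_point (p : R) (x y : vertex G) : \bar R :=
  P_ p [set w | open_connected w x y].

Definition p_u : R :=
  inf [set p : R | 0 <= p <= 1 /\ {ae P_ p, forall w, unique_infinite_cluster w}].

Definition p_conn (o : vertex G) : R :=
  inf [set p : R | 0 <= p <= 1 /\ (0 < ereal_inf (range (two_point p o)))%E].

End thresholds.

(* Main.v *)
(* Suppose that [tau p x y >= c > 0] for all [x], [y] and [0 < p < 1].

   Closing the edges of a finite set [B] leaves vertices far from [B] connected with probability
   bounded below: otherwise many disjoint translates of [B] would, when closed, nearly separate
   two vertices, contradicting [tau >= c].

   If some [q < p] percolates, couple the two levels by sprinkling. By Schonmann's argument every
   infinite [p]-cluster contains an infinite [q]-cluster. Two infinite [q]-clusters, revealed in a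
   finite box up to far away, have by the above a fresh chance of being joined at level [p]; this
   recurs in ever larger boxes, so that almost surely they are joined. Hence at most one infinite
   cluster at [p].

   If no [q < p] percolates and there are several infinite clusters at [p], then there are
   trifurcations, and Burton and Keane's count gives exponential volume growth. For [q < p] close
   to [p], [tau q >= c / 4] up to a large distance [k], hence [tau q >= (c / 4) ^ n] up to distance
   [n k]; summing over the ball of radius [n k] contradicts the finite susceptibility at [q] that
   Duminil-Copin and Tassion's criterion provides (Hutchcroft's argument). Unimodularity plays no
   role.

   For the thresholds, uniqueness bounds [tau] below by Harris' inequality. Conversely a lower bound
   on [tau p o] makes [p] percolate, so that the argument above gives uniqueness at every [q > p]. *)

Require Import Defs.
From HB Require Import structures.
From mathcomp Require Import all_boot all_order all_algebra.
From mathcomp Require Import all_classical all_reals all_analysis.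
From mathcomp Require Import lra ring zify.
Set Implicit Arguments.
Unset Strict Implicit.
Unset Printing Implicit Defensive.
Import Order.TTheory GRing.Theory Num.Theory.
Import numFieldNormedType.Exports.
Local Open Scope classical_set_scope.
Local Open Scope ring_scope.

(** * Events *)

Section pr.
Context {d : measure_display} {T : measurableType d} {R : realType}.
Implicit Types (P : probability T R) (X Y Z : T -> Prop).

(** The obstacle to gluing is that the event of two clusters not being joined involves all edges, so
    that no exploration is independent of it. It is replaced by an approximation determined by a
    finite edge set [M0]; links are then sought off an arbitrary finite [M] containing [M0], with a
    bound that does not depend on [M]. Letting [M] exhaust the edges produces infinitely many
    disjoint opportunities, and freezing the lower level shows that sprinkling almost surely uses
    one of them. The link probability off [M] must therefore be bounded below uniformly in [M],
    although closing [M] has probability [(1 - p) ^+ size M]. The remedy is to let the number of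
    disjoint translates grow like the inverse of this probability: some translate is then likely to
    be closed, while the union bound over the translates stays below the assumed lower bound on the
    two-point function. *)

Definition mea X := measurable (X : set T).
Definition Pr P X : R := fine (P (X : set T)).

Lemma mea_ext X Y : (forall w, X w <-> Y w) -> mea X -> mea Y.
Proof. by move=> h; rewrite (_ : X = Y)//; apply/funext => w; apply/propext. Qed.

Lemma mea_cst (Q : Prop) : mea (fun=> Q).
Proof.
have [q|q] := pselect Q.
  by apply: (@mea_ext setT) => //; exact: measurableT.
by apply: (@mea_ext set0) => //; exact: measurable0.
Qed.

Lemma mea_and X Y : mea X -> mea Y -> mea (fun w => X w /\ Y w).
Proof. exact: measurableI. Qed.

Lemma mea_or X Y : mea X -> mea Y -> mea (fun w => X w \/ Y w).
Proof. exact: measurableU. Qed.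

Lemma mea_not X : mea X -> mea (fun w => ~ X w).
Proof. exact: measurableC. Qed.

Lemma mea_imp X Y : mea X -> mea Y -> mea (fun w => X w -> Y w).
Proof.
move=> mX mY; apply: (@mea_ext (fun w => ~ X w \/ Y w)).
  by move=> w; split=> [[]//|h]; have [/h|] := pselect (X w); tauto.
by apply: mea_or => //; exact: mea_not.
Qed.

Lemma mea_impl (Q : Prop) Y : (Q -> mea Y) -> mea (fun w => Q -> Y w).
Proof.
move=> h; have [q|q] := pselect Q.
  by apply: (@mea_ext Y); [move=> w; split=> // /(_ q)|exact: h].
by apply: (@mea_ext (fun=> True)) => //; exact: mea_cst.
Qed.

Lemma mea_ex (S : Type) (Q : S -> T -> Prop) : countable [set: S] ->
  (forall s, mea (Q s)) -> mea (fun w => exists s, Q s w).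
Proof.
move=> cS mQ; apply: (@mea_ext (\bigcup_(s in [set: S]) (Q s : set T))).
  by move=> w; split=> [[s _ h]|[s h]]; exists s.
by apply: countable_bigcupT_measurable.
Qed.

Lemma mea_all (S : Type) (Q : S -> T -> Prop) : countable [set: S] ->
  (forall s, mea (Q s)) -> mea (fun w => forall s, Q s w).
Proof.
move=> cS mQ; apply: (@mea_ext (fun w => ~ exists s, ~ Q s w)).
  move=> w; split=> [h s|h [s]//].
  by apply: contrapT => n; apply: h; exists s.
by apply: mea_not; apply: mea_ex => // s; exact: mea_not.
Qed.

Lemma mea_exn (Q : nat -> T -> Prop) :
  (forall s, mea (Q s)) -> mea (fun w => exists s, Q s w).
Proof. by apply: mea_ex. Qed.

Lemma mea_alln (Q : nat -> T -> Prop) :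
  (forall s, mea (Q s)) -> mea (fun w => forall s, Q s w).
Proof. by apply: mea_all. Qed.

Section one.
Variable P : probability T R.

Lemma PrE X : mea X -> P X = (Pr P X)%:E.
Proof. by move=> mX; rewrite /Pr fineK// fin_num_measure. Qed.

Lemma Pr_ge0 X : 0 <= Pr P X.
Proof. by apply: fine_ge0; apply: measure_ge0. Qed.

Lemma Pr_ext X Y : (forall w, X w <-> Y w) -> Pr P X = Pr P Y.
Proof. by move=> h; congr (Pr _ _); apply/funext => w; apply/propext. Qed.

Lemma Pr_mono X Y : mea X -> mea Y -> (forall w, X w -> Y w) ->
  Pr P X <= Pr P Y.
Proof.
by move=> mX mY h; rewrite -lee_fin -!PrE//; apply: le_measure; rewrite ?inE.
Qed.

Lemma Pr_true X : (forall w, X w) -> Pr P X = 1.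
Proof.
move=> h; rewrite /Pr (_ : (X : set T) = setT) ?probability_setT//.
by apply/seteqP; split.
Qed.

Lemma Pr_false X : (forall w, ~ X w) -> Pr P X = 0.
Proof.
move=> h; rewrite /Pr (_ : (X : set T) = set0) ?measure0//.
by apply/seteqP; split.
Qed.

Lemma Pr_le1 X : mea X -> Pr P X <= 1.
Proof.
move=> mX; rewrite -(@Pr_true (fun=> True))//; apply: Pr_mono => //.
exact: mea_cst.
Qed.

Lemma Pr_disj X Y : mea X -> mea Y -> (forall w, X w -> Y w -> False) ->
  Pr P (fun w => X w \/ Y w) = Pr P X + Pr P Y.
Proof.
move=> mX mY h; apply: EFin_inj; rewrite EFinD -!PrE//; last exact: mea_or.
apply: measureU => //; rewrite -subset0 => w [/h]; exact.
Qed.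

Lemma Pr_split Y X : mea X -> mea Y ->
  Pr P X = Pr P (fun w => X w /\ Y w) + Pr P (fun w => X w /\ ~ Y w).
Proof.
move=> mX mY; rewrite -Pr_disj.
- by apply: Pr_ext => w; have := pselect (Y w); tauto.
- exact: mea_and.
- by apply: mea_and => //; exact: mea_not.
- tauto.
Qed.

Lemma Pr_not X : mea X -> Pr P (fun w => ~ X w) = 1 - Pr P X.
Proof.
move=> mX; have := @Pr_split X (fun=> True) (mea_cst _) mX.
rewrite Pr_true// (@Pr_ext (fun w => True /\ X w) X); last by tauto.
by rewrite (@Pr_ext (fun w => True /\ ~ X w) (fun w => ~ X w)); [lra|tauto].
Qed.

Lemma Pr_or X Y : mea X -> mea Y ->
  Pr P (fun w => X w \/ Y w) <= Pr P X + Pr P Y.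
Proof.
move=> mX mY; rewrite (@Pr_split X) //; last exact: mea_or.
rewrite lerD //; apply: Pr_mono => //; try (by move=> w; tauto);
  by do ?[apply: mea_and|apply: mea_or|apply: mea_not].
Qed.

Lemma Pr_up (X : nat -> T -> Prop) e : (forall n, mea (X n)) ->
  (forall n w, X n w -> X n.+1 w) -> 0 < e ->
  exists n, Pr P (fun w => exists n, X n w) - e < Pr P (X n).
Proof.
move=> mX mono e0.
have nd : nondecreasing_seq (X : nat -> set T).
  apply/nondecreasing_seqP => n; apply/subsetPset => w; exact: mono.
have mU : measurable (\bigcup_n (X n : set T)) by exact: bigcupT_measurable.
have cv : (fun n => P (X n)) @ \oo --> (Pr P (fun w => exists n, X n w))%:E.
  rewrite -PrE; last exact: mea_exn.
  have -> : (fun w => exists n, X n w) = \bigcup_n (X n : set T).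
    by apply/funext => w; apply/propext; split=> [[n h]|[n _ h]]; exists n.
  exact: nondecreasing_cvg_mu mX mU nd.
move: cv => /fine_cvgP[_ /cvgrPdist_lt /(_ e e0)] [N _ /(_ N (leqnn N))].
by rewrite /= -/(Pr P (X N)) ltr_distlC => /andP[+ _]; exists N.
Qed.

Lemma Pr_down (X : nat -> T -> Prop) e : (forall n, mea (X n)) ->
  (forall n w, X n.+1 w -> X n w) -> 0 < e ->
  exists n, Pr P (X n) < Pr P (fun w => forall n, X n w) + e.
Proof.
move=> mX mono e0.
have [||n hn] := @Pr_up (fun n w => ~ X n w) e _ _ e0.
- by move=> n; apply: mea_not.
- by move=> n w h /mono.
exists n; move: hn; rewrite Pr_not//.
rewrite (@Pr_ext _ (fun w => ~ forall n, X n w)).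
  by rewrite Pr_not; [lra|exact: mea_alln].
by move=> w; split=> [[k h] /(_ k)//|/existsNP].
Qed.

Lemma Pr_down_ge (X : nat -> T -> Prop) b : (forall n, mea (X n)) ->
  (forall n w, X n.+1 w -> X n w) -> (forall n, b <= Pr P (X n)) ->
  b <= Pr P (fun w => forall n, X n w).
Proof.
move=> mX mono h; rewrite leNgt; apply/negP => lt.
have [|n] := Pr_down mX mono (e := b - Pr P (fun w => forall n, X n w)).
  by rewrite subr_gt0.
by rewrite addrC subrK ltNge h.
Qed.

(** Countable subadditivity, after an injection of [S] into the naturals: the fibre over [n]
    contributes one [Q s] or nothing. *)
Lemma Pr_ex_gt0 (S : Type) (Q : S -> T -> Prop) : countable [set: S] ->
  (forall s, mea (Q s)) -> 0 < Pr P (fun w => exists s, Q s w) ->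
  exists s, 0 < Pr P (Q s).
Proof.
move=> cS mQ; apply: contraPP => /forallNP h.
apply/negP; rewrite -leNgt -lee_fin -PrE; last exact: mea_ex.
suff -> : P (fun w => exists s, Q s w) = 0%E by [].
have -> : (fun w => exists s, Q s w) = \bigcup_(s in [set: S]) (Q s : set T).
  by apply/funext => w; apply/propext; split=> [[s h1]|[s _ h1]]; exists s.
have [f finj] := countable_injP _ cS.
have -> : \bigcup_(s in [set: S]) (Q s : set T) =
    \bigcup_n (\bigcup_(s in [set s | f s = n]) (Q s : set T)).
  apply/seteqP; split=> w.
    by move=> [s _ h1]; exists (f s) => //; exists s.
  by move=> [n _ [s _ h1]]; exists s.
have nulls n : P (\bigcup_(s in [set s | f s = n]) (Q s : set T)) = 0%E.
  have [[s sn]|no] := pselect (exists s, f s = n).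
    have -> : \bigcup_(s in [set s | f s = n]) (Q s : set T) = Q s.
      apply/seteqP; split=> w; last by exists s.
      move=> [s' /= s'n h1]; suff <- : s' = s by [].
      by apply: finj; rewrite ?inE// s'n sn.
    rewrite PrE//; congr EFin; apply/eqP; rewrite eq_le Pr_ge0 andbT.
    by rewrite leNgt; apply/negP; exact: h.
  have -> : \bigcup_(s in [set s | f s = n]) (Q s : set T) = set0.
    by apply/seteqP; split=> // w [s sn _]; case: no; exists s.
  by rewrite measure0.
apply/eqP; rewrite eq_le measure_ge0 andbT.
have mm n : measurable (\bigcup_(s in [set s | f s = n]) (Q s : set T)).
  rewrite bigcup_mkcond; apply: countable_bigcupT_measurable => // s.
  by case: ifP => _; [exact: mQ|exact: measurable0].
apply: le_trans (measure_sigma_subadditive _ _ _ _) _.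
- exact: mm.
- exact: bigcupT_measurable.
- exact: subset_refl.
by rewrite eseries0// => i _ _; exact: nulls.
Qed.

Lemma Pr_ex0 (S : Type) (Q : S -> T -> Prop) : countable [set: S] ->
  (forall s, mea (Q s)) -> (forall s, Pr P (Q s) = 0) ->
  Pr P (fun w => exists s, Q s w) = 0.
Proof.
move=> cS mQ h; apply/eqP; rewrite eq_le Pr_ge0 andbT leNgt; apply/negP.
by move=> /(Pr_ex_gt0 cS mQ)[s]; rewrite h ltxx.
Qed.

End one.
End pr.

(** * Independent coordinates *)

Section cylinders.
Context {I : choiceType}.
Implicit Types (J : seq I) (v : I -> bool) (A : set I).

Definition cyl J v : config I -> Prop := fun w => forall i, i \in J -> w i = v i.

Lemma mea_coord (i : I) : mea (fun w : config I => w i).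
Proof. by apply: sub_sigma_algebra; exists i. Qed.

Lemma mea_all_seq {d} {T : measurableType d} {S : eqType} (s : seq S)
    (Q : S -> T -> Prop) : (forall i, i \in s -> mea (Q i)) ->
  mea (fun w => forall i, i \in s -> Q i w).
Proof.
elim: s => [|i s IH] h.
  by apply: (@mea_ext _ _ (fun=> True)) => //; exact: mea_cst.
apply: (@mea_ext _ _ (fun w => Q i w /\ forall j, j \in s -> Q j w)).
  move=> w; split=> [[hi hs] j|hs].
    by rewrite inE => /orP[/eqP->|/hs].
  by split=> [|j js]; apply: hs; rewrite inE ?eqxx ?js ?orbT.
apply: mea_and; first by apply: h; rewrite inE eqxx.
by apply: IH => j js; apply: h; rewrite inE js orbT.
Qed.

Lemma mea_ex_seq {d} {T : measurableType d} {S : eqType} (s : seq S)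
    (Q : S -> T -> Prop) : (forall i, i \in s -> mea (Q i)) ->
  mea (fun w => exists2 i, i \in s & Q i w).
Proof.
move=> h; apply: (@mea_ext _ _ (fun w => ~ forall i, i \in s -> ~ Q i w)).
  move=> w; split=> [|[i i_s q] /(_ i i_s)//].
  by move=> /existsNP[i /not_implyP[i_s /contrapT q]]; exists i.
by apply: mea_not; apply: mea_all_seq => i i_s; apply: mea_not; exact: h.
Qed.

Lemma mea_coord_eq (i : I) (b : bool) : mea (fun w : config I => w i = b).
Proof.
case: b; first exact: mea_coord.
apply: (@mea_ext _ _ (fun w : config I => ~ w i)); last by apply: mea_not; exact: mea_coord.
by move=> w; split=> [/negP/negbTE|->].
Qed.

Lemma mea_cyl J v : mea (cyl J v).
Proof. by apply: mea_all_seq => i _; exact: mea_coord_eq. Qed.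

Lemma mea_pre {d} {T : measurableType d} (F : T -> config I) (X : config I -> Prop) :
  (forall i, mea (fun t => F t i)) -> mea X -> mea (fun t => X (F t)).
Proof.
move=> mF mX; have mFF : measurable_fun setT F.
  apply: (@measurability _ _ _ (config I) setT F
    (range (fun i : I => [set w : I -> bool | w i]))) => // _ [_ [i _ <-] <-].
  by rewrite setTI; exact: mF.
by have := mFF measurableT (X : set (config I)) mX; rewrite setTI.
Qed.

(** The empty set is included for closure under intersection: cylinders that disagree at a
    coordinate are disjoint. *)
Definition cyls : set (set (config I)) :=
  [set X | X = set0 \/ exists J v, uniq J /\ X = cyl J v].

Lemma cyls_gen : @measurable _ (config I) = <<s cyls >>.
Proof.
apply/seteqP; split.
- apply: smallest_sub; first exact: smallest_sigma_algebra.
  move=> _ [i _ <-]; apply: sub_sigma_algebra; right.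
  exists [:: i], (fun=> true); split=> //; apply/seteqP; split=> w /=.
    by move=> h j; rewrite inE => /eqP ->.
  by apply; rewrite inE.
- apply: smallest_sub; first exact: sigma_algebra_measurable.
  by move=> X [->|[J [v [_ ->]]]]; [exact: measurable0|exact: mea_cyl].
Qed.

Lemma cyls_setI : setI_closed cyls.
Proof.
move=> X Y [->|[J [v [uJ ->]]]]; first by move=> _; left; rewrite set0I.
move=> [->|[K [u [uK ->]]]]; first by left; rewrite setI0.
have [h|h] := pselect (exists i, [/\ i \in J, i \in K & v i <> u i]).
  left; case: h => i [iJ iK ne]; rewrite -subset0 => w [/(_ i iJ) + /(_ i iK)].
  by move=> ->.
right; exists (undup (J ++ K)), (fun i => if i \in J then v i else u i).
split; first exact: undup_uniq.
apply/seteqP; split=> w.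
  move=> [hJ hK] i; rewrite mem_undup mem_cat.
  by case: ifP => [iJ _|_ /= iK]; [exact: hJ|exact: hK].
move=> hw; split=> i iJ.
  by have := hw i; rewrite mem_undup mem_cat iJ; exact.
have := hw i; rewrite mem_undup mem_cat iJ orbT => /(_ isT) ->.
by case: ifP => // iJ'; apply: contrapT => ne; apply: h; exists i.
Qed.

(** Dynkin's theorem for the pi-system [cyls]. It serves both to identify laws and to approximate
    events. *)
Lemma law_ind (Q : set (config I) -> Prop) : Q set0 ->
  (forall J v, uniq J -> Q (cyl J v)) ->
  (forall S, mea S -> Q S -> Q (~` S)) ->
  (forall F : (set (config I))^nat, (forall n, mea (F n)) ->
     trivIset setT F -> (forall n, Q (F n)) -> Q (\bigcup_n F n)) ->
  forall X, mea X -> Q X.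
Proof.
move=> Q0 Qc QC QU X mX.
apply: (@dynkin_induction _ (config I) cyls Q).
- exact: cyls_gen.
- exact: cyls_setI.
- by rewrite -setC0; apply: QC => //; exact: measurable0.
- by move=> Y [->//|[J [v [uJ ->]]]]; exact: Qc.
- exact: QC.
- exact: QU.
- by rewrite -cyls_gen.
Qed.

End cylinders.

Section law.
Context {R : realType} {I : choiceType}.
Implicit Types (r : I -> R) (J : seq I) (v : I -> bool).
Implicit Types (A : set I) (P : probability (config I) R) (X Y : config I -> Prop).

(** The parameter may vary with the coordinate: a coupling carries one parameter for the lower level
    and another for the sprinkling. *)
Definition weight r J v : R := \prod_(i <- J) (if v i then r i else 1 - r i).

Definition blaw r P := forall J v, uniq J -> P (cyl J v : set _) = (weight r J v)%:E.

(** A law is determined by its values on cylinders. The total mass of [m] enters through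
    complements. *)
Lemma law_image {d} {T : measurableType d} (m : {measure set T -> \bar R})
    (F : T -> config I) r P : blaw r P -> m setT = 1%E ->
  (forall i, mea (fun t => F t i)) ->
  (forall J v, uniq J -> m (fun t => cyl J v (F t)) = (weight r J v)%:E) ->
  forall X, mea X -> m (fun t => X (F t)) = P X.
Proof.
move=> lP m1 mF mc; apply: law_ind.
- by rewrite (_ : (fun t => _) = set0) ?measure0//; apply/seteqP; split.
- by move=> J v uJ; rewrite mc// lP.
- move=> S mS e; rewrite probability_setC// -e.
  have mS' : mea (fun t => S (F t)) by exact: mea_pre.
  have -> : (fun t => (~` S) (F t)) = [set: T] `\` (fun t => S (F t)).
    by apply/seteqP; split=> t; [split|case].
  have mlt : (m setT < +oo)%E by rewrite m1 ltry.
  apply: (etrans (measureD measurableT mS' mlt)).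
  by rewrite setTI -m1.
- move=> G mG tG hG.
  have -> : (fun t => (\bigcup_n G n) (F t)) = \bigcup_n (fun t => G n (F t)).
    by apply/seteqP; split=> t [n _ h]; exists n.
  have mG' n : mea (fun t => G n (F t)) by exact: mea_pre.
  rewrite (measure_bigcup m _ (fun n => (fun t => G n (F t)) : set T)).
  + rewrite (measure_bigcup P _ G)//.
    by apply: eq_eseriesr => n _; exact: hG.
  + by move=> n _; exact: mG.
  + by move=> n _; exact: mG'.
  + move=> i j _ _ [t [hi hj]]; apply: (tG i j) => //.
    by exists (F t).
Qed.

(** Splicing two independent samples along [A] reproduces the law ([mix_law]). Independence then
    reads as a product measure ([indep]), and freezing the coordinates of [A] as Fubini's theorem
    ([null_mix]). *)
Definition mix A (w1 w2 : config I) : config I := fun i => if `[< A i >] then w1 i else w2 i.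

(** An implication suffices, since agreement on [A] is symmetric in [w] and [w']. *)
Definition dep A X := forall w w' : config I, (forall i, A i -> w i = w' i) -> X w -> X w'.

Lemma mixT A w1 w2 i : A i -> mix A w1 w2 i = w1 i.
Proof. by move=> h; rewrite /mix asboolT. Qed.

Lemma mixF A w1 w2 i : ~ A i -> mix A w1 w2 i = w2 i.
Proof. by move=> h; rewrite /mix asboolF. Qed.

Lemma weight_cat r A J v : uniq J ->
  weight r J v = weight r [seq i <- J | `[<A i>]] v * weight r [seq i <- J | ~~ `[<A i>]] v.
Proof. by move=> uJ; rewrite /weight (bigID (fun i => `[<A i>])) /= !big_filter. Qed.

Lemma mix_law A r P X : blaw r P -> mea X ->
  (P \x P)%E (fun z => X (mix A z.1 z.2)) = P X.
Proof.
move=> lP mX; pose F (z : config I * config I) := mix A z.1 z.2.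
have m1 : (P \x P)%E setT = 1%E :> \bar R.
  rewrite -setXTT; apply: (etrans (product_measure1E _ _ measurableT measurableT)).
  by rewrite -[RHS]mule1; congr (_ * _)%E; exact: probability_setT.
apply: (@law_image _ _ (P \x P)%E F r P lP m1) => //.
- move=> i; have [Ai|Ai] := pselect (A i).
    apply: (@mea_ext _ _ (fun z : config I * config I => is_true (z.1 i))); first by move=> z; rewrite /F mixT.
    have := @measurable_fst _ _ (config I) (config I) measurableT _ (mea_coord i).
    by rewrite setTI.
  apply: (@mea_ext _ _ (fun z : config I * config I => is_true (z.2 i))); first by move=> z; rewrite /F mixF.
  have := @measurable_snd _ _ (config I) (config I) measurableT _ (mea_coord i).
  by rewrite setTI.
- move=> J v uJ; rewrite (weight_cat r A)//.
  pose J1 := [seq i <- J | `[< A i >]]; pose J2 := [seq i <- J | ~~ `[< A i >]].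
  have -> : (fun t => cyl J v (F t)) = (cyl J1 v : set _) `*` (cyl J2 v : set _).
    apply/seteqP; split=> -[w1 w2] /=.
      move=> h; split=> i /=; rewrite mem_filter => /andP[Ai iJ]; rewrite -(h i iJ).
        by rewrite /F /mix /= Ai.
      by rewrite /F /mix /= (negbTE Ai).
    move=> [h1 h2] i iJ; rewrite /F /mix /=.
    by case: ifPn => Ai; [apply: h1|apply: h2]; rewrite mem_filter Ai.
  apply: (etrans (product_measure1E _ _ (mea_cyl J1 v) (mea_cyl J2 v))).
  by rewrite EFinM; congr (_ * _)%E; apply: lP; exact: filter_uniq.
Qed.

Lemma indep A r P X Y : blaw r P -> mea X -> mea Y -> dep A X -> dep (~` A) Y ->
  Pr P (fun w => X w /\ Y w) = Pr P X * Pr P Y.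
Proof.
move=> lP mX mY dX dY; apply: EFin_inj; rewrite EFinM -!PrE//; last exact: mea_and.
rewrite -(mix_law A lP); last exact: mea_and.
apply: etrans (product_measure1E P P mX mY); congr product_measure1.
apply/seteqP; split=> -[w1 w2] /= [h1 h2]; split.
- by apply: dX h1 => i Ai; rewrite mixT.
- by apply: dY h2 => i Ai; rewrite mixF.
- by apply: dX h1 => i Ai; rewrite mixT.
- by apply: dY h2 => i Ai; rewrite mixF.
Qed.

Lemma mea_mix A w1 X : mea X -> mea (fun w2 : config I => X (mix A w1 w2)).
Proof.
apply: mea_pre => i; have [Ai|Ai] := pselect (A i).
  apply: (@mea_ext _ _ (fun=> is_true (w1 i))); last exact: mea_cst.
  by move=> w; rewrite mixT.
apply: (@mea_ext _ _ (fun w : config I => is_true (w i))); last exact: mea_coord.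
by move=> w; rewrite mixF.
Qed.

Lemma null_mix A r P X : blaw r P -> mea X ->
  (forall w1, Pr P (fun w2 => X (mix A w1 w2)) = 0) -> Pr P X = 0.
Proof.
move=> lP mX h; rewrite /Pr -(mix_law A lP)// /product_measure1.
rewrite (_ : (fun x => _) = cst 0%E) ?integral0//.
apply/funext => w1 /=; rewrite (_ : xsection _ _ = (fun w2 => X (mix A w1 w2))).
  by rewrite PrE ?h//; exact: mea_mix.
by apply/seteqP; split=> w2; rewrite /xsection /= inE.
Qed.

Lemma depS A B X : A `<=` B -> dep A X -> dep B X.
Proof. by move=> AB dX w w' h; apply: dX => i /AB; exact: h. Qed.

Lemma dep_and A X Y : dep A X -> dep A Y -> dep A (fun w => X w /\ Y w).
Proof. by move=> dX dY w w' h [/(dX _ _ h) ? /(dY _ _ h)]. Qed.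

Lemma dep_not A X : dep A X -> dep A (fun w => ~ X w).
Proof. by move=> dX w w' h nX /dX-/(_ w) X'; apply: nX; apply: X' => i /h. Qed.

End law.

Section law2.
Context {R : realType} {I : choiceType} {r : I -> R}.
Context {P : probability (config I) R} (lP : blaw r P).
Implicit Types (J : seq I) (v : I -> bool) (A : set I) (X Y : config I -> Prop).

Definition sdiff X Y : config I -> Prop := fun w => (X w /\ ~ Y w) \/ (~ X w /\ Y w).

Lemma mea_sdiff X Y : mea X -> mea Y -> mea (sdiff X Y).
Proof. by move=> mX mY; apply: mea_or; apply: mea_and => //; exact: mea_not. Qed.

Definition approximable X := forall e : R, 0 < e ->
  exists J X', [/\ mea X', dep [set` J] X' & Pr P (sdiff X X') < e].

Lemma approx_not X : mea X -> approximable X -> approximable (fun w => ~ X w).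
Proof.
move=> mX aX e e0; have [J [X' [mX' dX' lt]]] := aX e e0.
exists J, (fun w => ~ X' w); split; [exact: mea_not|exact: dep_not|].
rewrite (@Pr_ext _ _ _ _ _ (sdiff X X'))// => w; rewrite /sdiff.
by have := pselect (X w); have := pselect (X' w); tauto.
Qed.

Lemma approx_or X Y : mea X -> mea Y -> approximable X -> approximable Y ->
  approximable (fun w => X w \/ Y w).
Proof.
move=> mX mY aX aY e e0; have e20 : 0 < e / 2 by lra.
have [J [X' [mX' dX' ltX]]] := aX _ e20; have [K [Y' [mY' dY' ltY]]] := aY _ e20.
exists (J ++ K), (fun w => X' w \/ Y' w); split; first exact: mea_or.
  move=> w w' h [h'|h']; [left; apply: dX' h'|right; apply: dY' h'] => i iJ;
    by apply: h; rewrite /= mem_cat; move: iJ => /= ->; rewrite ?orbT.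
apply: (@le_lt_trans _ _ (Pr P (fun w => sdiff X X' w \/ sdiff Y Y' w))).
  apply: Pr_mono => [||w]; last by rewrite /sdiff; tauto.
  - by apply: mea_sdiff; exact: mea_or.
  - by apply: mea_or; exact: mea_sdiff.
apply: le_lt_trans (Pr_or _ _ _) _; try exact: mea_sdiff.
by lra.
Qed.

(** Approximable events are stable under complements and finite unions, and a countable union is
    close to one of its finite subunions. *)
Lemma approximableP X : mea X -> approximable X.
Proof.
move: X; apply: law_ind.
- move=> e e0; exists [::], (fun=> False); split=> //; first exact: mea_cst.
  by rewrite Pr_false// => w []; case.
- move=> J v uJ e e0; exists J, (cyl J v); split; first exact: mea_cyl.
    by move=> w w' h c i iJ; rewrite -h//; exact: c.
  by rewrite Pr_false// => w []; case.
- by move=> S mS; apply: approx_not.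
- move=> F mF tF aF.
  pose G n : config I -> Prop := fun w => exists2 k, (k < n)%N & F k w.
  have GS n w : G n.+1 w <-> G n w \/ F n w.
    split=> [[k]|[[k kn h]|h]]; last by exists n.
      by rewrite ltnS leq_eqVlt => /orP[/eqP->|kn h]; [right|left; exists k].
    by exists k => //; rewrite ltnS ltnW.
  have mG n : mea (G n).
    elim: n => [|n IH].
      by apply: (@mea_ext _ _ (fun=> False)); [move=> w; split=> // -[]|exact: mea_cst].
    by apply: (@mea_ext _ _ (fun w => G n w \/ F n w)); [move=> w; rewrite GS|exact: mea_or].
  have aG n : approximable (G n).
    elim: n => [|n IH].
      move=> e e0; exists [::], (fun=> False); split=> //; first exact: mea_cst.
      by rewrite Pr_false// => w []; case=> // -[].
    have -> : G n.+1 = (fun w => G n w \/ F n w) by apply/funext => w; apply/propext.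
    exact: approx_or.
  move=> e e0; have e20 : 0 < e / 2 by lra.
  have GU w : (exists n, G n w) <-> (\bigcup_n F n) w.
    by split=> [[n [k _ h]]|[n _ h]]; [exists k|exists n.+1; exists n].
  have mU : mea (\bigcup_n F n) by exact: bigcupT_measurable.
  have [|n] := Pr_up P mG _ e20; first by move=> n w; rewrite GS; left.
  rewrite (@Pr_ext _ _ _ _ _ (\bigcup_n F n))// => hn.
  have [J [X' [mX' dX' lt]]] := aG n _ e20.
  exists J, X'; split=> //.
  have h1 : Pr P (fun w => (\bigcup_n F n) w /\ ~ G n w) < e / 2.
    have := Pr_split P mU (mG n).
    rewrite (@Pr_ext _ _ _ _ (fun w => _ /\ G n w) (G n)); first lra.
    by move=> w; split=> [[]//|h]; split=> //; apply/GU; exists n.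
  apply: (@le_lt_trans _ _ (Pr P (fun w => ((\bigcup_n F n) w /\ ~ G n w) \/ sdiff (G n) X' w))).
    apply: Pr_mono => [||w].
    + exact: mea_sdiff.
    + by apply: mea_or; [apply: mea_and => //; exact: mea_not|exact: mea_sdiff].
    + rewrite /sdiff; have := pselect (G n w); have := (GU w).1 ; have : G n w -> exists n, G n w by exists n.
      tauto.
  apply: le_lt_trans (Pr_or _ _ _) _.
  + by apply: mea_and => //; exact: mea_not.
  + exact: mea_sdiff.
  by lra.
Qed.

Lemma approxP X e : mea X -> 0 < e ->
  exists J X', [/\ mea X', dep [set` J] X' & Pr P (sdiff X X') < e].
Proof. by move=> mX; exact: approximableP. Qed.

(** Kolmogorov's law: [X] is close to an event on finitely many coordinates, of which it is
    independent, so its probability is at most its own square. *)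
Lemma zero_one X : mea X -> (forall J, dep (~` [set` J]) X) ->
  Pr P X = 0 \/ Pr P X = 1.
Proof.
move=> mX tX; have x0 := Pr_ge0 P X; have x1 := Pr_le1 P mX.
suff h : Pr P X <= Pr P X * Pr P X.
  have [|nz] := eqVneq (Pr P X) 0; [by left|right].
  apply/le_anti/andP; split=> //.
  have xp : 0 < Pr P X by rewrite lt_def nz.
  by rewrite -(ler_pM2l xp) mulr1.
apply/ler_addgt0Pr => e e0; have e20 : 0 < e / 2 by lra.
have [J [X' [mX' dX' lt]]] := approxP mX e20.
have i1 := indep lP mX' mX dX' (tX J).
have m1 : mea (fun w => X' w /\ X w) by exact: mea_and.
have ms : mea (sdiff X X') by exact: mea_sdiff.
have h1 : Pr P X <= Pr P (fun w => X' w /\ X w) + Pr P (sdiff X X').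
  apply: le_trans (Pr_or _ m1 ms); apply: Pr_mono => //; first exact: mea_or.
  by move=> w; rewrite /sdiff; have := pselect (X' w); tauto.
have h2 : Pr P X' <= Pr P X + Pr P (sdiff X X').
  apply: le_trans (Pr_or _ mX ms); apply: Pr_mono => //; first exact: mea_or.
  by move=> w; rewrite /sdiff; have := pselect (X w); tauto.
have h3 : Pr P X' * Pr P X <= (Pr P X + Pr P (sdiff X X')) * Pr P X by exact: ler_wpM2r.
have h4 : Pr P (sdiff X X') * Pr P X <= Pr P (sdiff X X').
  by rewrite ler_piMr// Pr_ge0.
by move: h1 h3; rewrite i1 mulrDl; lra.
Qed.

Lemma Pr_cyl J v : uniq J -> Pr P (cyl J v) = weight r J v.
Proof. by move=> uJ; rewrite /Pr lP. Qed.

Lemma Pr_coord i : Pr P (fun w => w i) = r i.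
Proof.
rewrite (@Pr_ext _ _ _ _ _ (cyl [:: i] (fun=> true))) ?Pr_cyl//.
  by rewrite /weight big_seq1.
by move=> w; split=> [h j|]; [rewrite inE => /eqP->|apply; rewrite inE].
Qed.

Lemma r01 i : 0 <= r i <= 1.
Proof. by rewrite -Pr_coord Pr_ge0 Pr_le1//; exact: mea_coord. Qed.

Lemma weight_true_ge J q : 0 <= q -> (forall i, i \in J -> q <= r i) ->
  q ^+ size J <= weight r J (fun=> true).
Proof.
move=> q0; rewrite /weight; elim: J => [|i J IH] h; first by rewrite big_nil.
rewrite big_cons /= exprS ler_pM ?exprn_ge0//; first by apply: h; rewrite inE eqxx.
by apply: IH => j jJ; apply: h; rewrite inE jJ orbT.
Qed.

Lemma weight_const J (p : R) b : (forall i, i \in J -> r i = p) ->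
  weight r J (fun=> b) = (if b then p else 1 - p) ^+ size J.
Proof.
rewrite /weight; elim: J => [|i J IH] h; first by rewrite big_nil.
rewrite big_cons /= exprS h ?inE ?eqxx// IH// => j jJ.
by apply: h; rewrite inE jJ orbT.
Qed.

Lemma le_geometric_eq0 (x y : R) : 0 <= x -> 0 <= y < 1 ->
  (forall n, x <= y ^+ n) -> x = 0.
Proof.
move=> x0 /andP[y0 y1] h; apply/le_anti; rewrite x0 andbT.
have c : (fun n => y ^+ n) @ \oo --> (0 : R) by apply: cvg_expr; rewrite ger0_norm.
have cx : (fun=> x) @ \oo --> x by exact: cvg_cst.
by apply: (ler_cvg_to cx c); apply: nearW.
Qed.

(* [tr w T] only depends on the coordinates off [S]. Freezing these, [N] forces each of infinitely
   many disjoint sets [T] of bounded size to contain a closed coordinate. *)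
Lemma null_hits (S : set I) (q : R) (N : config I -> Prop) (tr : config I -> seq I -> Prop) :
  0 < q -> q <= 1 -> (forall i, S i -> q <= r i) -> mea N ->
  (forall T, dep (~` S) (tr^~ T)) ->
  (forall w (M : seq I), N w -> exists T, [/\ (size T <= 2)%N, (forall i, i \in T -> S i),
     (forall i, i \in T -> i \notin M) & tr w T]) ->
  (forall w T, N w -> tr w T -> exists2 i, i \in T & ~~ w i) ->
  Pr P N = 0.
Proof.
move=> q0 q1 Sr mN dtr exT hit; apply: (null_mix lP (A := ~` S)) => // w1.
set N1 := (fun w2 : config I => _).
have mN1 : mea N1 by exact: mea_mix.
have [[w2s N1s]|noN] := pselect (exists w2, N1 w2); last first.
  by apply: Pr_false => w h; apply: noN; exists w.
have agree w2 w2' i : (~` S) i -> mix (~` S) w1 w2 i = mix (~` S) w1 w2' i.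
  by move=> h; rewrite !mixT.
(* At most two coordinates, each open with probability at least [q], are simultaneously open with
   probability at least [q ^+ 2]. *)
apply: (@le_geometric_eq0 _ (1 - q ^+ 2)); first exact: Pr_ge0.
  have : 0 < q ^+ 2 by exact: exprn_gt0.
  have : q ^+ 2 <= 1 by apply: exprn_ile1; lra.
  by move=> ? ?; apply/andP; split; lra.
suff h n : exists (M : seq I) (G : config I -> Prop), [/\ mea G, dep [set` M] G, (forall w2, N1 w2 -> G w2) &
    Pr P G <= (1 - q ^+ 2) ^+ n].
  move=> n; have [M [G [mG _ NG le]]] := h n.
  exact: le_trans (Pr_mono _ mN1 mG NG) le.
elim: n => [|n [M [G [mG dG NG le]]]].
  exists [::], (fun=> True); split=> //; first exact: mea_cst.
  by rewrite expr0 Pr_true.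
(* [tr] ignores the coordinates in [S], and the others are frozen to [w1]: the set found for the
   single witness [w2s] serves for every [w2]. *)
have [T [sT ST TM trT]] := exT _ M N1s.
pose H (w : config I) := exists2 i, i \in T & ~~ w i.
have mH : mea H.
  apply: mea_ex_seq => i _; apply: (@mea_ext _ _ (fun w : config I => ~ w i)).
    by move=> w; split=> /negP.
  by apply: mea_not; exact: mea_coord.
exists (M ++ T), (fun w => G w /\ H w); split.
- exact: mea_and.
- apply: dep_and.
    by apply: depS dG => i /= iM; rewrite mem_cat iM.
  move=> w w' h [i iT nw]; exists i => //.
  by rewrite -h//= mem_cat iT orbT.
- move=> w2 Nw2; split; first exact: NG.
  have [|i iT nw] := hit _ T Nw2; first by apply: dtr trT => i; exact: agree.
  by exists i => //; move: nw; rewrite mixF//; move=> /(_ (ST i iT)).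
- have dH : dep (~` [set` M]) H.
    move=> w w' h [i iT nw]; exists i => //.
    by rewrite -h//=; apply/negP; exact: TM.
  rewrite (indep lP mG mH dG dH) exprSr ler_pM ?Pr_ge0//.
  rewrite (@Pr_ext _ _ _ _ _ (fun w => ~ cyl (undup T) (fun=> true) w)); last first.
    move=> w; split=> [[i iT nw] /(_ i)|/existsNP[i /not_implyP[]]].
      by rewrite mem_undup => /(_ iT); exact/negP.
    by rewrite mem_undup => iT /negP nw; exists i.
  rewrite Pr_not ?Pr_cyl ?undup_uniq//; last exact: mea_cyl.
  rewrite lerD2l lerN2; apply: le_trans (weight_true_ge (ltW q0) _).
    have le2 : (size (undup T) <= 2)%N by exact: leq_trans (size_undup T) sT.
    by apply: ler_wiXn2l => //; exact: ltW.
  by move=> i; rewrite mem_undup => /ST /Sr.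
Qed.

End law2.

(** * Harris' inequality and explorations *)

Section maps.
Context {R : realType} {I I' : choiceType} {r : I -> R} {r' : I' -> R}.
Context {P : probability (config I) R} {P' : probability (config I') R}.
Context (lP : blaw r P) (lP' : blaw r' P').

(** The coordinates of the image read disjoint sets [A i'] of coordinates, hence are independent,
    and their marginals are prescribed. *)
Lemma law_map (F : config I -> config I') (A : I' -> set I) :
  (forall i', mea (fun w => F w i')) ->
  (forall i', dep (A i') (fun w => F w i')) ->
  (forall i' j', i' <> j' -> A i' `&` A j' = set0) ->
  (forall i', Pr P (fun w => F w i') = r' i') ->
  forall X, mea X -> Pr P (fun w => X (F w)) = Pr P' X.
Proof.
move=> mF dF dA PF X mX; rewrite /Pr; congr fine.
apply: (law_image (m := P) lP') => //; first exact: probability_setT.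
have mFv i' b : mea (fun w => F w i' = b).
  case: b; first exact: mF.
  by apply: (@mea_ext _ _ (fun w => ~ F w i')); [move=> w; split=> [/negP/negbTE|->]|exact: mea_not].
have dFv i' b : dep (A i') (fun w => F w i' = b).
  case: b; first exact: dF.
  move=> w w' h /negbT nw; apply/negbTE/negP => Fw'; move/negP: nw; apply.
  by apply: dF Fw' => i /h.
elim=> [|i' J IH] v.
  move=> _; rewrite /weight big_nil.
  have -> : (fun w => cyl [::] v (F w)) = setT by apply/seteqP; split.
  exact: probability_setT.
move=> /= /andP[iJ uJ]; rewrite /weight big_cons -/(weight r' J v).
have mY : mea (fun w => cyl J v (F w)).
  by apply: mea_all_seq => i _; exact: mFv.
have -> : (fun w => cyl (i' :: J) v (F w)) = (fun w => F w i' = v i' /\ cyl J v (F w)).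
  apply/funext => w; apply/propext; split=> [h|[h1 h2] j].
    by split=> [|j jJ]; apply: h; rewrite inE ?eqxx ?jJ ?orbT.
  by rewrite inE => /orP[/eqP->|/h2].
rewrite (PrE P (mea_and (mFv i' (v i')) mY)) (indep (A := A i') lP) //.
- rewrite EFinM -(PrE _ mY) EFinM; congr (_ * _)%E; last exact: IH.
  case: (v i'); first by rewrite PF.
  rewrite (@Pr_ext _ _ _ _ _ (fun w => ~ F w i')) ?Pr_not ?PF//.
  by move=> w; split=> [/negbT/negP|/negP/negbTE].
- move=> w w' h c j jJ; rewrite -(c j jJ); apply/esym.
  have hj i : A j i -> w i = w' i.
    move=> Aj; apply: h => Ai'; have := dA i' j; case: (eqVneq i' j) => [e|/eqP ne /(_ ne) e].
      by move: iJ; rewrite e jJ.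
    by have : (A i' `&` A j) i by []; rewrite e.
  apply/esym; case Fw : (F w j); first exact: (dF j w w' hj Fw).
  apply/negbTE/negP => Fw'; move/negP: (negbT Fw); apply.
  by apply: dF Fw' => i /hj.
Qed.

End maps.

Section law3.
Context {R : realType} {I : choiceType} {r : I -> R}.
Context {P : probability (config I) R} (lP : blaw r P).
Implicit Types (J : seq I) (v : I -> bool) (A : set I) (X Y : config I -> Prop).

Definition rst A (w : config I) : config I := fun i => w i && `[< A i >].

Lemma mea_rst A X : mea X -> mea (fun w => X (rst A w)).
Proof.
apply: mea_pre => i; apply: (@mea_ext _ _ (fun w : config I => w i /\ A i)).
  by move=> w; rewrite /rst; split=> [[-> /asboolP]|/andP[? /asboolP]].
by apply: mea_and; [exact: mea_coord|exact: mea_cst].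
Qed.

Lemma dep_rst A X : dep A (fun w => X (rst A w)).
Proof.
move=> w w' h; suff -> : rst A w = rst A w' by [].
apply/funext => i; rewrite /rst; have [Ai|nAi] := pselect (A i).
  by rewrite h.
by rewrite (asboolF nAi) !andbF.
Qed.

Definition allclosed J : config I -> Prop := fun w => forall i, i \in J -> ~~ w i.

Lemma rst_closed J w : allclosed J w -> rst (~` [set` J]) w = w.
Proof.
move=> c; apply/funext => i; rewrite /rst; have [iJ|iJ] := boolP (i \in J).
  by rewrite (negbTE (c i iJ)).
by rewrite asboolT ?andbT//=; apply/negP.
Qed.

Lemma mea_allclosed J : mea (allclosed J).
Proof.
apply: mea_all_seq => i _; apply: (@mea_ext _ _ (fun w : config I => ~ w i)).
  by move=> w; split=> /negP.
by apply: mea_not; exact: mea_coord.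
Qed.

Lemma dep_allclosed J : dep [set` J] (allclosed J).
Proof. by move=> w w' h c i iJ; rewrite -h//; exact: c. Qed.

Lemma Pr_allclosed J : uniq J -> Pr P (allclosed J) = weight r J (fun=> false).
Proof.
move=> uJ; rewrite -(Pr_cyl lP)//; apply: Pr_ext => w.
by split=> h i iJ; [apply/negbTE; exact: h|rewrite h].
Qed.

(** When [J] is closed, restricting the configuration off [J] changes nothing, and the restricted
    event is independent of the closing. *)
Lemma Pr_closed J X : uniq J -> mea X ->
  Pr P (fun w => allclosed J w /\ X w) =
  weight r J (fun=> false) * Pr P (fun w => X (rst (~` [set` J]) w)).
Proof.
move=> uJ mX; rewrite -Pr_allclosed//.
rewrite -(indep lP (mea_allclosed J) (mea_rst _ mX) (@dep_allclosed J)); last exact: dep_rst.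
by apply: Pr_ext => w; split=> -[c]; rewrite rst_closed.
Qed.

Definition up (X : config I -> Prop) := forall w w' : config I,
  (forall i, w i -> w' i) -> X w -> X w'.

Definition upd i b (w : config I) : config I := fun j => if j == i then b else w j.

Lemma mea_upd i b X : mea X -> mea (fun w => X (upd i b w)).
Proof.
apply: mea_pre => j; rewrite /upd; case: eqVneq => _; first exact: mea_cst.
exact: mea_coord.
Qed.

Lemma Pr_upd i X : mea X -> Pr P X = r i * Pr P (fun w => X (upd i true w)) +
  (1 - r i) * Pr P (fun w => X (upd i false w)).
Proof.
move=> mX; rewrite -{1 2}(Pr_coord lP i) -Pr_not; last exact: mea_coord.
have d1 : dep [set i] (fun w : config I => w i) by move=> w w' h; rewrite h.
have dX b : dep (~` [set i]) (fun w => X (upd i b w)).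
  move=> w w' h; suff -> : upd i b w = upd i b w' by [].
  by apply/funext => j; rewrite /upd; case: eqVneq => // /eqP ji; exact: h.
have mi := @mea_coord I i; have mni := mea_not mi.
rewrite -(indep lP mi (mea_upd i true mX) d1 (dX true)).
rewrite -(indep lP mni (mea_upd i false mX) (dep_not d1) (dX false)).
rewrite -Pr_disj; [|exact: mea_and (mea_upd _ _ _)|exact: mea_and (mea_upd _ _ _)|tauto].
have uE (w : config I) : upd i (w i) w = w.
  by apply/funext => j; rewrite /upd; case: eqVneq => // ->.
apply: Pr_ext => w; rewrite -{1}(uE w); case: (w i); split=> //.
- by left.
- by case=> -[].
- by right; split.
- by case=> -[].
Qed.

Lemma harris_fin J X Y : mea X -> mea Y -> dep [set` J] X -> dep [set` J] Y ->
  up X -> up Y -> Pr P X * Pr P Y <= Pr P (fun w => X w /\ Y w).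
Proof.
elim: J X Y => [|i J IH] X Y mX mY dX dY uX uY.
  have [x|nx] := pselect (exists w, X w).
    case: x => w0 x0; have xT w : X w by apply: dX x0.
    rewrite (@Pr_true _ _ _ P X)// mul1r (@Pr_ext _ _ _ _ (fun w => X w /\ Y w) Y)//.
    by move=> w; split=> [[]//|]; split.
  by rewrite (@Pr_false _ _ _ P X) ?mul0r ?Pr_ge0// => w h; apply: nx; exists w.
have mXY : mea (fun w => X w /\ Y w) by exact: mea_and.
rewrite (Pr_upd i mX) (Pr_upd i mY) (Pr_upd i mXY).
have dU b Z : dep [set` i :: J] Z -> dep [set` J] (fun w => Z (upd i b w)).
  move=> dZ w w' h; apply: dZ => j; rewrite /= inE /upd.
  by case: eqVneq => //= _ jJ; exact: h.
have uU b Z : up Z -> up (fun w => Z (upd i b w)).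
  move=> uZ w w' h; apply: uZ => j; rewrite /upd; case: eqVneq => // _; exact: h.
have le Z : mea Z -> up Z -> Pr P (fun w => Z (upd i false w)) <= Pr P (fun w => Z (upd i true w)).
  move=> mZ uZ; apply: Pr_mono; [exact: mea_upd|exact: mea_upd|].
  by move=> w; apply: uZ => j; rewrite /upd; case: eqVneq.
have IH1 := IH _ _ (mea_upd i true mX) (mea_upd i true mY) (dU true _ dX) (dU true _ dY)
  (uU true _ uX) (uU true _ uY).
have IH0 := IH _ _ (mea_upd i false mX) (mea_upd i false mY) (dU false _ dX) (dU false _ dY)
  (uU false _ uX) (uU false _ uY).
have leX := le _ mX uX; have leY := le _ mY uY.
have /andP[r0 r1] := r01 lP i.
move: IH0 IH1 leX leY.
set x0 := Pr P _; set y0 := Pr P _; set z0 := Pr P _.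
set x1 := Pr P _; set y1 := Pr P _; set z1 := Pr P _ => h0 h1 hx hy.
have a : 0 <= r i * (z1 - x1 * y1) by rewrite mulr_ge0// subr_ge0.
have b : 0 <= (1 - r i) * (z0 - x0 * y0) by rewrite mulr_ge0 ?subr_ge0.
(* Chebyshev's correlation inequality for the two values of coordinate [i]. *)
have c : 0 <= (r i * (1 - r i)) * ((x1 - x0) * (y1 - y0)).
  by rewrite !mulr_ge0 ?subr_ge0.
by nra.
Qed.

Definition harris X Y := Pr P X * Pr P Y <= Pr P (fun w => X w /\ Y w).

Lemma harris_sym X Y : harris X Y -> harris Y X.
Proof.
by rewrite /harris mulrC (@Pr_ext _ _ _ _ (fun w => Y w /\ X w) (fun w => X w /\ Y w)) => // w; tauto.
Qed.

Lemma harris_up (X : nat -> config I -> Prop) Y : (forall n, mea (X n)) -> mea Y ->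
  (forall n w, X n w -> X n.+1 w) -> (forall n, harris (X n) Y) ->
  harris (fun w => exists n, X n w) Y.
Proof.
move=> mX mY mono h; apply/ler_addgt0Pr => e e0.
have [n hn] := Pr_up P mX mono e0.
have y0 := Pr_ge0 P Y; have y1 := Pr_le1 P mY.
have := h n; rewrite /harris => hN.
have le : Pr P (fun w => X n w /\ Y w) <= Pr P (fun w => (exists n, X n w) /\ Y w).
  apply: Pr_mono; [exact: mea_and|by apply: mea_and => //; exact: mea_exn|].
  by move=> w [x y]; split=> //; exists n.
have : Pr P (fun w => exists n, X n w) * Pr P Y <= (Pr P (X n) + e) * Pr P Y.
  by rewrite ler_wpM2r//; lra.
have : e * Pr P Y <= e by rewrite ler_piMr// ltW.
by rewrite mulrDl; lra.
Qed.

Lemma harris_down (X : nat -> config I -> Prop) Y : (forall n, mea (X n)) -> mea Y ->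
  (forall n w, X n.+1 w -> X n w) -> (forall n, harris (X n) Y) ->
  harris (fun w => forall n, X n w) Y.
Proof.
move=> mX mY mono h.
rewrite /harris (@Pr_ext _ _ _ _ (fun w => (forall n, X n w) /\ Y w)
  (fun w => forall n, X n w /\ Y w)); last first.
  by move=> w; split=> [[x y] n|xy]; split=> // [n|]; [have [] := xy n|have [] := xy 0%N].
apply: Pr_down_ge => [n|n w [/mono]|n]; [exact: mea_and|by []|].
apply: le_trans (h n); rewrite ler_wpM2r ?Pr_ge0//.
by apply: Pr_mono => //; exact: mea_alln.
Qed.

(** * Conditioning on an exploration with finitely many outcomes *)

Section explore.
Context {K : eqType} (C : config I -> K) (L : seq K) (A : K -> set I) (J : set I).
Context (Lk : K -> config I -> Prop) (D : config I -> Prop) (Q : K -> Prop) (e : R).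
Hypothesis CL : forall w, C w \in L.
Hypothesis mC : forall k, mea (fun w => C w = k).
Hypothesis dC : forall k, dep (A k) (fun w => C w = k).
Hypothesis mD : mea D.
Hypothesis dD : dep J D.
Hypothesis mLk : forall k, mea (Lk k).
Hypothesis dLk : forall k, dep (~` (A k `|` J)) (Lk k).

Lemma mea_code (F : K -> config I -> Prop) : (forall k, mea (F k)) ->
  mea (fun w => F (C w) w).
Proof.
move=> mF; apply: (@mea_ext _ _ (fun w => exists2 k, k \in L & C w = k /\ F k w)).
  by move=> w; split=> [[k _ [-> ]]//|h]; exists (C w).
by apply: mea_ex_seq => k _; apply: mea_and.
Qed.

(* Conditionally on the explored value [k], the event [Lk k] only involves fresh coordinates. *)
Lemma explore_ge : (forall w, Q (C w) -> e <= Pr P (Lk (C w))) ->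
  e * Pr P (fun w => D w /\ Q (C w)) <= Pr P (fun w => D w /\ Q (C w) /\ Lk (C w) w).
Proof.
move=> h.
(* The outcomes are split off one at a time; [uniq l] makes the pieces disjoint. *)
suff S : forall l : seq K, uniq l -> e * Pr P (fun w => (D w /\ Q (C w)) /\ C w \in l) <=
    Pr P (fun w => (D w /\ Q (C w) /\ Lk (C w) w) /\ C w \in l).
  have := S _ (undup_uniq L).
  rewrite (@Pr_ext _ _ _ _ _ (fun w => D w /\ Q (C w))); last first.
    by move=> w; rewrite mem_undup CL; split=> [[]//|].
  rewrite (@Pr_ext _ _ _ _ (fun w => (D w /\ Q (C w) /\ Lk (C w) w) /\ _)
    (fun w => D w /\ Q (C w) /\ Lk (C w) w))//.
  by move=> w; rewrite mem_undup CL; split=> [[]//|].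
have mQ : mea (fun w => Q (C w)) by apply: (@mea_code (fun k _ => Q k)) => k; exact: mea_cst.
have mLC : mea (fun w => Lk (C w) w) by exact: mea_code.
have ml (l : seq K) : mea (fun w => C w \in l).
  by apply: (@mea_code (fun k _ => k \in l)) => k; exact: mea_cst.
elim=> [_|k l' IH /= /andP[kl ul]].
  by rewrite !Pr_false ?mulr0// => w [].
have e1 : Pr P (fun w => (D w /\ Q (C w)) /\ C w \in k :: l') =
    Pr P (fun w => (D w /\ Q k) /\ C w = k) + Pr P (fun w => (D w /\ Q (C w)) /\ C w \in l').
  rewrite -Pr_disj.
  - apply: Pr_ext => w; rewrite inE; split.
      by move=> [h1 /orP[/eqP e1|h2]]; [left; rewrite -e1|right].
    by move=> [[[d q] e1]|[h1 h2]]; [rewrite e1 eqxx|rewrite h2 orbT].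
  - by apply: mea_and; [apply: mea_and => //; exact: mea_cst|exact: mC].
  - by do 2 apply: mea_and => //.
  - by move=> w [_ ->] [_]; rewrite (negbTE kl).
have e2 : Pr P (fun w => (D w /\ Q (C w) /\ Lk (C w) w) /\ C w \in k :: l') =
    Pr P (fun w => (D w /\ Q k /\ Lk k w) /\ C w = k) +
    Pr P (fun w => (D w /\ Q (C w) /\ Lk (C w) w) /\ C w \in l').
  rewrite -Pr_disj.
  - apply: Pr_ext => w; rewrite inE; split.
      by move=> [h1 /orP[/eqP e2|h2]]; [left; rewrite -e2|right].
    by move=> [[[d [q k']] e3]|[h1 h2]]; [rewrite e3 eqxx|rewrite h2 orbT].
  - by do 2 (apply: mea_and => //); apply: mea_and; [exact: mea_cst|exact: mLk].
  - by do 3 apply: mea_and => //.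
  - by move=> w [_ ->] [_]; rewrite (negbTE kl).
rewrite e1 e2 mulrDr lerD ?IH//.
have [q|nq] := pselect (Q k); last by rewrite !Pr_false ?mulr0 => // w; tauto.
have [[w0 w0k]|nk] := pselect (exists w, C w = k); last first.
  by rewrite !Pr_false ?mulr0 => // w [_ h']; apply: nk; exists w.
have mk := mC k; have mDk : mea (fun w => D w /\ C w = k) by exact: mea_and.
rewrite (@Pr_ext _ _ _ _ _ (fun w => D w /\ C w = k)); last by move=> w; tauto.
rewrite (@Pr_ext _ _ _ _ (fun w => (D w /\ Q k /\ _) /\ _) (fun w => (D w /\ C w = k) /\ Lk k w)); last by move=> w; tauto.
have dd : dep (A k `|` J) (fun w => D w /\ C w = k).
  by move=> w w' hh [d c]; split; [apply: dD d|apply: dC c] => i Ai; apply: hh; [right|left].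
rewrite (indep lP mDk (mLk k) dd (@dLk k)) mulrC ler_wpM2l ?Pr_ge0//.
by rewrite -w0k; apply: h; rewrite w0k.
Qed.

End explore.

(** [explore_ge] for the complementary events with [1 - e]. *)
Lemma explore_le {K : eqType} (C : config I -> K) (L : seq K) (A : K -> set I) (J : set I)
    (Lk : K -> config I -> Prop) (D : config I -> Prop) (Q : K -> Prop) (e : R) :
  (forall w, C w \in L) -> (forall k, mea (fun w => C w = k)) ->
  (forall k, dep (A k) (fun w => C w = k)) -> mea D -> dep J D ->
  (forall k, mea (Lk k)) -> (forall k, dep (~` (A k `|` J)) (Lk k)) ->
  (forall w, Q (C w) -> Pr P (Lk (C w)) <= e) ->
  Pr P (fun w => D w /\ Q (C w) /\ Lk (C w) w) <= e * Pr P (fun w => D w /\ Q (C w)).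
Proof.
move=> CL mC dC mD dD mLk dLk h.
have H := @explore_ge K C L A J (fun k w => ~ Lk k w) D Q (1 - e) CL mC dC mD dD
  (fun k => mea_not (mLk k)) (fun k => dep_not (@dLk k)).
have mQ : mea (fun w => Q (C w)).
  by apply: (mea_code CL mC (F := fun k _ => Q k)) => k; exact: mea_cst.
have mLC : mea (fun w => Lk (C w) w) by exact: (mea_code CL mC).
have E : Pr P (fun w => D w /\ Q (C w)) = Pr P (fun w => D w /\ Q (C w) /\ Lk (C w) w) +
    Pr P (fun w => D w /\ Q (C w) /\ ~ Lk (C w) w).
  by rewrite (Pr_split P (mea_and mD mQ) mLC); congr (_ + _); apply: Pr_ext => w; tauto.
have : forall w, Q (C w) -> 1 - e <= Pr P (fun w0 => ~ Lk (C w) w0).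
  by move=> w /h; rewrite Pr_not//; lra.
by move=> /H; lra.
Qed.

End law3.

(** * Coupling two levels by independent sprinkling *)

Section pair_law.
Context {R : realType} {I : choiceType}.

Implicit Type X : config I -> Prop.

Definition pair_par (p q : R) (i : I + I) : R := if i is inl _ then p else q.

Section join.
Context (p q : R) (P Q : probability (config I) R).
Hypotheses (lP : blaw (fun=> p) P) (lQ : blaw (fun=> q) Q).

Let join (z : config I * config I) : config (I + I)%type :=
  fun i => match i with inl x => z.1 x | inr x => z.2 x end.

Let mjoin i : mea (fun z => join z i).
Proof.
case: i => x; rewrite /join.
  have := @measurable_fst _ _ (config I) (config I) measurableT _ (mea_coord x).
  by rewrite setTI.
have := @measurable_snd _ _ (config I) (config I) measurableT _ (mea_coord x).
by rewrite setTI.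
Qed.

Let mfjoin : measurable_fun setT join.
Proof.
move=> _ X mX; rewrite setTI; exact: (mea_pre mjoin).
Qed.

HB.instance Definition _ := isMeasurableFun.Build _ _ _ _ join mfjoin.

Lemma pair_law_exists : exists PP : probability (config (I + I)%type) R,
  blaw (pair_par p q) PP.
Proof.
exists (distribution (P \x Q)%E join) => J v uJ.
pose J1 := pmap (fun i : I + I => if i is inl x then Some x else None) J.
pose J2 := pmap (fun i : I + I => if i is inr x then Some x else None) J.
pose v1 x := v (inl x); pose v2 x := v (inr x).
have in1 x : (x \in J1) = (inl x \in J).
  rewrite mem_pmap; apply/mapP/idP => [[[y|y] yJ]|xJ]; last by exists (inl x).
    by move=> [->].
  by [].
have in2 x : (x \in J2) = (inr x \in J).
  rewrite mem_pmap; apply/mapP/idP => [[[y|y] yJ]|xJ]; last by exists (inr x).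
    by [].
  by move=> [->].
have u1 : uniq J1.
  rewrite /J1; elim: J uJ {in1 in2 J1 J2} => [|[x|x] J IH] //= /andP[xJ uJ]; rewrite IH// andbT.
  rewrite mem_pmap; apply/negP => /mapP[[y|y] yJ]// [xy]; move: xJ; rewrite xy yJ.
  by [].
have u2 : uniq J2.
  rewrite /J2; elim: J uJ {in1 in2 u1 J1 J2} => [|[x|x] J IH] //= /andP[xJ uJ]; rewrite IH// andbT.
  rewrite mem_pmap; apply/negP => /mapP[[y|y] yJ]// [xy]; move: xJ; rewrite xy yJ.
  by [].
have wE : weight (pair_par p q) J v = weight (fun=> p) J1 v1 * weight (fun=> q) J2 v2.
  rewrite /J1 /J2 /weight; elim: (J) => [|[x|x] K IH] /=; rewrite ?big_nil ?mulr1//.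
    by rewrite !big_cons IH mulrA.
  by rewrite !big_cons IH mulrCA.
have E : join @^-1` (cyl J v : set _) = (cyl J1 v1 : set _) `*` (cyl J2 v2 : set _).
  apply/seteqP; split=> -[w1 w2] /=.
    by move=> h; split=> x; rewrite /= ?in1 ?in2 => xJ; have := h _ xJ.
  by move=> [h1 h2] [x|x] xJ; [apply: h1; rewrite in1|apply: h2; rewrite in2].
transitivity ((P \x Q)%E (join @^-1` (cyl J v : set _))); first by [].
rewrite E wE; apply: (etrans (product_measure1E _ _ (mea_cyl J1 v1) (mea_cyl J2 v2))).
rewrite EFinM; congr (_ * _)%E; [exact: lP|exact: lQ].
Qed.

End join.

(* On [I + I], the summand [inl] carries a lower level and [inr] the independent sprinkling;
   [orc] is the upper level obtained by adding the latter to the former. *)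
Definition lowc (w : config (I + I)%type) : config I := fun i => w (inl i).
Definition orc (w : config (I + I)%type) : config I := fun i => w (inl i) || w (inr i).

Lemma mea_lowc X : mea X -> mea (fun w => X (lowc w)).
Proof. by apply: mea_pre => i; exact: mea_coord. Qed.

Lemma mea_orc X : mea X -> mea (fun w => X (orc w)).
Proof.
apply: mea_pre => i.
apply: (@mea_ext _ _ (fun w : config (I + I)%type => w (inl i) \/ w (inr i))).
  by move=> w; rewrite /orc; split=> /orP.
by apply: mea_or; exact: mea_coord.
Qed.

Section laws.
Context {p q : R} {PP : probability (config (I + I)%type) R} (lPP : blaw (pair_par p q) PP).

Lemma law_lowc (P : probability (config I) R) X : blaw (fun=> p) P -> mea X ->
  Pr PP (fun w => X (lowc w)) = Pr P X.
Proof.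
move=> lP; apply: (law_map lPP lP (A := fun i => [set inl i])).
- by move=> i; exact: mea_coord.
- by move=> i w w' h; rewrite /lowc h.
- by move=> i j ij; rewrite -subset0 => k [-> [e]]; case: ij.
- by move=> i; exact: (Pr_coord lPP (inl i)).
Qed.

Lemma law_orc (P : probability (config I) R) X :
  blaw (fun=> 1 - (1 - p) * (1 - q)) P -> mea X ->
  Pr PP (fun w => X (orc w)) = Pr P X.
Proof.
move=> lP; apply: (law_map lPP lP (A := fun i => [set inl i; inr i])).
- move=> i; have := @mea_orc (fun w => w i) (mea_coord i); exact.
- by move=> i w w' h; rewrite /orc (h (inl i)) ?(h (inr i))//; [right|left].
- by move=> i j ij; rewrite -subset0 => k [] [->|->] [] [e] //; case: ij.
- move=> i; have := indep lPP (A := [set inl i])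
    (X := fun w => ~ w (inl i)) (Y := fun w => ~ w (inr i)).
  rewrite !Pr_not; [|exact: mea_coord|exact: mea_coord].
  rewrite !(Pr_coord lPP) /= => <-.
  + rewrite -[LHS]opprK -[X in - X = _](addKr 1) opprD opprK -Pr_not; last first.
      by have := @mea_orc (fun w => w i) (mea_coord i); exact.
    congr (1 - _); apply: Pr_ext => w; rewrite /orc.
    by split=> [/negP|[/negP ? /negP ?]]; rewrite ?negb_or; [move=> /andP[/negP ? /negP ?]|apply/negP; rewrite negb_or; apply/andP].
  + by apply: mea_not; exact: mea_coord.
  + by apply: mea_not; exact: mea_coord.
  + by move=> w w' h; rewrite h.
  + by move=> w w' h; rewrite h//.
Qed.

End laws.

Lemma law_reindex (p : R) (P : probability (config I) R) (g : I -> I) X :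
  blaw (fun=> p) P -> injective g -> mea X -> Pr P (fun w => X (w \o g)) = Pr P X.
Proof.
move=> lP gi; apply: (law_map lP lP (F := fun w => w \o g) (A := fun i => [set g i])).
- by move=> i; exact: (mea_coord (g i)).
- by move=> i w w' h /=; rewrite h.
- by move=> i j ij; rewrite -subset0 => k [-> /gi e]; case: ij.
- by move=> i; exact: (Pr_coord lP).
Qed.

End pair_law.

Section count.
Context {d : measure_display} {T : measurableType d} {R : realType}.

(** Linearity of expectation: the left-hand side is the mean number of events that occur. *)
Lemma Pr_count (P : probability T R) (S : Type) (s : seq S) (A : S -> T -> Prop) (m : nat) :
  (forall x, mea (A x)) -> (forall w, (count (fun x => `[< A x w >]) s <= m)%N) ->
  \sum_(x <- s) Pr P (A x) <= m%:R.
Proof.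
have m1 : P setT = 1%E by exact: probability_setT.
move=> mA h; rewrite -lee_fin -sumEFin.
rewrite (eq_bigr (fun x => \int[P]_(w in setT) (\1_(A x : set T) w)%:E)%E); last first.
  move=> x _; rewrite -PrE//; apply/esym.
  by rewrite integral_indic//; [congr (P _); rewrite setIT|exact: mA].
rewrite -ge0_integral_sum//; last first.
  by move=> x; apply/measurable_realfun.measurable_EFinP; apply: measurable_realfun.measurable_indic; exact: mA.
rewrite (_ : m%:R%:E = \int[P]_(w in setT) (cst (m%:R%:E) w))%E; last first.
  by rewrite integral_cst// -[LHS]mule1; congr (_ * _)%E; apply/esym; exact: m1.
apply: ge0_le_integral => //.
- by move=> w _; apply: sume_ge0.
- by apply: emeasurable_sum => x; apply/measurable_realfun.measurable_EFinP; apply: measurable_realfun.measurable_indic; exact: mA.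
- move=> w _; rewrite sumEFin lee_fin /=.
  rewrite (eq_bigr (fun x => (`[< A x w >] : nat)%:R)); last first.
    move=> x _; rewrite indicE; congr (_%:R); congr nat_of_bool.
  rewrite -natr_sum ler_nat (leq_trans _ (h w))//.
  by elim: (s) => [|x s' IH]; rewrite ?big_nil// big_cons /= leq_add2l.
Qed.

End count.

(** * Open paths and balls *)

Section walks.
Context {G : multigraph}.
Local Notation V := (vertex G).
Local Notation E := (edge G).
Implicit Types (w : E -> bool) (x y z u v : V) (e : E) (S F : set V) (A B : set E).

Lemma joins_sym e x y : joins e x y -> joins e y x.
Proof. by case=> h; [right|left]. Qed.

Lemma joins_ends e x y u v : joins e x y -> joins e u v -> u = x \/ u = y.
Proof. by case=> h [] h'; move: h'; rewrite h => -[-> ->]; [left|right|right|left]. Qed.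

Lemma conn_refl w x : open_connected w x x.
Proof. by exists [::]. Qed.

Lemma conn_cons w e x y z : w e -> joins e x y -> open_connected w y z ->
  open_connected w x z.
Proof. by move=> we j [s h]; exists ((e, y) :: s). Qed.

Lemma conn_step w e x y : w e -> joins e x y -> open_connected w x y.
Proof. by move=> we j; apply: (conn_cons we j); exact: conn_refl. Qed.

Lemma conn_trans w x y z : open_connected w x y -> open_connected w y z ->
  open_connected w x z.
Proof.
case=> s; elim: s x => [x <-//|[e u] s IH x /= [we j h] yz].
exact: (conn_cons we j (IH _ h yz)).
Qed.

Lemma conn_sym w x y : open_connected w x y -> open_connected w y x.
Proof.
case=> s; elim: s x => [x ->|[e u] s IH x /= [we j /IH h]]; first exact: conn_refl.
exact: conn_trans h (conn_step we (joins_sym j)).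
Qed.

Lemma conn_ind w x y (Q : V -> Prop) : open_connected w x y -> Q x ->
  (forall u v e, Q u -> open_connected w x u -> w e -> joins e u v -> Q v) -> Q y.
Proof.
move=> [s h] Qx step.
suff H : forall s u, open_walk w u s y -> Q u -> open_connected w x u -> Q y.
  exact: (H s x h Qx (conn_refl _ _)).
elim=> [u /= <-//|[e z] s' IH u /= [we j hs] Qu xu].
apply: (IH z hs); first exact: step Qu xu we j.
exact: conn_trans xu (conn_step we j).
Qed.

Lemma conn_mono w w' x y : (forall e, w e -> w' e) -> open_connected w x y ->
  open_connected w' x y.
Proof.
move=> ww' h; apply: (conn_ind (Q := open_connected w' x) h); first exact: conn_refl.
by move=> u v e xu _ we j; apply: conn_trans xu (conn_step (ww' _ we) j).
Qed.

Lemma cluster_eq w x y : open_connected w x y -> Defs.cluster w x = Defs.cluster w y.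
Proof.
move=> xy; apply/seteqP; split=> z h; last exact: conn_trans xy h.
exact: conn_trans (conn_sym xy) h.
Qed.

Definition touch F : set E := [set e | exists u v, F u /\ joins e u v].

Lemma touchS F F' : F `<=` F' -> touch F `<=` touch F'.
Proof. by move=> h e [u [v [/h Fu j]]]; exists u, v. Qed.

Lemma rst_le A w e : rst A w e -> w e.
Proof. by case/andP. Qed.

Lemma rstE A w e : rst A w e <-> w e /\ A e.
Proof. by rewrite /rst; split=> [/andP[? /asboolP]|[-> /asboolP]]. Qed.

Lemma rstS A B w e : A `<=` B -> rst A w e -> rst B w e.
Proof. by move=> AB /rstE[we /AB Be]; apply/rstE. Qed.

Lemma rst_mono A w w' e : (forall e, w e -> w' e) -> rst A w e -> rst A w' e.
Proof. by move=> h /rstE[/h ? ?]; apply/rstE. Qed.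

Lemma conn_rstS A B w x y : A `<=` B -> open_connected (rst A w) x y ->
  open_connected (rst B w) x y.
Proof. by move=> AB; apply: conn_mono => e; exact: rstS. Qed.

Lemma conn_rst A w x y : open_connected (rst A w) x y -> open_connected w x y.
Proof. by apply: conn_mono => e; exact: rst_le. Qed.

Lemma first_exit w x y S : open_connected w x y -> S x -> ~ S y ->
  exists u v e, [/\ S u, ~ S v, w e /\ joins e u v &
    open_connected (rst (~` touch (~` S)) w) x u].
Proof.
move=> h Sx nSy.
pose Q u := (exists u v e, [/\ S u, ~ S v, w e /\ joins e u v &
    open_connected (rst (~` touch (~` S)) w) x u]) \/
  (S u /\ open_connected (rst (~` touch (~` S)) w) x u).
have : Q y.
  apply: (conn_ind (Q := Q) h); first by right; split=> //; exact: conn_refl.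
  move=> u v e [ex|[Su xu]] _ we j; first by left.
  have [Sv|nSv] := pselect (S v); last by left; exists u, v, e.
  right; split=> //; apply: conn_trans xu (conn_step _ j).
  apply/rstE; split=> // -[a [b [nSa jab]]].
  by case: (joins_ends j jab) => ab; apply: nSa; rewrite ab.
by case=> // -[].
Qed.

(** The last exit from [F] is the first exit of the reversed path from the complement of [F]. *)
Lemma last_exit w x y F : open_connected w x y -> F x -> ~ F y ->
  exists u v e, [/\ F u, ~ F v, w e /\ joins e u v &
    open_connected (rst (~` touch F) w) v y].
Proof.
move=> /conn_sym h Fx nFy.
have [|u [v [e [nFu nnFv [we j] yu]]]] := first_exit (S := ~` F) h nFy; first by move=> nFx; exact: nFx Fx.
exists v, u, e; split=> //; first exact: contrapT.
  by split=> //; exact: joins_sym.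
by apply: conn_sym; move: yu; rewrite setCK.
Qed.

Lemma avoid_vertex F w x y : open_connected (rst (~` touch F) w) x y -> ~ F x -> ~ F y.
Proof.
move=> h nFx; apply: (conn_ind (Q := fun y => ~ F y) h nFx).
move=> u v e nFu _ /rstE[_ nt] j Fv; apply: nt.
by exists v, u; split=> //; exact: joins_sym.
Qed.

(** Cut the path at its first entrance into [K2], and what precedes at its last exit from [K1]. At
    most two edges touching the two sets remain, whence the bound two in [null_hits]. *)
Lemma link_between w K1 K2 x y : open_connected w x y -> K1 x -> K2 y ->
  (forall z, K1 z -> K2 z -> False) ->
  (exists u v e, [/\ K1 u, K2 v, w e & joins e u v]) \/
  (exists u v u' v' e1 e2, [/\ K1 u /\ K2 v, w e1 /\ joins e1 u u', w e2 /\ joins e2 v' v &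
    open_connected (rst (~` touch (K1 `|` K2)) w) u' v']).
Proof.
move=> h K1x K2y dis.
have [||v' [v [e2 [nK2v' nnK2v [we2 j2] xv']]]] := first_exit (S := ~` K2) h.
- by move=> K2x; exact: dis K1x K2x.
- by move=> nK2y; exact: nK2y K2y.
have K2v : K2 v by exact: contrapT.
move: xv'; rewrite setCK => xv'.
have [K1v'|nK1v'] := pselect (K1 v'); first by left; exists v', v, e2.
right; have [u [u' [e1 [K1u nK1u' [/rstE[we1 _] j1] u'v']]]] := last_exit xv' K1x nK1v'.
exists u, v, u', v', e1, e2; split=> //.
apply: conn_mono u'v' => e /rstE[/rstE[we n2] n1]; apply/rstE; split=> //.
by move=> [a [b [[K1a|K2a] jab]]]; [apply: n1|apply: n2]; exists a, b.
Qed.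

Fixpoint gball x n : set V :=
  if n is n'.+1 then gball x n' `|` [set z | exists y e, gball x n' y /\ joins e y z]
  else [set x].

Lemma gball0 x n : gball x n x.
Proof. by elim: n => //= n IH; left. Qed.

Lemma gballS x n : gball x n `<=` gball x n.+1.
Proof. by move=> y h; left. Qed.

Lemma gball_mono x n m : (n <= m)%N -> gball x n `<=` gball x m.
Proof.
move=> /subnK <-; elim: (m - n)%N => // k IH y /IH; exact: gballS.
Qed.

Lemma gball_joins x n y z e : gball x n y -> joins e y z -> gball x n.+1 z.
Proof. by move=> h j; right; exists y, e. Qed.

Lemma gball_trans x y z n m : gball x n y -> gball y m z -> gball x (n + m) z.
Proof.
move=> xy; elim: m z => [z ->|m IH z /= [/IH h|[u [e [/IH h j]]]]]; rewrite ?addn0//.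
  by rewrite addnS; left.
by rewrite addnS; right; exists u, e.
Qed.

Lemma gball_sym x y n : gball x n y -> gball y n x.
Proof.
elim: n y => [y ->//|n IH y /= [/IH h|[u [e [/IH h j]]]]]; first by left.
suff: gball y (1 + n) x by [].
by apply: gball_trans h; right; exists y, e; split=> //; exact: joins_sym.
Qed.

Lemma conn_ball x y : open_connected (fun=> true) x y -> exists n, gball x n y.
Proof.
move=> h; apply: (conn_ind (Q := fun y => exists n, gball x n y) h); first by exists 0%N.
by move=> u v e [n h'] _ _ j; exists n.+1; exact: gball_joins h' j.
Qed.

(** A finite-range substitute for [infc]: it decreases to it as [r] grows ([infcP]) and survives
    closing edges that do not touch the ball ([reach_rst]). *)
Definition reach r w x := exists y, ~ gball x r y /\ open_connected w x y.
Definition infc w x := infinite_set (Defs.cluster w x).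

Lemma infc_conn w x y : open_connected w x y -> infc w x -> infc w y.
Proof. by rewrite /infc => /cluster_eq ->. Qed.

Lemma infc_mono w w' x : (forall e, w e -> w' e) -> infc w x -> infc w' x.
Proof. by move=> h; apply: sub_infinite_set => y; exact: conn_mono. Qed.

Lemma reach_mono r w w' x : (forall e, w e -> w' e) -> reach r w x -> reach r w' x.
Proof. by move=> h [y [nb c]]; exists y; split=> //; exact: conn_mono c. Qed.

Lemma reachS r w x : reach r.+1 w x -> reach r w x.
Proof. by move=> [y [nb c]]; exists y; split=> // b; apply: nb; left. Qed.

Lemma reach_le r s w x : (r <= s)%N -> reach s w x -> reach r w x.
Proof. by move=> rs [y [nb c]]; exists y; split=> // b; apply: nb; exact: gball_mono b. Qed.

Lemma reach_rst r A w x : touch (gball x r) `<=` A -> reach r w x -> reach r (rst A w) x.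
Proof.
move=> tA [y [nb c]].
have [u [v [e [bu nbv [we j] xu]]]] := first_exit c (gball0 x r) nb.
exists v; split=> //; apply: conn_trans (conn_step (e := e) _ j).
  apply: conn_mono xu => f /rstE[wf nt]; apply/rstE; split=> //; apply: tA.
  exists (ends f).1, (ends f).2; split; last by left; exact: surjective_pairing.
  apply: contrapT => h; apply: nt; exists (ends f).1, (ends f).2; split=> //.
  by left; exact: surjective_pairing.
by apply/rstE; split=> //; apply: tA; exists u, v.
Qed.

Section locally_finite.
Hypotheses (connG : connected_graph G) (lfG : locally_finite G).

Lemma finite_touch F : finite_set F -> finite_set (touch F).
Proof.
move=> fF; apply: (@sub_finite_set _ _ (\bigcup_(x in F) [set e | exists y, joins e x y])).
  by move=> e [u [v [Fu j]]]; exists u => //; exists v.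
by apply: bigcup_finite => // x _; exact: lfG.
Qed.

Lemma finite_ball x n : finite_set (gball x n).
Proof.
elim: n => [|n IH] /=; first exact: finite_set1.
rewrite finite_setU; split=> //.
apply: (@sub_finite_set _ _ (\bigcup_(e in touch (gball x n)) [set (ends e).1; (ends e).2])).
  move=> z [y [e [b j]]]; exists e; first by exists y, z.
  by case: j => -> /=; [right|left].
by apply: bigcup_finite; [exact: finite_touch|move=> e _; exact: finite_set2].
Qed.

Lemma gball_ex x y : exists n, gball x n y.
Proof. exact: conn_ball (connG x y). Qed.

Lemma finite_sub_ball x F : finite_set F -> exists n, F `<=` gball x n.
Proof.
move=> /finite_seqP[s ->]; elim: s => [|y s [n IH]]; first by exists 0%N.
have [m ym] := gball_ex x y; exists (maxn n m) => z; rewrite /= inE => /orP[/eqP->|zs].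
  by apply: gball_mono ym; exact: leq_maxr.
by apply: gball_mono (IH z zs); exact: leq_maxl.
Qed.

Lemma infcP w x : infc w x <-> forall r, reach r w x.
Proof.
split=> [inf r|h fin].
  apply: contrapT => nr; apply: inf; apply: sub_finite_set (finite_ball x r) => y c.
  by apply: contrapT => nb; apply: nr; exists y.
have [n sub] := finite_sub_ball x fin; have [y [nb c]] := h n.
exact: nb (sub _ c).
Qed.

Lemma countable_vertices : countable [set: V].
Proof.
have [[x _]|no] := pselect (exists x : V, True); last first.
  have -> : [set: V] = set0 by rewrite -subset0 => x _; apply: no; exists x.
  exact/finite_set_countable.
have -> : [set: V] = \bigcup_n gball x n.
  by apply/seteqP; split=> // y _; have [n h] := gball_ex x y; exists n.
by apply: bigcup_countable => // n _; exact/finite_set_countable/finite_ball.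
Qed.

Lemma edge_exhaustion : exists EL : nat -> seq E,
  (forall n e, e \in EL n -> e \in EL n.+1) /\ forall e, exists n, e \in EL n.
Proof.
have /countable_injP[f finj] := countable_edges connG lfG.
have fin n : finite_set [set e | (f e < n)%N].
  apply: (@finite_preimage _ _ [set k | (k < n)%N] f); last exact: finite_II.
  by move=> e e' _ _; apply: finj; rewrite inE.
have [EL hEL] : exists EL : nat -> seq E, forall n, [set e | (f e < n)%N] = [set` EL n].
  have /choice[EL h] : forall n, exists s : seq E, [set e | (f e < n)%N] = [set` s].
    by move=> n; exact/finite_seqP.
  by exists EL.
have inEL n e : [set` EL n] e <-> (f e < n)%N by rewrite -hEL.
exists EL; split=> [n e /inEL h|e]; first by apply/inEL; exact: ltnW.
by exists (f e).+1; apply/inEL.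
Qed.

Lemma exhaustion_subset (EL : nat -> seq E) (M : seq E) :
  (forall n e, e \in EL n -> e \in EL n.+1) -> (forall e, exists n, e \in EL n) ->
  exists n, {subset M <= EL n}.
Proof.
move=> mono ex; elim: M => [|e M [n sub]]; first by exists 0%N.
have [m em] := ex e; exists (n + m)%N => f; rewrite inE.
have le k l : {subset EL k <= EL (k + l)%N}.
  by elim: l => [|l IH] g gk; rewrite ?addn0// addnS; apply: mono; exact: IH.
by move=> /orP[/eqP->|/sub]; [rewrite addnC; exact: le|exact: le].
Qed.

Lemma conn_exhaust (EL : nat -> seq E) w x y :
  (forall n e, e \in EL n -> e \in EL n.+1) -> (forall e, exists n, e \in EL n) ->
  open_connected w x y -> exists n, open_connected (rst [set` EL n] w) x y.
Proof.
move=> mono ex c.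
have le n m : (n <= m)%N -> [set` EL n] `<=` [set` EL m].
  by move=> /subnK <-; elim: (m - n)%N => // k IH e /IH; exact: mono.
apply: (conn_ind (Q := fun y => exists n, open_connected (rst [set` EL n] w) x y) c).
  by exists 0%N; exact: conn_refl.
move=> u v e [n h] _ we j; have [m em] := ex e; exists (maxn n m).
apply: conn_trans (conn_rstS (le _ _ (leq_maxl _ _)) h) (conn_step (e := e) _ j).
by apply/rstE; split=> //; exact: (le _ _ (leq_maxr _ _)).
Qed.

Definition far D (B : seq E) x := forall e, e \in B -> ~ touch (gball x D) e.

Lemma far_infinite D (B : seq E) (F : set V) : infinite_set F -> exists x, F x /\ far D B x.
Proof.
move=> inf; apply: contrapT => no; apply: inf.
apply: (@sub_finite_set _ _ (\bigcup_(e in [set` B]) (gball (ends e).1 D `|` gball (ends e).2 D))).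
  move=> x Fx; have : ~ far D B x by move=> h; apply: no; exists x.
  move=> /existsNP[e /not_implyP[eB /contrapT[u [v [/gball_sym b j]]]]]; exists e => //.
  by case: j => -> /=; [left|right].
apply: bigcup_finite => [|e _]; first exact: finite_seq.
by rewrite finite_setU; split; exact: finite_ball.
Qed.

End locally_finite.

Section automorphisms.
Implicit Types (f : V -> V) (g : E -> E).

Lemma aut_id : automorphism (@id V) (@id E).
Proof. by split=> //; exists id. Qed.

Lemma aut_comp f g f' g' : automorphism f g -> automorphism f' g' ->
  automorphism (f \o f') (g \o g').
Proof.
move=> [bf bg h] [bf' bg' h']; split; [exact: bij_comp|exact: bij_comp|].
by move=> e x y; rewrite h' h.
Qed.

Lemma aut_conn f g w x y : automorphism f g ->
  open_connected (w \o g) x y <-> open_connected w (f x) (f y).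
Proof.
move=> [[f' ff' f'f] [g' gg' g'g] h]; split=> c.
  apply: (conn_ind (Q := fun y => open_connected w (f x) (f y)) c); first exact: conn_refl.
  by move=> u v e c' _ we /h j; exact: conn_trans c' (conn_step (e := g e) we j).
have : open_connected (w \o g) x (f' (f y)); last by rewrite ff'.
apply: (conn_ind (Q := fun z => open_connected (w \o g) x (f' z)) c).
  by rewrite ff'; exact: conn_refl.
move=> u v e c' _ we j; apply: conn_trans c' (conn_step (e := g' e) _ _).
  by rewrite /= g'g.
by apply/h; rewrite !f'f g'g.
Qed.

Lemma aut_ball f g x y n : automorphism f g -> gball x n y <-> gball (f x) n (f y).
Proof.
move=> [[f' ff' f'f] [g' gg' g'g] h]; elim: n y => [y|n IH y] /=.
  by split=> [->//|/(can_inj ff')].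
split=> [[/IH b|[u [e [/IH b /h j]]]]|[/IH b|[u [e [b j]]]]]; [by left| |by left|].
  by right; exists (f u), (g e).
right; exists (f' u), (g' e); split; first by apply/IH; rewrite f'f.
by apply/h; rewrite f'f g'g.
Qed.

(** Take the maximum of one bound per orbit. Quasi-transitivity enters the whole proof through this
    statement. *)
Lemma qt_uniform (qtG : quasi_transitive G) (U : V -> nat -> Prop) :
  (forall f g x n, automorphism f g -> U x n -> U (f x) n) ->
  (forall x n m, (n <= m)%N -> U x n -> U x m) ->
  (forall x, exists n, U x n) -> exists n, forall x, U x n.
Proof.
move=> inv mono ex.
have /finite_seqP[s hs] := qtG.
have [n hn] : exists n, forall x, aut_orbit x \in s -> U x n.
  elim: s {hs} => [|O s [n IH]]; first by exists 0%N.
  have [[x xO]|no] := pselect (exists x, aut_orbit x = O); last first.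
    exists n => x; rewrite inE => /orP[/eqP xO|]; last exact: IH.
    by case: no; exists x.
  have [m Um] := ex x; exists (maxn n m) => y; rewrite inE => /orP[/eqP yO|ys].
    have : aut_orbit y y by exists id, id; split=> //; exact: aut_id.
    rewrite yO -xO => -[f [g [a <-]]].
    by apply: inv a _; apply: mono Um; exact: leq_maxr.
  by apply: mono (IH y ys); exact: leq_maxl.
exists n => x; apply: hn; suff : [set` s] (aut_orbit x) by [].
by rewrite -hs; exists x.
Qed.

Lemma orbit_dense (connG : connected_graph G) (qtG : quasi_transitive G) (o : V) :
  exists r, forall y, exists f g, automorphism f g /\ gball y r (f o).
Proof.
apply: (qt_uniform qtG (U := fun y r => exists f g, automorphism f g /\ gball y r (f o))).
- move=> f g x n a [f' [g' [a' b]]]; exists (f \o f'), (g \o g'); split.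
    exact: aut_comp.
  exact: (proj1 (aut_ball _ _ _ a) b).
- by move=> x n m nm [f [g [a b]]]; exists f, g; split=> //; exact: gball_mono b.
- by move=> x; have [n b] := gball_ex connG x o; exists n, id, id; split=> //; exact: aut_id.
Qed.

End automorphisms.
End walks.

(** * The two-point function *)

Section percolation.
Context {R : realType} {G : multigraph}.
Hypotheses (connG : connected_graph G) (lfG : locally_finite G).
Local Notation V := (vertex G).
Local Notation E := (edge G).
Local Notation P_ p := (@bond_percolation R G p).
Implicit Types (x y z : V) (e : E) (A B : set E) (p q c : R).

Lemma lawP p : 0 <= p <= 1 -> blaw (fun=> p) (P_ p).
Proof. by move=> h; exact: (bond_percolationP connG lfG h). Qed.

Lemma rstT (w : config E) : rst setT w = w.
Proof. by apply/funext => e; rewrite /rst asboolT// andbT. Qed.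

Lemma rst_rst A B (w : config E) : rst A (rst B w) = rst (A `&` B) w.
Proof.
apply/funext => e; apply/idP/idP => /rstE.
  by move=> [/rstE[we Be] Ae]; apply/rstE.
by move=> [we [Ae Be]]; apply/rstE; split=> //; apply/rstE.
Qed.

Lemma mea_conn x y : mea (fun w : config E => open_connected w x y).
Proof.
pose W := fix W n x y (w : config E) : Prop :=
  if n is n'.+1 then exists e z, (joins e x z /\ w e) /\ W n' z y w else x = y.
apply: (@mea_ext _ _ (fun w : config E => exists n, W n x y w)) => [w|].
  split=> [[n]|[s]].
    elim: n x => [x ->|n IH x [e [z [[j we] /IH c]]]]; first exact: conn_refl.
    exact: conn_cons we j c.
  elim: s x => [x /= ->|[e z] s IH x /= [we j /IH[n h]]]; first by exists 0%N.
  by exists n.+1, e, z.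
apply: mea_exn => n; elim: n x => [|n IH] x /=; first exact: mea_cst.
apply: mea_ex; first exact: countable_edges.
move=> e; apply: mea_ex; first exact: countable_vertices.
move=> z; apply: mea_and => //; apply: mea_and; first exact: mea_cst.
exact: mea_coord.
Qed.

Lemma mea_reach r x : mea (fun w : config E => reach r w x).
Proof.
apply: mea_ex => [|y]; first exact: countable_vertices.
by apply: mea_and; [exact: mea_cst|exact: mea_conn].
Qed.

Lemma mea_infc x : mea (fun w : config E => infc w x).
Proof.
apply: (@mea_ext _ _ (fun w : config E => forall r, reach r w x)).
  by move=> w; rewrite infcP.
by apply: mea_alln => r; exact: mea_reach.
Qed.

Section association.
Context {r : E -> R} {P : probability (config E) R} (lP : blaw r P).

(* Harris' inequality for events that are monotone limits of increasing cylinder events. *)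
Definition associated (X : config E -> Prop) := mea X /\ forall Y, mea Y ->
  (forall Z (J : seq E), mea Z -> dep [set` J] Z -> up Z -> harris (P := P) Z Y) -> harris (P := P) X Y.

Lemma harrisP X Y : associated X -> associated Y -> Pr P X * Pr P Y <= Pr P (fun w => X w /\ Y w).
Proof.
move=> [mX hX] [mY hY]; apply: hX => // Z J mZ dZ uZ; apply: harris_sym.
apply: hY => // Z' J' mZ' dZ' uZ'; apply: (harris_fin lP (J := J' ++ J)) => //.
  by apply: depS dZ' => e /= eJ; rewrite mem_cat eJ.
by apply: depS dZ => e /= eJ; rewrite mem_cat eJ orbT.
Qed.

Lemma assoc_fin X (J : seq E) : mea X -> dep [set` J] X -> up X -> associated X.
Proof. by move=> mX dX uX; split=> // Y mY h; exact: (h X J). Qed.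

Lemma assoc_up (X : nat -> config E -> Prop) : (forall n w, X n w -> X n.+1 w) ->
  (forall n, associated (X n)) -> associated (fun w => exists n, X n w).
Proof.
move=> mono h; have mX n := proj1 (h n).
split=> [|Y mY hY]; first exact: mea_exn.
by apply: harris_up => // n; apply: (proj2 (h n)).
Qed.

Lemma assoc_down (X : nat -> config E -> Prop) : (forall n w, X n.+1 w -> X n w) ->
  (forall n, associated (X n)) -> associated (fun w => forall n, X n w).
Proof.
move=> mono h; have mX n := proj1 (h n).
split=> [|Y mY hY]; first exact: mea_alln.
by apply: harris_down => // n; apply: (proj2 (h n)).
Qed.

Lemma assoc_ext X Y : (forall w, X w <-> Y w) -> associated X -> associated Y.
Proof.
by move=> h; suff -> : X = Y by []; apply/funext => w; apply/propext; exact: h.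
Qed.

Lemma assoc_conn A x y : associated (fun w => open_connected (rst A w) x y).
Proof.
have [EL [mono ex]] := edge_exhaustion connG lfG.
apply: (@assoc_ext (fun w => exists n, open_connected (rst [set` EL n] (rst A w)) x y)).
  move=> w; split=> [[n]|]; first exact: conn_rst.
  exact: conn_exhaust.
apply: assoc_up => [n w|n]; first by apply: conn_rstS => e; exact: mono.
apply: (@assoc_fin _ (EL n)).
- have m := mea_rst [set` EL n] (X := fun w : config E => open_connected w x y) (mea_conn x y).
  exact: (mea_rst A (X := fun w : config E => open_connected (rst [set` EL n] w) x y) m).
- move=> w w' h; rewrite !rst_rst; apply: conn_mono => e /rstE[we [eE Ae]].
  by apply/rstE; split=> //; rewrite -h.
- by move=> w w' h; apply: conn_mono => e; apply: rst_mono => f; exact: rst_mono.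
Qed.

Lemma assoc_infc x : associated (fun w => infc w x).
Proof.
have [EL [mono ex]] := edge_exhaustion connG lfG.
apply: (@assoc_ext (fun w => forall r, reach r w x)); first by move=> w; rewrite infcP.
apply: assoc_down => [n w|s]; first exact: reachS.
apply: (@assoc_ext (fun w => exists n, reach s (rst [set` EL n] w) x)).
  move=> w; split=> [[n]|[y [nb /(conn_exhaust mono ex)[n c]]]].
    by apply: reach_mono => e; exact: rst_le.
  by exists n, y.
apply: assoc_up => [n w|n].
  by apply: reach_mono => e; apply: rstS => f; exact: mono.
apply: (@assoc_fin _ (EL n)).
- exact: (mea_rst [set` EL n] (X := fun w : config E => reach s w x) (mea_reach s x)).
- exact: (@dep_rst _ _ (fun w => reach s w x)).
- by move=> w w' h; apply: reach_mono => e; exact: rst_mono.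
Qed.

End association.

Section invariance.
Context {f : V -> V} {g : E -> E} (fg : automorphism f g).

Lemma aut_Pr p (X Y : config E -> Prop) : 0 <= p <= 1 -> mea X ->
  (forall w, Y w <-> X (w \o g)) -> Pr (P_ p) Y = Pr (P_ p) X.
Proof.
move=> p01 mX h; rewrite -(law_reindex (lawP p01) _ mX (g := g)); first exact: Pr_ext.
by case: fg => _ /bij_inj.
Qed.

Lemma aut_conn_rst A (w : config E) x y :
  open_connected (rst A (w \o g)) x y <-> open_connected (rst (g @` A) w) (f x) (f y).
Proof.
rewrite -(aut_conn (rst (g @` A) w) x y fg).
suff -> : rst (g @` A) w \o g = rst A (w \o g) by [].
have gi : injective g by case: fg => _ /bij_inj.
apply/funext => e /=; apply/idP/idP => /rstE[we h]; apply/rstE; split=> //.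
by case: h => e' Ae' /gi <-.
Qed.

Lemma aut_reach r (w : config E) x : reach r (w \o g) x <-> reach r w (f x).
Proof.
case: (fg) => -[f' ff' f'f] _ _; split=> [[y [nb c]]|[y [nb c]]].
  exists (f y); split; last exact: (proj1 (aut_conn _ _ _ fg) c).
  by move=> b; apply: nb; exact: (proj2 (aut_ball _ _ _ fg) b).
exists (f' y); split; last by apply: (proj2 (aut_conn _ _ _ fg)); rewrite f'f.
by move=> b; apply: nb; have := proj1 (aut_ball _ _ _ fg) b; rewrite f'f.
Qed.

Lemma aut_infc (w : config E) x : infc (w \o g) x <-> infc w (f x).
Proof.
by rewrite !infcP//; split=> h r; apply/aut_reach.
Qed.

End invariance.

Lemma coupling_par p q : 0 <= p -> p < q -> q <= 1 -> 0 < (q - p) / (1 - p) <= 1.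
Proof.
move=> p0 pq q1; have p1 : 0 < 1 - p by lra.
apply/andP; split; first by rewrite divr_gt0// subr_gt0.
by rewrite ler_pdivrMr// mul1r; lra.
Qed.

(** The sprinkling parameter [s] solves [(1 - p) * (1 - s) = 1 - q]: an edge is closed above when it
    is closed below and not sprinkled. *)
Lemma coupling p q : 0 <= p -> p < q -> q <= 1 ->
  exists PP : probability (config (E + E)%type) R,
  [/\ blaw (pair_par p ((q - p) / (1 - p))) PP,
    forall X, mea X -> Pr PP (fun w => X (lowc w)) = Pr (P_ p) X &
    forall X, mea X -> Pr PP (fun w => X (orc w)) = Pr (P_ q) X].
Proof.
move=> p0 pq q1; have := coupling_par p0 pq q1; set s := _ / _ => /andP[s0 s1].
have e : 1 - (1 - p) * (1 - s) = q.
  by rewrite mulrBr mulr1 /s mulrC divfK ?subr_eq0 ?gt_eqF//; lra.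
have p01 : 0 <= p <= 1 by lra.
have s01 : 0 <= s <= 1 by lra.
have [PP lPP] := pair_law_exists (lawP p01) (lawP s01).
exists PP; split=> // X mX; first by apply: (law_lowc lPP) => //; exact: lawP.
by apply: (law_orc lPP) => //; rewrite e; apply: lawP; lra.
Qed.

Lemma Pr_param_mono p q X : 0 <= p -> p <= q -> q <= 1 -> mea X -> up X ->
  Pr (P_ p) X <= Pr (P_ q) X.
Proof.
move=> p0 + q1 mX uX; rewrite le_eqVlt => /orP[/eqP->//|pq].
have [PP [_ lo hi]] := coupling p0 pq q1.
rewrite -lo// -hi//; apply: Pr_mono; [exact: mea_lowc|exact: mea_orc|].
by move=> w; apply: uX => e; rewrite /lowc /orc => ->.
Qed.

Definition tau p x y := Pr (P_ p) (fun w => open_connected w x y).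

Lemma tauE p x y : two_point p x y = (tau p x y)%:E.
Proof. by rewrite /two_point /tau -PrE//; exact: mea_conn. Qed.

Lemma tau_sym p x y : tau p x y = tau p y x.
Proof. by apply: Pr_ext => w; split=> /conn_sym. Qed.

Lemma tau_le1 p x y : tau p x y <= 1.
Proof. by apply: Pr_le1; exact: mea_conn. Qed.

Lemma tau_trans p x y z : 0 <= p <= 1 -> tau p x y * tau p y z <= tau p x z.
Proof.
move=> p01.
have a u v : associated (P := P_ p) (fun w : config E => open_connected w u v).
  by apply: assoc_ext (assoc_conn setT u v) => w; rewrite rstT.
apply: le_trans (harrisP (lawP p01) (a x y) (a y z)) _; apply: Pr_mono.
- by apply: mea_and; exact: mea_conn.
- exact: mea_conn.
- by move=> w [h1 h2]; exact: conn_trans h1 h2.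
Qed.

Lemma up_conn x y : up (fun w : config E => open_connected w x y).
Proof. by move=> w w' h; exact: conn_mono. Qed.

Lemma tau_mono p q x y : 0 <= p -> p <= q -> q <= 1 -> tau p x y <= tau q x y.
Proof. by move=> *; apply: Pr_param_mono => //; [exact: mea_conn|exact: up_conn]. Qed.

Lemma aut_tau p f g x y : 0 <= p <= 1 -> automorphism f g -> tau p (f x) (f y) = tau p x y.
Proof.
move=> p01 fg; apply: (aut_Pr fg p01); first exact: mea_conn.
by move=> w; rewrite (aut_conn _ _ _ fg).
Qed.

Lemma tau_gt0 p x y : 0 < p <= 1 -> 0 < tau p x y.
Proof.
move=> /andP[p0 p1]; have p01 : 0 <= p <= 1 by rewrite ltW.
have [EL [mono ex]] := edge_exhaustion connG lfG.
have [n c] := conn_exhaust mono ex (connG x y).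
apply: (@lt_le_trans _ _ (Pr (P_ p) (cyl (undup (EL n)) (fun=> true)))).
  by rewrite (Pr_cyl (lawP p01)) ?undup_uniq// (weight_const (p := p))// exprn_gt0.
apply: Pr_mono; [exact: mea_cyl|exact: mea_conn|] => w h.
by apply: conn_mono c => e /rstE[_ eE]; apply: h; rewrite mem_undup.
Qed.

Definition theta p x := Pr (P_ p) (fun w => infc w x).

Lemma theta_mono p q x : 0 <= p -> p <= q -> q <= 1 -> theta p x <= theta q x.
Proof.
by move=> *; apply: Pr_param_mono => //; [exact: mea_infc|move=> w w' h; exact: infc_mono].
Qed.

Lemma aut_theta p f g x : 0 <= p <= 1 -> automorphism f g -> theta p (f x) = theta p x.
Proof.
move=> p01 fg; apply: (aut_Pr fg p01); first exact: mea_infc.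
by move=> w; rewrite (aut_infc fg).
Qed.

Lemma theta_conn p x y : 0 <= p <= 1 -> tau p x y * theta p x <= theta p y.
Proof.
move=> p01.
have a u v : associated (P := P_ p) (fun w : config E => open_connected w u v).
  by apply: assoc_ext (assoc_conn setT u v) => w; rewrite rstT.
apply: le_trans (harrisP (lawP p01) (a x y) (assoc_infc x)) _; apply: Pr_mono.
- by apply: mea_and; [exact: mea_conn|exact: mea_infc].
- exact: mea_infc.
- by move=> w [h1 h2]; exact: infc_conn h1 h2.
Qed.

Section quasi_transitive.
Hypothesis qtG : quasi_transitive G.

Lemma qt_lower (F : V -> R) : (forall x, 0 < F x) ->
  (forall f g x, automorphism f g -> F (f x) = F x) -> exists2 c, 0 < c & forall x, c <= F x.
Proof.
move=> F0 inv.
have [|||n hn] := qt_uniform qtG (U := fun x n => n.+1%:R^-1 <= F x).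
- by move=> f g x n a; rewrite (inv _ _ _ a).
- move=> x n m nm; apply: le_trans.
  by rewrite lef_pV2 ?posrE// ler_nat ltnS.
- move=> x; exists (Num.bound (F x)^-1).
  rewrite -[X in _ <= X]invrK lef_pV2 ?posrE ?invr_gt0//.
  apply: ltW; apply: lt_le_trans (archi_boundP _) _; first by rewrite invr_ge0 ltW.
  by rewrite ler_nat.
by exists n.+1%:R^-1.
Qed.

Lemma theta_lower p : 0 < p <= 1 -> (exists x, 0 < theta p x) ->
  exists2 t, 0 < t & forall x, t <= theta p x.
Proof.
move=> p01 [x tx]; have p01' : 0 <= p <= 1 by case/andP: p01 => /ltW -> ->.
apply: qt_lower => [y|f g y]; last exact: aut_theta.
apply: lt_le_trans (theta_conn x y p01'); rewrite mulr_gt0//; exact: tau_gt0.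
Qed.

End quasi_transitive.

End percolation.

(** * Closing one of many disjoint sets *)

Section closing.
Context {R : realType} {I : choiceType} {p : R} {P : probability (config I) R}.
Hypotheses (lP : blaw (fun=> p) P).

Lemma Pr_none_closed (n : nat) (Bs : seq (seq I)) : uniq (flatten Bs) ->
  (forall b, b \in Bs -> size b = n) ->
  Pr P (fun w => forall b, b \in Bs -> ~ allclosed b w) = (1 - (1 - p) ^+ n) ^+ size Bs.
Proof.
elim: Bs => [_ _|b Bs IH /=]; first by rewrite expr0 Pr_true.
rewrite cat_uniq => /and3P[ub hb uBs] sz.
rewrite exprS -IH//; last by move=> b' b'B; apply: sz; rewrite inE b'B orbT.
have -> : 1 - (1 - p) ^+ n = Pr P (fun w => ~ allclosed b w).
  rewrite Pr_not ?(Pr_allclosed lP)//; last exact: mea_allclosed.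
  by rewrite (weight_const (p := p))// -(sz b) ?inE ?eqxx.
have mB : mea (fun w : config I => forall b, b \in Bs -> ~ allclosed b w).
  by apply: mea_all_seq => b' _; apply: mea_not; exact: mea_allclosed.
have mb : mea (fun w : config I => ~ allclosed b w).
  by apply: mea_not; exact: mea_allclosed.
rewrite -(indep (A := [set` b]) lP mb mB).
- apply: Pr_ext => w; split=> [h|[h1 h2] b'].
    by split=> [|b' b'B]; apply: h; rewrite inE ?eqxx ?b'B ?orbT.
  by rewrite inE => /orP[/eqP->|/h2].
- by apply: dep_not; exact: dep_allclosed.
- move=> w w' h c b' b'B; have := c b' b'B; apply: dep_not.
    by move=> w1 w2; exact: (@dep_allclosed _ b').
  move=> i ib'; apply: h => ib; move/negP: hb; apply; apply/hasP; exists i => //.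
  by apply/flattenP; exists b'.
Qed.

Lemma Pr_some_closed (t : R) (Bs : seq (seq I)) X : mea X ->
  (forall b, b \in Bs -> Pr P (fun w => allclosed b w /\ X w) <= t) ->
  Pr P (fun w => (exists2 b, b \in Bs & allclosed b w) /\ X w) <= (size Bs)%:R * t.
Proof.
move=> mX; elim: Bs => [_|b Bs IH h].
  by rewrite mul0r Pr_false// => w [[]].
have mc (l : seq (seq I)) : mea (fun w : config I => exists2 b, b \in l & allclosed b w).
  by apply: mea_ex_seq => b' _; exact: mea_allclosed.
rewrite [size _]/= -addn1 natrD mulrDl mul1r addrC.
apply: le_trans (lerD (h b _) (IH _)).
- apply: le_trans (Pr_or P (mea_and (mea_allclosed b) mX) (mea_and (mc Bs) mX)).
  apply: Pr_mono.
  + by apply: mea_and; first exact: mc.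
  + exact: mea_or (mea_and (mea_allclosed b) mX) (mea_and (mc Bs) mX).
  + move=> w [[b' + c] x]; rewrite inE => /orP[/eqP e|b'B]; [left|right].
      by rewrite -e.
    by split=> //; exists b'.
- by rewrite inE eqxx.
- by move=> b' b'B; apply: h; rewrite inE b'B orbT.
Qed.

(** Either no [b] is closed, which independence makes unlikely, or some [b] is; there [X] is an
    event of the configuration off [b], and a union bound applies. *)
Lemma Pr_many_closings (t : R) (n : nat) (Bs : seq (seq I)) X : mea X ->
  uniq (flatten Bs) -> (forall b, b \in Bs -> size b = n) ->
  (forall b, b \in Bs -> Pr P (fun w => X (rst (~` [set` b]) w)) <= t) ->
  Pr P X <= (1 - (1 - p) ^+ n) ^+ size Bs + (size Bs)%:R * ((1 - p) ^+ n * t).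
Proof.
move=> mX uB sz h.
have mc : mea (fun w : config I => exists2 b, b \in Bs & allclosed b w).
  by apply: mea_ex_seq => b' _; exact: mea_allclosed.
rewrite (Pr_split P mX mc) addrC -(Pr_none_closed uB sz); apply: lerD.
  apply: Pr_mono; first by apply: mea_and => //; exact: mea_not.
    by apply: mea_all_seq => b' _; apply: mea_not; exact: mea_allclosed.
  by move=> w [_ no] b bB c; apply: no; exists b.
rewrite (@Pr_ext _ _ _ _ _ (fun w => (exists2 b, b \in Bs & allclosed b w) /\ X w)); last first.
  by move=> w; split=> -[].
apply: Pr_some_closed => // b bB; rewrite (Pr_closed lP)//; last first.
  have : uniq (flatten Bs) by []; elim: (Bs) bB => //= b' l IH; rewrite inE cat_uniq.
  by move=> /orP[/eqP<- /and3P[]//|/IH + /and3P[_ _]]; apply.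
rewrite (weight_const (p := p))//= (sz b bB).
(* The bound [p <= 1] is read off a coordinate of [b], so an empty [b] is treated apart. *)
have [[i ib]|nb] := pselect (exists i, i \in b).
  have /andP[_ p1] := r01 lP i.
  have p1' : 0 <= 1 - p by rewrite subr_ge0.
  by apply: ler_wpM2l; [exact: exprn_ge0|exact: h].
have b0 : b = [::].
  by case: (b) nb => // i b' []; exists i; rewrite inE eqxx.
by rewrite -(sz b bB) b0 /= !mul1r; move: (h b bB); rewrite b0.
Qed.

End closing.

(** * Connections within a set of edges *)

Section avoiding.
Context {R : realType} {G : multigraph}.
Hypotheses (connG : connected_graph G) (lfG : locally_finite G).
Local Notation V := (vertex G).
Local Notation E := (edge G).
Local Notation P_ p := (@bond_percolation R G p).
Implicit Types (x y z : V) (e : E) (A : set E) (B : seq E) (p q c : R).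

Definition tau_in p A x y := Pr (P_ p) (fun w => open_connected (rst A w) x y).

Lemma mea_conn_rst A x y : mea (fun w : config E => open_connected (rst A w) x y).
Proof.
by apply: (mea_rst A (X := fun w : config E => open_connected w x y)); exact: mea_conn.
Qed.

Lemma tau_inS p A A' x y : A `<=` A' -> tau_in p A x y <= tau_in p A' x y.
Proof.
move=> AA'; apply: Pr_mono; [exact: mea_conn_rst|exact: mea_conn_rst|].
by move=> w; exact: conn_rstS.
Qed.

Lemma tau_in_sym p A x y : tau_in p A x y = tau_in p A y x.
Proof. by apply: Pr_ext => w; split=> /conn_sym. Qed.

Lemma tau_in_trans p A x y z : 0 <= p <= 1 ->
  tau_in p A x y * tau_in p A y z <= tau_in p A x z.
Proof.
move=> p01; have a u v := assoc_conn connG lfG (P := P_ p) A u v.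
apply: le_trans (harrisP (lawP connG lfG p01) (a x y) (a y z)) _; apply: Pr_mono.
- by apply: mea_and; exact: mea_conn_rst.
- exact: mea_conn_rst.
- by move=> w [h1 h2]; exact: conn_trans h1 h2.
Qed.

Lemma aut_tau_in p f g A x y : 0 <= p <= 1 -> automorphism f g ->
  tau_in p (g @` A) (f x) (f y) = tau_in p A x y.
Proof.
move=> p01 fg; apply: (aut_Pr connG lfG fg p01); first exact: mea_conn_rst.
by move=> w; rewrite (aut_conn_rst fg).
Qed.

Lemma aut_touch f g x n e : automorphism f g -> touch (gball x n) e <-> touch (gball (f x) n) (g e).
Proof.
move=> fg; have [[f' ff' f'f] _ h] := fg; split=> -[u [v [b j]]].
  by exists (f u), (f v); split; [exact: (proj1 (aut_ball _ _ _ fg) b)|exact: (proj1 (h _ _ _) j)].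
exists (f' u), (f' v); split; last by apply: (proj2 (h _ _ _)); rewrite !f'f.
by apply: (proj2 (aut_ball _ _ _ fg)); rewrite f'f.
Qed.

Lemma aut_far f g D B x : automorphism f g -> far D B x -> far D (map g B) (f x).
Proof.
by move=> fg h _ /mapP[e eB ->] t; apply: (h e eB); exact: (proj2 (aut_touch _ _ _ fg) t).
Qed.

Lemma image_off (g : E -> E) B : bijective g -> g @` (~` [set` B]) = ~` [set` map g B].
Proof.
move=> [g' gg' g'g]; apply/seteqP; split=> [_ [e ne <-] /= /mapP[e' eB /(can_inj gg') ee']|e ne].
  by apply: ne; rewrite ee'.
exists (g' e) => // eB; apply: ne; apply/mapP; exists (g' e) => //.
Qed.

Lemma touch_end e : exists x, forall y n, gball y n x -> touch (gball y n) e.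
Proof.
exists (ends e).1 => y n b; exists (ends e).1, (ends e).2; split=> //.
by left; exact: surjective_pairing.
Qed.

Lemma edges_sub_touch B x : exists n, [set` B] `<=` touch (gball x n).
Proof.
elim: B => [|e B [n IH]]; first by exists 0%N.
have [y hy] := touch_end e; have [m b] := gball_ex connG x y.
exists (maxn n m) => e'; rewrite /= inE => /orP[/eqP->|/IH].
  by apply: hy; apply: gball_mono b; exact: leq_maxr.
by apply: touchS; apply: gball_mono; exact: leq_maxl.
Qed.

Lemma conn_touch_ball (w : config E) x y z : open_connected w y z ->
  exists n, open_connected (rst (touch (gball x n)) w) y z.
Proof.
have [EL [mono ex]] := edge_exhaustion connG lfG.
move=> /(conn_exhaust mono ex)[k c]; have [n sub] := edges_sub_touch (EL k) x.
by exists n; exact: conn_rstS sub c.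
Qed.

(** An open path stays in some ball, so a large ball keeps half of the probability. The radius is
    uniform over the finitely many [y] near [x], then over [x] by [qt_uniform]. *)
Lemma tau_near p (qtG : quasi_transitive G) c (n : nat) : 0 <= p <= 1 -> 0 < c ->
  (forall x y, gball x n y -> c <= tau p x y) ->
  exists m, forall x y, gball x n y -> c / 2 <= tau_in p (touch (gball x m)) x y.
Proof.
move=> p01 c0 h.
apply: (qt_uniform qtG (U := fun x m => forall y, gball x n y -> c / 2 <= tau_in p (touch (gball x m)) x y)).
- move=> f g x m fg U y b; have [[f' ff' f'f] [g' gg' g'g] _] := fg.
  rewrite -(f'f y); have -> : touch (gball (f x) m) = g @` touch (gball x m).
    apply/seteqP; split=> [e t|_ [e t <-]]; last exact: (proj1 (aut_touch _ _ _ fg) t).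
    by exists (g' e) => //; apply: (proj2 (aut_touch _ _ _ fg)); rewrite g'g.
  rewrite (aut_tau_in _ _ _ p01 fg); apply: U; apply: (proj2 (aut_ball _ _ _ fg)).
  by rewrite f'f.
- move=> x m m' mm' U y /U /le_trans; apply; apply: tau_inS; apply: touchS.
  exact: gball_mono.
move=> x; have /finite_seqP[s sE] := finite_ball lfG x n.
have {h} : forall y, y \in s -> c <= tau p x y.
  by move=> y ys; apply: h; rewrite sE.
suff H : (forall y, y \in s -> c <= tau p x y) ->
    exists m, forall y, y \in s -> c / 2 <= tau_in p (touch (gball x m)) x y.
  by move=> /H[m hm]; exists m => y; rewrite sE; exact: hm.
elim: s {sE} => [_|y s IH h]; first by exists 0%N.
have [|m1 h1] := IH; first by move=> z zs; apply: h; rewrite inE zs orbT.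
have c2 : 0 < c / 2 by lra.
have mC m : mea (fun w : config E => open_connected (rst (touch (gball x m)) w) x y).
  exact: mea_conn_rst.
have monoC m (w : config E) : open_connected (rst (touch (gball x m)) w) x y ->
    open_connected (rst (touch (gball x m.+1)) w) x y.
  by apply: conn_rstS; apply: touchS; exact: gballS.
have [m2 h2] := Pr_up (P_ p) mC monoC c2.
have h3 : tau p x y = Pr (P_ p) (fun w => exists m, open_connected (rst (touch (gball x m)) w) x y).
  by apply: Pr_ext => w; split=> [|[m]]; [exact: conn_touch_ball|exact: conn_rst].
have h4 := h y (mem_head _ _).
exists (maxn m1 m2) => z; rewrite inE => /orP[/eqP->|/h1 le]; last first.
  by apply: le_trans le _; apply: tau_inS; apply: touchS; apply: gball_mono; exact: leq_maxl.
apply: (@le_trans _ _ (tau_in p (touch (gball x m2)) x y)).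
  by rewrite /tau_in; move: h2; rewrite -h3; lra.
by apply: tau_inS; apply: touchS; apply: gball_mono; exact: leq_maxr.
Qed.

End avoiding.

(** * Links far from a finite set *)

Section deep_links.
Context {R : realType} {G : multigraph}.
Hypotheses (connG : connected_graph G) (lfG : locally_finite G) (qtG : quasi_transitive G).
Local Notation V := (vertex G).
Local Notation E := (edge G).
Local Notation P_ p := (@bond_percolation R G p).
Implicit Types (x y z : V) (e : E) (A : set E) (B : seq E) (p q c : R).
Local Notation off B := (~` [set` B]).

Section contradiction.
Context {p c s : R} {B : seq E} {o : V}.
Hypotheses (p01 : 0 <= p <= 1) (c0 : 0 < c) (s0 : 0 < s) (uB : uniq B).
Hypothesis tauc : forall x y, c <= tau p x y.
Hypothesis bad : forall D, exists x1 x2,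
  [/\ far D B x1, far D B x2 & tau_in p (off B) x1 x2 <= s ^+ 2].

(* If [x1] and [x2], deep with respect to [B], are hardly connected off [B], then by Harris any [z] is
   hardly connected off [B] to one of them. Iterating at translates of [B] of growing depth gives
   many disjoint translates, each of which nearly separates [z] from the same [x] when closed. *)
Lemma bad_translates k : exists r, forall y z, exists x (Bs : seq (seq E)),
  [/\ gball y r x, size Bs = k, uniq (flatten Bs) &
  [/\ forall b, b \in Bs -> size b = size B,
    forall e, e \in flatten Bs -> touch (gball y r) e &
    forall b, b \in Bs -> tau_in p (off b) z x <= 2 * s / c]].
Proof.
elim: k => [|k [r IH]].
  by exists 0%N => y z; exists y, [::].
have [m near] := tau_near connG lfG qtG (n := r) p01 c0 (fun x y _ => tauc x y).
(* Depth [r] keeps the new translate disjoint from those supplied by the induction; depth [m] keeps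
   the short links of [tau_near] away from it. *)
have [x1 [x2 [far1 far2 le12]]] := bad (maxn r m).
have [r0 dense] := orbit_dense connG qtG o.
have [n1 b1] := gball_ex connG o x1; have [n2 b2] := gball_ex connG o x2.
have [n3 sub3] := edges_sub_touch connG B o.
pose n := maxn n1 (maxn n2 n3).
exists ((r0 + n) + r)%N => y z.
have [f [g [fg yfo]]] := dense y.
have [_ bg _] := fg; have gi := bij_inj bg.
have := le12; rewrite -(aut_tau_in connG lfG (~` [set` B]) x1 x2 p01 fg).
rewrite (image_off _ bg) => le12'.
have [xj [farj [bj lej]]] : exists xj, far (maxn r m) (map g B) xj /\
    (gball (f o) n xj /\ tau_in p (off (map g B)) z xj <= s).
  have H : tau_in p (off (map g B)) z (f x1) * tau_in p (off (map g B)) z (f x2) <= s ^+ 2.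
    apply: le_trans le12'; rewrite [tau_in p _ z (f x1)]tau_in_sym.
    exact: tau_in_trans.
  have [le1|gt1] := leP (tau_in p (off (map g B)) z (f x1)) s.
    exists (f x1); split; [exact: aut_far fg far1|split=> //].
    apply: (proj1 (aut_ball _ _ _ fg)); apply: gball_mono b1; exact: leq_maxl.
  exists (f x2); split; [exact: aut_far fg far2|split].
    apply: (proj1 (aut_ball _ _ _ fg)); apply: gball_mono b2.
    by rewrite /n leq_max leq_max leqnn orbT.
  rewrite leNgt; apply/negP => gt2; move: H; rewrite leNgt expr2 => /negP; apply.
  by apply: ltr_pM => //; exact: ltW.
have [x [Bs [xr sz uBs [szb tch le]]]] := IH xj z.
have yxj : gball y (r0 + n) xj by exact: gball_trans yfo bj.
exists x, (map g B :: Bs); split=> /=.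
- exact: gball_trans yxj xr.
- by rewrite sz.
- rewrite cat_uniq uBs map_inj_uniq// uB andbT /=; apply/hasPn => e eBs; apply/negP => eB.
  apply: (farj e eB); apply: touchS (tch e eBs); apply: gball_mono; exact: leq_maxl.
split.
- by move=> b; rewrite inE => /orP[/eqP->|/szb//]; rewrite size_map.
- move=> e; rewrite mem_cat => /orP[/mapP[e' eB ->]|/tch].
    have t : touch (gball (f o) n3) (g e') by apply: (proj1 (aut_touch _ _ _ fg)); exact: sub3.
    apply: touchS t => u /(gball_trans yfo); apply: gball_mono.
    by apply: leq_trans _ (leq_addr _ _); rewrite leq_add2l /n !leq_max leqnn !orbT.
  by apply: touchS => u; exact: gball_trans.
- move=> b; rewrite inE => /orP[/eqP->|/le//].
  (* [x] is well connected to the deep vertex [xj] off the new translate, so [z] is as badly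
     connected to [x] as to [xj], up to a factor [c / 2]. *)
  have lx : c / 2 <= tau_in p (off (map g B)) x xj.
    rewrite tau_in_sym; apply: le_trans (near _ _ xr) _; apply: (tau_inS connG lfG).
    move=> e te /= eB; apply: (farj e eB); apply: touchS te; apply: gball_mono; exact: leq_maxr.
  have t0 : 0 <= tau_in p (off (map g B)) z x by exact: Pr_ge0.
  have := tau_in_trans connG lfG (off (map g B)) z x xj p01.
  rewrite ler_pdivlMr// => tr.
  have : tau_in p (off (map g B)) z x * (c / 2) <= tau_in p (off (map g B)) z x * tau_in p (off (map g B)) x xj.
    exact: ler_wpM2l.
  by lra.
Qed.

End contradiction.

(** A rational substitute for the bound of [(1 - p) ^+ n] by the exponential of [- n * p]. *)
Lemma inv_one_plus_ge p n : 0 <= p <= 1 -> (1 - p) ^+ n * (1 + n%:R * p) <= 1.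
Proof.
move=> /andP[p0 p1]; elim: n => [|n IH]; first by rewrite expr0 mul0r addr0 mulr1.
have h0 : 0 <= (1 - p) ^+ n by rewrite exprn_ge0// subr_ge0.
apply: le_trans IH; rewrite exprSr -mulrA ler_wpM2l// -addn1 natrD.
have n0 : 0 <= n%:R :> R by [].
have : 0 <= n%:R * p * p by rewrite !mulr_ge0.
have : 0 <= p * p by rewrite mulr_ge0.
by nra.
Qed.

(** [eps] precedes [B]: only the depth [D] depends on the closed set. If the claim fails for [B],
    about [4 / (c * q)] translates are used, [q] being the probability that one is closed. With
    probability at least [1 - c / 4] one of them is closed, and the connections surviving such a
    closing have total probability at most [c / 2], so that [tau] would be at most [3 * c / 4]. *)
Lemma deep_link_gt0 p c : 0 < p < 1 -> 0 < c -> (forall x y, c <= tau p x y) ->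
  exists2 eps, 0 < eps & forall B, exists D, forall x1 x2, far D B x1 -> far D B x2 ->
    eps < tau_in p (off B) x1 x2.
Proof.
move=> /andP[p0 p1] c0 tauc; have p01 : 0 <= p <= 1 by rewrite !ltW.
(* [t] solves [(4 / c + 1) * t = c / 2], and [s] makes the bound [2 * s / c] of [bad_translates]
   equal to [t]. *)
pose t := c ^+ 2 / (2 * (4 + c)); pose s := c * t / 2.
have t0 : 0 < t by rewrite divr_gt0// ?exprn_gt0//; lra.
have s0 : 0 < s by rewrite divr_gt0// mulr_gt0.
exists (s ^+ 2) => [|B0]; first by rewrite exprn_gt0.
pose B := undup B0.
apply: contrapT => no.
have [v0 _] : exists v0 : V, True.
  apply: contrapT => nV; apply: no; exists 0%N => x; by case: nV; exists x.
have offE : off B0 = off B by apply/seteqP; split=> e /=; rewrite mem_undup.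
have bad D : exists x1 x2, [/\ far D B x1, far D B x2 & tau_in p (off B) x1 x2 <= s ^+ 2].
  apply: contrapT => nb; apply: no; exists D => x1 x2 f1 f2; rewrite ltNge; apply/negP => le.
  apply: nb; exists x1, x2; split; last by rewrite -offE.
    by move=> e; rewrite mem_undup; exact: f1.
  by move=> e; rewrite mem_undup; exact: f2.
pose q := (1 - p) ^+ size B.
have q0 : 0 < q by rewrite exprn_gt0// subr_gt0.
have q1 : q <= 1 by rewrite exprn_ile1//; lra.
(* The lower bound makes a closing likely, and the upper bound controls the union bound; both hold
   for one [N] because [q <= 1]. *)
have [N [N1 N2]] : exists N : nat, 4 / c <= N%:R * q /\ N%:R * q <= 4 / c + 1.
  have cq0 : 0 <= 4 / c / q by rewrite !divr_ge0// ltW.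
  exists (Num.truncn (4 / c / q)).+1.
  have /andP[h1 h2] := truncn_itv cq0; split.
    by rewrite -ler_pdivrMr// ltW.
  rewrite -natr1 mulrDl mul1r lerD//.
  by rewrite -ler_pdivlMr.
have [r /(_ v0 v0)[x [Bs [_ sz uBs [szb _ le]]]]] :=
  bad_translates (o := v0) p01 c0 s0 (undup_uniq B0) tauc bad N.
have st : 2 * s / c = t by rewrite /s; field; rewrite gt_eqF.
have H := Pr_many_closings (lawP connG lfG p01) (mea_conn connG lfG v0 x) uBs szb (t := t).
rewrite -/B -/q -st in H.
move: H => /(_ le); rewrite sz st => H.
have h1 : (1 - q) ^+ N <= c / 4.
  have h2 := inv_one_plus_ge N (p := q); have q01 : 0 <= q <= 1 by lra.
  move: h2 => /(_ q01) h2.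
  have h3 : 0 <= (1 - q) ^+ N by rewrite exprn_ge0//; lra.
  have h4 : (1 - q) ^+ N * (4 / c) <= 1.
    by apply: le_trans h2; rewrite ler_wpM2l//; lra.
  by rewrite ler_pdivlMr; move: h4; rewrite ?mulrA ?ler_pdivrMr//; lra.
have h5 : N%:R * (q * t) <= c / 2 * 1.
  rewrite mulrA; apply: (@le_trans _ _ ((4 / c + 1) * t)).
    by rewrite ler_wpM2r// ltW.
  have -> : (4 / c + 1) * t = c / 2 by rewrite /t; field; rewrite ?gt_eqF//; lra.
  by rewrite mulr1.
have := tauc v0 x; rewrite /tau; lra.
Qed.

End deep_links.

(** * Exploring a cluster in a finite box *)

Section exploration.
Context {G : multigraph}.
Local Notation V := (vertex G).
Local Notation E := (edge G).
Implicit Types (x y z u v : V) (e : E) (w : config E) (L : seq E) (F : seq V).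

Lemma cluster_local (w w' : E -> bool) x : (forall e, touch (Defs.cluster w x) e -> w e = w' e) ->
  Defs.cluster w' x = Defs.cluster w x.
Proof.
move=> h; apply/seteqP; split=> y c.
  apply: (conn_ind (Q := Defs.cluster w x) c); first exact: conn_refl.
  move=> u v e xu _ we j; apply: (conn_trans xu (conn_step (e := e) _ j)).
  rewrite h; [exact: we|by exists u, v; split].
apply: (conn_ind (Q := Defs.cluster w' x) c); first exact: conn_refl.
move=> u v e xu xu' we j; apply: (conn_trans xu (conn_step (e := e) _ j)).
by rewrite -h; [exact: we|by exists u, v; split].
Qed.

Definition vertices_of L x := x :: flatten [seq [:: (ends e).1; (ends e).2] | e <- L].

(** Filtering a list that does not depend on [w] leaves finitely many outcomes ([explored_code]), as
    [explore_ge] requires. *)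
Definition explored L x w := [seq v <- vertices_of L x | `[< open_connected (rst [set` L] w) x v >]].

Lemma mem_explored L x w v : v \in explored L x w <-> open_connected (rst [set` L] w) x v.
Proof.
rewrite mem_filter; split=> [/andP[/asboolP]//|c]; rewrite asboolT//=.
apply: (conn_ind (Q := fun v => v \in vertices_of L x) c); first exact: mem_head.
move=> u z e _ _ /rstE[_ eL] j; rewrite inE; apply/orP; right.
apply/flattenP; exists [:: (ends e).1; (ends e).2]; first by apply/mapP; exists e.
by case: j => -> /=; rewrite !inE eqxx ?orbT.
Qed.

Lemma filter_code (A : eqType) (s : seq A) :
  exists codes : seq (seq A), forall a : pred A, [seq b <- s | a b] \in codes.
Proof.
exists [seq mask (val t) s | t <- enum {: (size s).-tuple bool}] => a.
rewrite filter_mask; apply/mapP.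
have sz : size [seq a b | b <- s] == size s by rewrite size_map.
by exists (Tuple sz); rewrite ?mem_enum.
Qed.

Lemma explored_code L x : exists codes : seq (seq V), forall w, explored L x w \in codes.
Proof. by have [codes h] := filter_code (vertices_of L x); exists codes => w; exact: h. Qed.

(** The outcome is determined by the edges of the box that touch it, so all other edges remain
    fresh. *)
Lemma explored_local L x w w' :
  (forall e, e \in L -> touch [set` explored L x w] e -> w e = w' e) ->
  explored L x w' = explored L x w.
Proof.
move=> h; apply: eq_filter => v.
suff c : Defs.cluster (rst [set` L] w') x = Defs.cluster (rst [set` L] w) x.
  by congr asbool; exact: (congr1 (fun S : set V => S v) c).
apply: cluster_local => e te; rewrite /rst; have [eL|eL] := boolP (e \in L).
  rewrite h//; apply: touchS te => u c; exact: (proj2 (mem_explored _ _ _ _) c).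
by rewrite asboolF ?andbF//; apply/negP.
Qed.

Lemma mea_filter_eq {d} {T : measurableType d} {S : eqType} (Q : S -> T -> Prop) (s k : seq S) :
  (forall a, mea (Q a)) -> mea (fun t => [seq a <- s | `[< Q a t >]] = k).
Proof.
move=> mQ; elim: s k => [|a s IH] k; first by rewrite /=; exact: mea_cst.
apply: (@mea_ext _ _ (fun t => (Q a t /\ a :: [seq a <- s | `[< Q a t >]] = k) \/
   (~ Q a t /\ [seq a <- s | `[< Q a t >]] = k))).
  move=> t /=; have [q|q] := pselect (Q a t).
    by rewrite asboolT//; split=> [[[]//|[]//]|]; left.
  by rewrite asboolF//; split=> [[[]//|[]//]|]; right.
apply: mea_or; last by apply: mea_and => //; exact: mea_not.
apply: mea_and => //; case: k => [|b k].
  by apply: (@mea_ext _ _ (fun=> False)); [split|exact: mea_cst].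
apply: (@mea_ext _ _ (fun t => a = b /\ [seq a <- s | `[< Q a t >]] = k)).
  by move=> t; split=> [[-> ->]//|[-> ->]].
by apply: mea_and => //; exact: mea_cst.
Qed.

Section locally_finite.
Hypotheses (connG : connected_graph G) (lfG : locally_finite G).

Lemma mea_explored L x k : mea (fun w => explored L x w = k).
Proof. by apply: mea_filter_eq => v; exact: mea_conn_rst. Qed.

(* Pigeonhole: the infinite cluster leaves the finite set [F] through finitely many edges. *)
Lemma infinite_exit (w : E -> bool) (F : set V) x : finite_set F -> infc w x -> F x ->
  exists u v e, [/\ F u, ~ F v, w e /\ joins e u v, open_connected w x v &
    infc (rst (~` touch F) w) v].
Proof.
move=> fF inf Fx; apply: contrapT => no; apply: inf.
pose N := \bigcup_(e in touch F) [set (ends e).1; (ends e).2].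
have fN : finite_set N.
  by apply: bigcup_finite => [|e _]; [exact: finite_touch|exact: finite_set2].
apply: (@sub_finite_set _ _ (F `|` \bigcup_(v in N `&` [set v | ~ infc (rst (~` touch F) w) v])
   Defs.cluster (rst (~` touch F) w) v)).
  move=> y c; have [Fy|nFy] := pselect (F y); first by left.
  have [u [v [e [Fu nFv [we j] vy]]]] := last_exit c Fx nFy.
  right; exists v => //; split; last first.
    by move=> i; apply: no; exists u, v, e; split=> //; exact: conn_trans c (conn_sym (conn_rst vy)).
  by exists e; [exists u, v|case: j => -> /=; [right|left]].
rewrite finite_setU; split=> //; apply: bigcup_finite => [|v [_ /contrapT//]].
exact: sub_finite_set fN.
Qed.

End locally_finite.
End exploration.

Section far_from_closed.
Context {R : realType} {G : multigraph}.
Hypotheses (connG : connected_graph G) (lfG : locally_finite G) (qtG : quasi_transitive G).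
Local Notation V := (vertex G).
Local Notation E := (edge G).
Local Notation P_ p := (@bond_percolation R G p).
Local Notation off B := (~` [set` B]).

(** Closing [B] far from [x] does not affect [reach r], which exceeds [infc] by at most [e] in
    probability. Conditioning on the closing divides this error by [q], hence the choice
    [e = t / 2 * q]. *)
Lemma far_infc_gt (p t : R) : 0 < p < 1 -> 0 < t -> (forall x : V, t <= theta p x) ->
  forall B : seq E, exists D, forall x : V, far D B x ->
  t / 2 <= Pr (P_ p) (fun w => infc (rst (off B) w) x).
Proof.
move=> /andP[p0 p1] t0 ht B0; have p01 : 0 <= p <= 1 by rewrite !ltW.
have lP := lawP connG lfG p01.
pose B := undup B0; pose q := (1 - p) ^+ size B; pose e := t / 2 * q.
have q0 : 0 < q by rewrite exprn_gt0// subr_gt0.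
have e0 : 0 < e by rewrite mulr_gt0// divr_gt0.
have [|||r hr] := qt_uniform qtG
  (U := fun x r => Pr (P_ p) (fun w => reach r w x) <= theta p x + e).
- move=> f g x n fg; rewrite (aut_theta connG lfG x p01 fg).
  rewrite (aut_Pr connG lfG fg p01 (mea_reach connG lfG n x) (Y := fun w => reach n w (f x)))//.
  by move=> w; rewrite (aut_reach fg).
- move=> x n m nm; apply: le_trans; apply: Pr_mono; [exact: mea_reach|exact: mea_reach|].
  by move=> w; exact: reach_le.
- move=> x; have mr n := mea_reach connG lfG n x.
  have [n hn] := Pr_down (P_ p) mr (fun n w => @reachS _ n w x) e0.
  exists n; apply: ltW; apply: lt_le_trans hn _; rewrite lerD2r; apply: Pr_mono.
  + exact: mea_alln.
  + exact: mea_infc.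
  + by move=> w; rewrite infcP.
exists r => x fx.
have offE : off B0 = off B by apply/seteqP; split=> f /=; rewrite mem_undup.
rewrite offE.
have mi := mea_infc connG lfG x; have mr := mea_reach connG lfG r x.
have mc := @mea_allclosed E B.
have qE : weight (fun=> p) B (fun=> false) = q by rewrite (weight_const (p := p)).
have h1 := Pr_closed lP (undup_uniq B0) mi.
have h2 := Pr_closed lP (undup_uniq B0) mr.
rewrite -/B qE in h1 h2.
have h3 : Pr (P_ p) (fun w => reach r w x) <= Pr (P_ p) (fun w => reach r (rst (off B) w) x).
  apply: Pr_mono => //; first exact: (mea_rst (off B) (X := fun w : config E => reach r w x) mr).
  move=> w; apply: reach_rst => f tf /= fB; apply: (fx f _ tf).
  by move: fB; rewrite mem_undup.
have h4 : Pr (P_ p) (fun w => allclosed B w /\ reach r w x) <=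
    Pr (P_ p) (fun w => allclosed B w /\ infc w x) + e.
  have s1 := Pr_split (P_ p) mr mi.
  have s2 := Pr_split (P_ p) (mea_and mc mr) mi.
  have i1 : Pr (P_ p) (fun w => reach r w x /\ infc w x) = theta p x.
    by apply: Pr_ext => w; split=> [[]//|i]; split=> //; exact: (proj1 (infcP connG lfG w x) i r).
  have i2 : Pr (P_ p) (fun w => (allclosed B w /\ reach r w x) /\ infc w x) =
      Pr (P_ p) (fun w => allclosed B w /\ infc w x).
    apply: Pr_ext => w; split=> [[[]]//|[c i]]; split=> //; split=> //.
    exact: (proj1 (infcP connG lfG w x) i r).
  have i3 : Pr (P_ p) (fun w => (allclosed B w /\ reach r w x) /\ ~ infc w x) <=
      Pr (P_ p) (fun w => reach r w x /\ ~ infc w x).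
    apply: Pr_mono.
    - by apply: mea_and; [exact: mea_and|exact: mea_not].
    - by apply: mea_and => //; exact: mea_not.
    - by move=> w [[]].
  have := hr x; lra.
have tx : t <= Pr (P_ p) (fun w => reach r w x).
  apply: le_trans (ht x) _; apply: Pr_mono => // w i.
  exact: (proj1 (infcP connG lfG w x) i r).
have h5 : q * t <= q * Pr (P_ p) (fun w => reach r (rst (off B) w) x).
  by rewrite ler_wpM2l ?(ltW q0)//; lra.
rewrite -(ler_pM2l q0); rewrite /e in h4; lra.
Qed.

End far_from_closed.

(** * Gluing the clusters of a lower level *)

Section two_levels.
Context {R : realType} {G : multigraph}.
Hypotheses (connG : connected_graph G) (lfG : locally_finite G).
Local Notation V := (vertex G).
Local Notation E := (edge G).
Local Notation off M := (~` [set` M]).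
Context {p s : R} {PP : probability (config (E + E)%type) R}.
Hypotheses (lPP : blaw (pair_par p s) PP) (s0 : 0 < s) (s1 : s <= 1).
Implicit Types (x y z u v o : V) (e : E) (w : config (E + E)%type) (M L : seq E) (F : seq V).

Definition fiber (A : set E) : set (E + E) :=
  [set i | A (match i with inl e => e | inr e => e end)].

Lemma fiber_lowc A w w' : (forall i, fiber A i -> w i = w' i) ->
  forall e, A e -> lowc w e = lowc w' e.
Proof. by move=> h e Ae; exact: h. Qed.

Lemma fiber_orc A w w' : (forall i, fiber A i -> w i = w' i) ->
  forall e, A e -> orc w e = orc w' e.
Proof. by move=> h e Ae; rewrite /orc !h. Qed.

Lemma lowc_orc w e : lowc w e -> orc w e.
Proof. by rewrite /lowc /orc => ->. Qed.

Lemma conn_lowc_orc w x y : open_connected (lowc w) x y -> open_connected (orc w) x y.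
Proof. by apply: conn_mono; exact: lowc_orc. Qed.

Lemma dep_explored (L : seq E) x F (c : config (E + E)%type -> config E) :
  (forall A w w', (forall i, fiber A i -> w i = w' i) -> forall e, A e -> c w e = c w' e) ->
  dep (fiber ([set` L] `&` touch [set` F])) (fun w => explored L x (c w) = F).
Proof.
move=> hc w w' h eF; rewrite -eF; apply: explored_local => e eL te.
by apply: (hc _ _ _ h e); split=> //; rewrite eF in te.
Qed.

Lemma mea_explored_pre (L : seq E) x F (c : config (E + E)%type -> config E) :
  (forall X : config E -> Prop, mea X -> mea (fun w => X (c w))) ->
  mea (fun w => explored L x (c w) = F).
Proof. by move=> mc; apply: (mc (fun w : config E => explored L x w = F)); exact: mea_explored. Qed.

Lemma approx_edges (D : config (E + E)%type -> Prop) (d : R) : mea D -> 0 < d -> exists M D',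
  [/\ mea D', dep (fiber [set` M]) D' & Pr PP (sdiff D D') < d].
Proof.
move=> mD d0; have [J [D' [mD' dD' lt]]] := approxP (P := PP) mD d0.
exists [seq (match i with inl e => e | inr e => e end) | i <- J], D'; split=> //.
by apply: depS dD' => i iJ /=; apply/mapP; exists i.
Qed.

Section fresh.
Context {D : config (E + E)%type -> Prop} {T : seq E -> config (E + E)%type -> Prop}.
Hypotheses (mD : mea D) (mT : forall M, mea (T M)).
Hypothesis monoT : forall M M' w, {subset M <= M'} -> T M' w -> T M w.

Lemma mea_fresh : mea (fun w => D w /\ forall M, T M w).
Proof.
have [EL [mono ex]] := edge_exhaustion connG lfG.
apply: mea_and => //; apply: (@mea_ext _ _ (fun w => forall n, T (EL n) w)); last exact: mea_alln.
move=> w; split=> h M //.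
have [n sub] := exhaustion_subset M mono ex; exact: monoT sub (h n).
Qed.

(** [T] decreases in [M], so a bound uniform in [M] passes to the limit along an exhaustion of the
    edges. *)
Lemma fresh_limit (b : R) M0 : (forall M, {subset M0 <= M} -> b <= Pr PP (fun w => D w /\ T M w)) ->
  b <= Pr PP (fun w => D w /\ forall M, T M w).
Proof.
move=> h; have [EL [mono ex]] := edge_exhaustion connG lfG.
have sub n : {subset M0 ++ EL n <= M0 ++ EL n.+1}.
  by move=> e; rewrite !mem_cat => /orP[->//|/mono ->]; rewrite orbT.
apply: (@le_trans _ _ (Pr PP (fun w => forall n, D w /\ T (M0 ++ EL n) w))).
  apply: Pr_down_ge => [n|n w [d t]|n]; first exact: mea_and.
    by split=> //; exact: monoT t.
  by apply: h => e eM; rewrite mem_cat eM.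
apply: Pr_mono; [by apply: mea_alln => n; exact: mea_and|exact: mea_fresh|].
move=> w t; split; first by have [] := t 0%N.
move=> M; have [n subM] := exhaustion_subset M mono ex.
apply: (@monoT _ (M0 ++ EL n)); last by have [] := t n.
by move=> e /subM eM; rewrite mem_cat eM orbT.
Qed.

End fresh.

Section avoiding_low_clusters.
Context {o : V} {t : R}.
Hypothesis t0 : 0 < t.
Hypothesis far_low : forall M, exists D, forall x, far D M x ->
  t <= Pr PP (fun w => infc (rst (off M) (lowc w)) x).

Let B w := infc (orc w) o /\ forall y, open_connected (orc w) o y -> ~ infc (lowc w) y.

Let T M w := exists y z e, (joins e y z /\ e \notin M) /\
  (open_connected (orc w) o y /\ infc (lowc w) z).

(** [Fr] and [Ex] are the two ways in which an infinite lower cluster can leave the explored set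
    [F]. In [Fr] the exit edge lies outside the box, hence is unexplored, and its being open is part
    of the event. In [Ex] it lies in the box and its state is already known, so only what lies
    beyond it is fresh. *)
Let Fr L M F w := exists y z e, [/\ joins e y z, y \in F, z \notin F, e \notin M & e \notin L] /\
  (lowc w e /\ infc (rst (~` touch [set` F]) (rst (off M) (lowc w))) z).

Let Ex L M F w := exists y z e, [/\ joins e y z, y \in F, z \notin F, e \notin M & e \in L] /\
  infc (rst (~` touch [set` F]) (rst (off M) (lowc w))) z.

Let cV := countable_vertices connG lfG.
Let cE := countable_edges connG lfG.

Let mea3 (Q : V -> V -> E -> Prop) (X : V -> V -> E -> config (E + E)%type -> Prop) :
  (forall y z e, mea (X y z e)) -> mea (fun w => exists y z e, Q y z e /\ X y z e w).
Proof.
move=> mX; apply: (mea_ex cV) => y; apply: (mea_ex cV) => z; apply: (mea_ex cE) => e.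
by apply: mea_and => //; exact: mea_cst.
Qed.

Let mea_out F M z : mea (fun w => infc (rst (~` touch [set` F]) (rst (off M) (lowc w))) z).
Proof.
have m1 := mea_rst (~` touch [set` F]) (X := fun w : config E => infc w z) (mea_infc connG lfG z).
have m2 := mea_rst (off M) (X := fun w : config E => infc (rst (~` touch [set` F]) w) z) m1.
exact: (mea_lowc m2).
Qed.

Let mFr L M F : mea (Fr L M F).
Proof. by apply: mea3 => y z e; apply: mea_and => //; exact: mea_coord. Qed.

Let mEx L M F : mea (Ex L M F).
Proof. exact: mea3. Qed.

Let mB : mea B.
Proof.
apply: mea_and; first exact: (mea_orc (mea_infc connG lfG o)).
apply: (mea_all cV) => y; apply: mea_imp; first exact: (mea_orc (mea_conn connG lfG o y)).
by apply: mea_not; exact: (mea_lowc (mea_infc connG lfG y)).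
Qed.

Let mT M : mea (T M).
Proof.
apply: mea3 => y z e; apply: mea_and; first exact: (mea_orc (mea_conn connG lfG o y)).
exact: (mea_lowc (mea_infc connG lfG z)).
Qed.

Let fresh_set L M F : set (E + E) := ~` (fiber ([set` L] `&` touch [set` F]) `|` fiber [set` M]).

Let out_agree L M F w w' : (forall i, fresh_set L M F i -> w i = w' i) ->
  rst (~` touch [set` F]) (rst (off M) (lowc w)) = rst (~` touch [set` F]) (rst (off M) (lowc w')).
Proof.
move=> h; apply/funext => e; rewrite /rst.
have [te|te] := pselect (touch [set` F] e).
  by rewrite [X in _ && X]asboolF ?andbF//= ?[X in _ = _ && X]asboolF ?andbF//; apply.
have [eM|eM] := boolP (e \in M).
  by rewrite (_ : `[< off M e >] = false) ?andbF//; apply: asboolF; apply.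
by rewrite /lowc h//= => -[[]|/=]; [|apply/negP].
Qed.

Let dFr L M F : dep (fresh_set L M F) (Fr L M F).
Proof.
move=> w w' h [y [z [e [st [we inf]]]]]; exists y, z, e; split=> //; split; last first.
  by rewrite -(out_agree h).
have [_ _ _ eM eL] := st; move: we; rewrite /lowc h// => -[[/= eL' _]|/= eM'].
  by rewrite eL' in eL.
by rewrite eM' in eM.
Qed.

Let dEx L M F : dep (fresh_set L M F) (Ex L M F).
Proof.
move=> w w' h [y [z [e [st inf]]]]; exists y, z, e; split=> //.
by rewrite -(out_agree h).
Qed.

Let Fr_or_Ex L M F D x : (forall x, far D M x -> t <= Pr PP (fun w => infc (rst (off M) (lowc w)) x)) ->
  x \in F -> far D M x -> t / 2 <= Pr PP (Fr L M F) \/ t / 2 <= Pr PP (Ex L M F).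
Proof.
move=> hD xF fx.
have : t <= Pr PP (fun w => Fr L M F w \/ Ex L M F w).
  apply: le_trans (hD x fx) _; apply: Pr_mono; last first.
  - move=> w inf.
    have [y [z [e [yF zF [we j] _ iz]]]] := infinite_exit lfG (finite_seq F) inf xF.
    move/rstE: we => [we /negP eM].
    have zF' : z \notin F by apply/negP.
    have [eL|eL] := boolP (e \in L); [right|left]; exists y, z, e; split=> //; split=> //.
  - exact: mea_or.
  - exact: (mea_lowc (mea_rst (off M) (X := fun w : config E => infc w x) (mea_infc connG lfG x))).
have := Pr_or PP (mFr L M F) (mEx L M F).
have [le|lt] := leP (t / 2) (Pr PP (Fr L M F)); first by left.
by move=> ? ?; right; lra.
Qed.

Let farF D M F := exists2 x, x \in F & far D M x.

(** In a large box the upper cluster of [o] reaches a vertex far from [M], whose lower cluster is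
    infinite off [M] with probability at least [t]. This makes [Fr] or [Ex] likely given the
    outcome. [Fr] is incompatible with [B], so [Ex] prevails and gives the contact [T M]. *)
Let touch_fresh_gt : 0 < Pr PP B -> exists2 b, 0 < b &
  exists M0, forall M, {subset M0 <= M} -> b <= Pr PP (fun w => B w /\ T M w).
Proof.
(* Replacing [B] by [B'] and stopping at a finite box cost [h * (2 * u + 2)] in all, which this [h]
   makes half of [u * d]. *)
set d := Pr PP B => d0; pose u := t / 2; pose h := u * d / (4 * (u + 1)).
have u0 : 0 < u by rewrite divr_gt0.
have h0 : 0 < h by rewrite divr_gt0 ?mulr_gt0//; lra.
have hE : h * (2 * u + 2) = u * d / 2 by rewrite /h; field; lra.
exists (u * d / 2); first by rewrite divr_gt0// mulr_gt0.
have [M0 [B' [mB' dB' ltB]]] := approx_edges mB h0.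
exists M0 => M sub.
have [D hD] := far_low M.
have [EL [mono ex]] := edge_exhaustion connG lfG.
pose X n w := B w /\ farF D M (explored (EL n) o (orc w)).
have mC n F : mea (fun w => explored (EL n) o (orc w) = F).
  by apply: mea_explored_pre => Y; exact: mea_orc.
have mcode n (Q : seq V -> Prop) : mea (fun w => Q (explored (EL n) o (orc w))).
  have [codes hc] := explored_code (EL n) o.
  by apply: (mea_code (fun w => hc (orc w)) (mC n) (F := fun k _ => Q k)) => k; exact: mea_cst.
have mX n : mea (X n) by apply: mea_and => //; exact: mcode.
have [n hn] : exists n, d - h < Pr PP (X n).
  have monoX n w : X n w -> X n.+1 w.
    move=> [b [x xF fx]]; split=> //; exists x => //; apply/mem_explored.
    by move/mem_explored: xF; apply: conn_rstS => e; exact: mono.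
  have [n hn] := Pr_up PP mX monoX h0; exists n; apply: le_lt_trans hn.
  rewrite lerD2r; apply: Pr_mono => //; first exact: mea_exn.
  move=> w b; have [x [xK fx]] := far_infinite lfG D M (proj1 b).
  have [k c] := conn_exhaust mono ex xK; exists k; split=> //; exists x => //.
  exact/mem_explored.
pose C w := explored (EL n) o (orc w).
have [codes hc] := explored_code (EL n) o.
have dC F : dep (fiber ([set` EL n] `&` touch [set` F])) (fun w => C w = F).
  by apply: dep_explored => A w w' hA; exact: fiber_orc.
have dM : dep (fiber [set` M]) B' by apply: depS dB' => i /=; exact: sub.
have msd := mea_sdiff mB mB'.
pose Q1 F := u <= Pr PP (Fr (EL n) M F); pose Q2 F := u <= Pr PP (Ex (EL n) M F).
(* An open lower edge joins [o] to an infinite lower cluster, so [Fr] only occurs where [B] and [B']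
   differ. *)
have a1 : u * Pr PP (fun w => B' w /\ Q1 (C w)) <= h.
  apply: le_trans (explore_ge lPP (fun w => hc (orc w)) (mC n) dC mB' dM (mFr (EL n) M) (@dFr (EL n) M) (Q := Q1) (fun w => id)) _.
  apply: le_trans (ltW ltB); apply: Pr_mono => //.
    apply: mea_and => //; apply: mea_and; first exact: (mcode n Q1).
    exact: (mea_code (fun w => hc (orc w)) (mC n) (mFr (EL n) M)).
  move=> w [b' [_ [y [z [e [[j yC zC eM eL] [we inf]]]]]]]; right; split=> //.
  move=> [_ no]; apply: (no z); last first.
    by apply: infc_mono inf => f /rstE[/rstE[]].
  move/mem_explored: yC => /conn_rst yC; apply: (conn_trans yC (conn_step _ j)).
  exact: lowc_orc.
have a2 : u * Pr PP (fun w => B' w /\ Q2 (C w)) <= Pr PP (fun w => B w /\ T M w) + h.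
  apply: le_trans (explore_ge lPP (fun w => hc (orc w)) (mC n) dC mB' dM (mEx (EL n) M) (@dEx (EL n) M) (Q := Q2) (fun w => id)) _.
  have mBT := mea_and mB (mT M).
  apply: le_trans (lerD (lexx _) (ltW ltB)); apply: le_trans (Pr_or PP mBT msd).
  apply: Pr_mono; last 1 first.
  - move=> w [b' [_ [y [z [e [[j yC zC eM eL] inf]]]]]].
    have [b|nb] := pselect (B w); last by right; right.
    left; split=> //; exists y, z, e; split=> //; split.
      by move/mem_explored: yC => /conn_rst.
    by apply: infc_mono inf => f /rstE[/rstE[]].
  - apply: mea_and => //; apply: mea_and; first exact: (mcode n Q2).
    exact: (mea_code (fun w => hc (orc w)) (mC n) (mEx (EL n) M)).
  - exact: mea_or.
have mQ1 := mea_and mB' (mcode n Q1); have mQ2 := mea_and mB' (mcode n Q2).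
have a3 : Pr PP (X n) <= Pr PP (fun w => B' w /\ Q1 (C w)) + Pr PP (fun w => B' w /\ Q2 (C w)) + h.
  apply: le_trans (lerD (Pr_or PP mQ1 mQ2) (ltW ltB)).
  apply: le_trans (Pr_or PP (mea_or mQ1 mQ2) msd); apply: Pr_mono => //.
    by apply: mea_or => //; exact: mea_or.
  move=> w [b [x xC fx]]; have [b'|nb'] := pselect (B' w); last by right; left.
  by left; case: (Fr_or_Ex (EL n) hD xC fx); [left|right].
nra.
Qed.

(** With the lower level frozen, the union [W] of its infinite clusters is fixed. Each contact
    offers an edge whose sprinkled copy must be closed, and contacts exist off every finite set.
    [tr] reaches the contact by edges off [W], so it ignores the sprinkling of the edges touching
    [W], as [null_hits] demands. *)
Let touch_fresh0 : Pr PP (fun w => B w /\ forall M, T M w) = 0.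
Proof.
have monoT M M' w : {subset M <= M'} -> T M' w -> T M w.
  move=> sub [y [z [e [[j eM] h]]]]; exists y, z, e; split=> //; split=> //.
  by apply/negP => /sub; exact/negP.
have mN := mea_fresh mB mT monoT.
apply: (null_mix lPP (A := range inl) mN) => w1.
have lowE w2 : lowc (mix (range inl) w1 w2) = lowc w1.
  by apply/funext => e; rewrite /lowc mixT//; exists e.
pose W := [set z | infc (lowc w1) z].
pose c w2 := orc (mix (range inl) w1 w2).
pose tr w2 (J : seq (E + E)) := exists e y z, [/\ J = [:: inr e], joins e y z, W z &
  open_connected (rst (~` touch W) (c w2)) o y].
apply: (null_hits lPP (S := [set i | exists2 e, i = inr e & touch W e]) (q := s) (tr := tr)) => //.
- by move=> _ [e -> _].
- exact: (mea_mix (range inl) w1 mN).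
- move=> J w w' h [e [y [z [JE j Wz cc]]]]; exists e, y, z; split=> //.
  suff -> : rst (~` touch W) (c w') = rst (~` touch W) (c w) by [].
  apply/funext => f; rewrite /rst; have [tf|tf] := pselect (touch W f).
    by rewrite (_ : `[< (~` touch W) f >] = false) ?andbF//; apply: asboolF => ntf; exact: ntf.
  have cfE w2 : c w2 f = w1 (inl f) || w2 (inr f).
    rewrite /c /orc [X in X || _]mixT; last by exists f.
    by rewrite [X in _ || X]mixF//; case.
  by rewrite !cfE h//= => -[g [<-]].
- move=> w J [[inf no] fresh].
  pose M := pmap (fun i : E + E => if i is inr e then Some e else None) J.
  have [y [z [e [[j eM] [oy iz]]]]] := fresh M.
  rewrite lowE in iz.
  exists [:: inr e]; split=> //.
  + move=> i; rewrite inE => /eqP->; exists e => //; exists z, y; split=> //; exact: joins_sym.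
  + move=> i; rewrite inE => /eqP->; apply/negP => eJ; move/negP: eM; apply.
    by rewrite mem_pmap; apply/mapP; exists (inr e).
  + exists e, y, z; split=> //.
    (* Under [B] the upper cluster of [o] contains no vertex of [W], so none of its open edges
       touches [W]. *)
    apply: (conn_ind (Q := fun y => open_connected (rst (~` touch W) (c w)) o y) oy); first exact: conn_refl.
    move=> u v f ou ou' wf jf; apply: (conn_trans ou (conn_step (e := f) _ jf)).
    apply/rstE; split=> // -[a [b [Wa jab]]]; have := no a; rewrite lowE; apply=> //.
    case: (joins_ends jf jab) => ->//.
    exact: conn_trans ou' (conn_step wf jf).
- move=> w J [[inf no] _] [e [y [z [-> j Wz oy]]]]; exists (inr e); first exact: mem_head.
  apply/negP => we; have := no z; rewrite lowE; apply=> //.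
  apply: (conn_trans (conn_rst oy) (conn_step (e := e) _ j)).
  by rewrite /c /orc [X in _ || X]mixF ?we ?orbT//; case.
Qed.

(* Schonmann's argument: exploring an upper cluster in a finite box leaves a fresh chance that it
   meets an infinite lower cluster just outside, so almost surely it would do so infinitely often,
   and one of these contacts would be sprinkled. *)
Lemma infinite_orc_avoiding_low0 :
  Pr PP (fun w => infc (orc w) o /\ forall y, open_connected (orc w) o y -> ~ infc (lowc w) y) = 0.
Proof.
apply/le_anti; rewrite Pr_ge0 andbT leNgt; apply/negP => /touch_fresh_gt[b b0 [M0 h]].
have monoT M M' w : {subset M <= M'} -> T M' w -> T M w.
  move=> sub [y [z [e [[j eM] h']]]]; exists y, z, e; split=> //; split=> //.
  by apply/negP => /sub; exact/negP.
by have := fresh_limit mB mT monoT h; rewrite touch_fresh0 leNgt b0.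
Qed.

End avoiding_low_clusters.
End two_levels.

Section joining.
Context {R : realType} {G : multigraph}.
Hypotheses (connG : connected_graph G) (lfG : locally_finite G).
Local Notation V := (vertex G).
Local Notation E := (edge G).
Local Notation off M := (~` [set` M]).
Context {p s : R} {PP : probability (config (E + E)%type) R}.
Hypotheses (lPP : blaw (pair_par p s) PP) (s0 : 0 < s) (s1 : s <= 1).
Implicit Types (x y z u v : V) (e : E) (w : config (E + E)%type) (M L : seq E) (F : seq V * seq V)
  (K : set V).

(* Exploring in a finite box the lower clusters of two vertices until they reach far, deep links
   join them by fresh edges with probability at least [t]. If the upper level does not join them,
   this happens for infinitely many disjoint sets of sprinkled edges touching the lower clusters. *)
Section two_vertices.
Context {y1 y2 : V} {t : R}.
Hypothesis t0 : 0 < t.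
Hypothesis deep : forall M, exists D, forall x1 x2, far D M x1 -> far D M x2 ->
  t <= Pr PP (fun w => open_connected (rst (off M) (orc w)) x1 x2).

Let B w := (infc (lowc w) y1 /\ infc (lowc w) y2) /\ ~ open_connected (orc w) y1 y2.

(** Granting the edges that touch [K] makes the link independent of the explored edges ([dLk]). The
    one or two granted edges that matter are to be opened by sprinkling. *)
Let boost K M w : config E := fun e => (e \notin M) && (orc w e || `[< touch K e >]).

Let low_clusters w : set V := Defs.cluster (lowc w) y1 `|` Defs.cluster (lowc w) y2.

Let T M w := exists a b, [/\ open_connected (lowc w) y1 a, open_connected (lowc w) y2 b &
  open_connected (boost (low_clusters w) M w) a b].

Let both F : set V := [set` F.1] `|` [set` F.2].

Let Lk M F w := exists a b, (a \in F.1 /\ b \in F.2) /\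
  open_connected (boost (both F) M w) a b.

Let cV := countable_vertices connG lfG.
Let cE := countable_edges connG lfG.

Let mB : mea B.
Proof.
apply: mea_and; first by apply: mea_and; exact: (mea_lowc (mea_infc connG lfG _)).
by apply: mea_not; exact: (mea_orc (mea_conn connG lfG y1 y2)).
Qed.

Let mea_boost (K : config (E + E)%type -> set V) M a b : (forall e, mea (fun w => touch (K w) e)) ->
  mea (fun w => open_connected (boost (K w) M w) a b).
Proof.
move=> mK; apply: (@mea_pre _ _ _ (fun w => boost (K w) M w) _ _ (mea_conn connG lfG a b)) => e.
apply: (@mea_ext _ _ (fun w => e \notin M /\ (orc w e \/ touch (K w) e))).
  move=> w; rewrite /boost; split=> [[-> /=] [->//|h]|/andP[-> /orP[->|/asboolP]]].
  - by rewrite asboolT ?orbT.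
  - by split=> //; left.
  - by split=> //; right.
apply: mea_and; first exact: mea_cst.
by apply: mea_or => //; exact: (mea_orc (mea_coord e)).
Qed.

Let mT M : mea (T M).
Proof.
apply: (mea_ex cV) => a; apply: (mea_ex cV) => b.
apply: (@mea_ext _ _ (fun w => (open_connected (lowc w) y1 a /\ open_connected (lowc w) y2 b) /\
  open_connected (boost (low_clusters w) M w) a b)); first by move=> w; split=> [[[]]|[]].
apply: mea_and.
  by apply: mea_and; exact: (mea_lowc (mea_conn connG lfG _ _)).
apply: mea_boost => e.
apply: (mea_ex cV) => u; apply: (mea_ex cV) => v; apply: mea_and; last exact: mea_cst.
by apply: mea_or; exact: (mea_lowc (mea_conn connG lfG _ _)).
Qed.

Let mLk M F : mea (Lk M F).
Proof.
apply: (mea_ex cV) => a; apply: (mea_ex cV) => b.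
apply: mea_and; first exact: mea_cst.
by apply: mea_boost => e; exact: mea_cst.
Qed.

Let C L w := (explored L y1 (lowc w), explored L y2 (lowc w)).

Let seen L F : set (E + E) := fiber ([set` L] `&` touch (both F)).

Let dC L F : dep (seen L F) (fun w => C L w = F).
Proof.
move=> w w' h e; rewrite -e; congr (_, _); apply: explored_local => f fL tf;
  apply: (fiber_lowc (A := [set` L] `&` touch (both F))) => //; split=> //; rewrite -e;
  apply: touchS tf => u uC; first [by left|by right].
Qed.

Let dLk M L F : dep (~` (seen L F `|` fiber [set` M])) (Lk M F).
Proof.
move=> w w' h [a [b [ab c]]]; exists a, b; split=> //.
apply: conn_mono c => e /andP[eM]; rewrite /boost eM /=.
have [te|te] := pselect (touch (both F) e); first by rewrite [in X in _ -> X]asboolT ?orbT.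
rewrite asboolF// !orbF /orc !h//=.
- by case=> [[_ te']|eM']; [exact: te|move/negP: eM].
- by case=> [[_ te']|eM']; [exact: te|move/negP: eM].
Qed.

Let mC L F : mea (fun w => C L w = F).
Proof.
apply: (@mea_ext _ _ (fun w => explored L y1 (lowc w) = F.1 /\ explored L y2 (lowc w) = F.2)).
  by move=> w; rewrite /C; case: F => F1 F2 /=; split=> [[-> ->]|[]].
by apply: mea_and; apply: (mea_explored_pre connG lfG) => Y; exact: mea_lowc.
Qed.

Let codes L : exists cs : seq (seq V * seq V), forall w, C L w \in cs.
Proof.
have [c1 h1] := explored_code L y1; have [c2 h2] := explored_code L y2.
exists [seq (a, b) | a <- c1, b <- c2] => w; apply/allpairsP.
by exists (C L w); split; [exact: h1|exact: h2|].
Qed.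

Let farF D M F := (exists2 x, x \in F.1 & far D M x) /\ (exists2 x, x \in F.2 & far D M x).

(** The scheme of [touch_fresh_gt] with two explorations of the lower level. Their boxes are
    enlarged until both meet vertices far from [M], between which [deep] applies. *)
Let joined_fresh_gt : 0 < Pr PP B -> exists2 b, 0 < b &
  exists M0, forall M, {subset M0 <= M} -> b <= Pr PP (fun w => B w /\ T M w).
Proof.
set d := Pr PP B => d0; pose h := t * d / (4 * (t + 1)).
have tt0 : 0 < t := t0.
have t1 : 0 < t + 1 by rewrite addr_gt0.
have h0 : 0 < h by rewrite divr_gt0 ?mulr_gt0.
have hE : h * (2 * t + 2) = t * d / 2 by rewrite /h; field; rewrite gt_eqF.
exists (t * d / 2); first by rewrite divr_gt0// mulr_gt0.
have [M0 [B' [mB' dB' ltB]]] := approx_edges (PP := PP) mB h0.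
exists M0 => M sub.
have [D hD] := deep M.
have [EL [mono ex]] := edge_exhaustion connG lfG.
pose X n w := B w /\ farF D M (C (EL n) w).
have mcode n (Q : seq V * seq V -> Prop) : mea (fun w => Q (C (EL n) w)).
  have [cs hc] := codes (EL n).
  by apply: (mea_code hc (mC (EL n)) (F := fun k _ => Q k)) => k; exact: mea_cst.
have mX n : mea (X n) by apply: mea_and => //; exact: mcode.
have monoC n y w x : x \in explored (EL n) y (lowc w) -> x \in explored (EL n.+1) y (lowc w).
  by move/mem_explored => c; apply/mem_explored; apply: conn_rstS c => e; exact: mono.
have [n hn] : exists n, d - h < Pr PP (X n).
  have monoX n w : X n w -> X n.+1 w.
    by move=> [b [[x xF fx] [x' xF' fx']]]; split=> //; split; [exists x|exists x'] => //; exact: monoC.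
  have [n hn] := Pr_up PP mX monoX h0; exists n; apply: le_lt_trans hn.
  rewrite lerD2r; apply: Pr_mono => //; first exact: mea_exn.
  move=> w b; have [[i1 i2] _] := b.
  have [x1 [c1 f1]] := far_infinite lfG D M i1.
  have [x2 [c2 f2]] := far_infinite lfG D M i2.
  have [n1 e1] := conn_exhaust mono ex c1; have [n2 e2] := conn_exhaust mono ex c2.
  have le k l y x : x \in explored (EL k) y (lowc w) -> x \in explored (EL (k + l)%N) y (lowc w).
    by elim: l => [|l IH]; rewrite ?addn0// addnS => hx; apply: monoC; exact: IH.
  exists (n1 + n2)%N; split=> //; split; [exists x1 => //|exists x2 => //].
    by apply: le; exact/mem_explored.
  by rewrite addnC; apply: le; exact/mem_explored.
have [cs hc] := codes (EL n).
have dM : dep (fiber [set` M]) B' by apply: depS dB' => i /=; exact: sub.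
have msd := mea_sdiff mB mB'.
have link w : farF D M (C (EL n) w) -> t <= Pr PP (Lk M (C (EL n) w)).
  set F := C _ _ => -[[x1 x1F f1] [x2 x2F f2]]; apply: le_trans (hD _ _ f1 f2) _.
  apply: Pr_mono => //.
    exact: (mea_orc (mea_conn_rst connG lfG (off M) x1 x2)).
  move=> w' c; exists x1, x2; split=> //; apply: conn_mono c => e /rstE[we eM].
  by rewrite /boost we andbT; apply/negP.
have a2 := explore_ge lPP hc (mC (EL n)) (@dC (EL n)) mB' dM (mLk M) (@dLk M (EL n)) (Q := farF D M) link.
have mBT := mea_and mB (mT M).
have a3 : Pr PP (fun w => B' w /\ farF D M (C (EL n) w) /\ Lk M (C (EL n) w) w) <=
    Pr PP (fun w => B w /\ T M w) + h.
  apply: le_trans (lerD (lexx _) (ltW ltB)); apply: le_trans (Pr_or PP mBT msd).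
  apply: Pr_mono.
  - apply: mea_and => //; apply: mea_and; first exact: (mcode n (farF D M)).
    exact: (mea_code hc (mC (EL n)) (mLk M)).
  - exact: mea_or.
  move=> w [b' [_ [a [b [[aF bF] c]]]]].
  have [bw|nb] := pselect (B w); last by right; right.
  left; split=> //; exists a, b; split.
  - by move/mem_explored: aF => /conn_rst.
  - by move/mem_explored: bF => /conn_rst.
  - apply: conn_mono c => e /andP[eM]; rewrite /boost eM /= => /orP[->//|/asboolP te].
    rewrite asboolT ?orbT//; apply: touchS te => u [/mem_explored/conn_rst uu|/mem_explored/conn_rst uu].
      by left.
    by right.
have mQ := mea_and mB' (mcode n (farF D M)).
have a4 : Pr PP (X n) <= Pr PP (fun w => B' w /\ farF D M (C (EL n) w)) + h.
  apply: le_trans (lerD (lexx _) (ltW ltB)); apply: le_trans (Pr_or PP mQ msd); apply: Pr_mono => //.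
    exact: mea_or.
  move=> w [b f]; have [b'|nb'] := pselect (B' w); [by left|by right; left].
nra.
Qed.

Let monoT M M' w : {subset M <= M'} -> T M' w -> T M w.
Proof.
move=> sub [a [b [c1 c2 c]]]; exists a, b; split=> //.
apply: conn_mono c => e /andP[eM h]; rewrite /boost h andbT.
by apply/negP => /sub; exact/negP.
Qed.

(** With the lower level frozen, [K1] and [K2] are fixed and, under [B], disjoint. [link_between]
    turns each boosted link into one or two edges whose sprinkled copies, if all open, would join
    [y1] to [y2]. *)
Let joined_fresh0 : Pr PP (fun w => B w /\ forall M, T M w) = 0.
Proof.
have mN := mea_fresh connG lfG mB mT monoT.
apply: (null_mix lPP (A := range inl) mN) => w1.
have lowE w2 : lowc (mix (range inl) w1 w2) = lowc w1.
  by apply/funext => e; rewrite /lowc mixT//; exists e.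
pose K1 := Defs.cluster (lowc w1) y1; pose K2 := Defs.cluster (lowc w1) y2.
pose c w2 := orc (mix (range inl) w1 w2).
have inS (K : set V) w2 e : w2 (inr e) -> c w2 e.
  by move=> we; rewrite /c /orc [X in _ || X]mixF ?we ?orbT//; case.
pose tr w2 (J : seq (E + E)) :=
  (exists u v e, [/\ J = [:: inr e], K1 u, K2 v & joins e u v]) \/
  (exists u v u' v' e1 e2, [/\ J = [:: inr e1; inr e2], K1 u /\ K2 v,
     joins e1 u u', joins e2 v' v & open_connected (rst (~` touch (K1 `|` K2)) (c w2)) u' v']).
apply: (null_hits lPP (S := [set i | exists2 e, i = inr e & touch (K1 `|` K2) e]) (q := s) (tr := tr)) => //.
- by move=> _ [e -> _].
- exact: (mea_mix (range inl) w1 mN).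
- move=> J w w' h [l|[u [v [u' [v' [e1 [e2 [JE uv j1 j2 cc]]]]]]]]; first by left.
  right; exists u, v, u', v', e1, e2; split=> //.
  suff -> : rst (~` touch (K1 `|` K2)) (c w') = rst (~` touch (K1 `|` K2)) (c w) by [].
  apply/funext => f; rewrite /rst; have [tf|tf] := pselect (touch (K1 `|` K2) f).
    by rewrite (_ : `[< (~` touch (K1 `|` K2)) f >] = false) ?andbF//; apply: asboolF => ntf; exact: ntf.
  have cfE w2 : c w2 f = w1 (inl f) || w2 (inr f).
    rewrite /c /orc [X in X || _]mixT; last by exists f.
    by rewrite [X in _ || X]mixF//; case.
  by rewrite !cfE h//= => -[g [<-]].
- move=> w J [[[i1 i2] ndis] fresh].
  pose M := pmap (fun i : E + E => if i is inr e then Some e else None) J.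
  have MJ e : e \notin M -> inr e \notin J.
    by move=> eM; apply/negP => eJ; move/negP: eM; apply; rewrite mem_pmap; apply/mapP; exists (inr e).
  have [a [b []]] := fresh M; rewrite /low_clusters !lowE -/K1 -/K2 => a1 b2 ab.
  have dis z : K1 z -> K2 z -> False.
    move=> k1 k2; apply: ndis; apply: conn_lowc_orc; rewrite lowE.
    exact: conn_trans k1 (conn_sym k2).
  have [[u [v [e [u1 v2 /andP[eM _] j]]]]|[u [v [u' [v' [e1 [e2 [[u1 v2] [/andP[eM1 _] j1] [/andP[eM2 _] j2] cc]]]]]]]] :=
      link_between ab a1 b2 dis.
    exists [:: inr e]; split=> //.
    + by move=> i; rewrite inE => /eqP->; exists e => //; exists u, v; split=> //; left.
    + by move=> i; rewrite inE => /eqP->; exact: MJ.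
    + by left; exists u, v, e.
  exists [:: inr e1; inr e2]; split=> //.
  + move=> i; rewrite !inE => /orP[/eqP->|/eqP->].
      by exists e1 => //; exists u, u'; split=> //; left.
    by exists e2 => //; exists v, v'; split; [right|exact: joins_sym].
  + by move=> i; rewrite !inE => /orP[/eqP->|/eqP->]; exact: MJ.
  + right; exists u, v, u', v', e1, e2; split=> //.
    apply: conn_mono cc => e /rstE[/andP[eM /orP[we|/asboolP te]] nt]; last by [].
    by apply/rstE.
- move=> w J [[[i1 i2] ndis] _] trJ.
  have K1c u : K1 u -> open_connected (c w) y1 u.
    by move=> k; apply: conn_lowc_orc; rewrite lowE.
  have K2c u : K2 u -> open_connected (c w) u y2.
    by move=> k; apply: conn_sym; apply: conn_lowc_orc; rewrite lowE.
  apply: contrapT => no; apply: ndis.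
  have allo i : i \in J -> w i.
    by move=> iJ; apply/negPn/negP => ni; apply: no; exists i.
  case: trJ allo {no} => [[u [v [e [-> u1 v2 j]]]]|[u [v [u' [v' [e1 [e2 [-> [u1 v2] j1 j2 cc]]]]]]]] allo.
    apply: conn_trans (K1c _ u1) _; apply: conn_trans _ (K2c _ v2).
    by apply: (conn_step (e := e) _ j); apply: inS => //; apply: allo; rewrite inE.
  apply: conn_trans (K1c _ u1) _; apply: conn_trans _ (K2c _ v2).
  apply: (@conn_trans _ _ _ u').
    by apply: (conn_step (e := e1) _ j1); apply: inS => //; apply: allo; rewrite !inE eqxx.
  apply: (conn_trans (conn_rst cc)).
  by apply: (conn_step (e := e2) _ j2); apply: inS => //; apply: allo; rewrite !inE eqxx orbT.
Qed.

Lemma unjoined_low0 :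
  Pr PP (fun w => (infc (lowc w) y1 /\ infc (lowc w) y2) /\ ~ open_connected (orc w) y1 y2) = 0.
Proof.
apply/le_anti; rewrite Pr_ge0 andbT leNgt; apply/negP => /joined_fresh_gt[b b0 [M0 h]].
by have := fresh_limit connG lfG mB mT monoT h; rewrite joined_fresh0 leNgt b0.
Qed.

End two_vertices.
End joining.

(** * Uniqueness above a percolating level *)

Section uniqueness.
Context {R : realType} {G : multigraph}.
Hypotheses (connG : connected_graph G) (lfG : locally_finite G) (qtG : quasi_transitive G).
Local Notation V := (vertex G).
Local Notation E := (edge G).
Local Notation P_ p := (@bond_percolation R G p).

(** Here [p] is the lower level and the bound on [tau] is only assumed at the upper level [q]. The
    exceptional events are countable unions over vertices of the null events [U] and [J]. *)
Lemma no_two_infinite (p q c : R) : 0 < p -> p < q -> q < 1 -> (exists x : V, 0 < theta p x) ->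
  0 < c -> (forall x y : V, c <= tau q x y) ->
  Pr (P_ q) (fun w => exists x y : V, [/\ infc w x, infc w y & ~ open_connected w x y]) = 0.
Proof.
move=> p0 pq q1 ex c0 tc.
have p01 : 0 < p <= 1 by lra.
have p01' : 0 < p < 1 by lra.
have q01 : 0 < q < 1 by lra.
have /andP[s0 s1] := coupling_par (ltW p0) pq (ltW q1).
have [PP [lPP lo hi]] := coupling connG lfG (ltW p0) pq (ltW q1).
have [t t0 ht] := theta_lower connG lfG qtG p01 ex.
have far_low (M : seq E) : exists D, forall x : V, far D M x ->
    t / 2 <= Pr PP (fun w => infc (rst (~` [set` M]) (lowc w)) x).
  have [D hD] := far_infc_gt connG lfG qtG p01' t0 ht M; exists D => x fx.
  rewrite (lo (fun w => infc (rst (~` [set` M]) w) x)); first exact: hD.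
  exact: (mea_rst _ (X := fun w : config E => infc w x) (mea_infc connG lfG x)).
have [eps eps0 heps] := deep_link_gt0 connG lfG qtG q01 c0 tc.
have deep (M : seq E) : exists D, forall x1 x2 : V, far D M x1 -> far D M x2 ->
    eps <= Pr PP (fun w => open_connected (rst (~` [set` M]) (orc w)) x1 x2).
  have [D hD] := heps M; exists D => x1 x2 f1 f2.
  rewrite (hi (fun w => open_connected (rst (~` [set` M]) w) x1 x2)); last exact: mea_conn_rst.
  by apply: ltW; exact: hD.
have t2 : 0 < t / 2 by rewrite divr_gt0.
have cV := countable_vertices connG lfG.
have mi z := mea_infc connG lfG z; have mc x y := mea_conn connG lfG x y.
have mN : mea (fun w : config E => exists x y : V, [/\ infc w x, infc w y & ~ open_connected w x y]).
  apply: (@mea_ext _ _ (fun w : config E => exists x y : V, (infc w x /\ infc w y) /\ ~ open_connected w x y)).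
    by move=> w; split=> -[x [y]]; [move=> [[]]|move=> []]; exists x, y.
  by apply: (mea_ex cV) => x; apply: (mea_ex cV) => y; apply: mea_and;
     [apply: mea_and|apply: mea_not].
rewrite -hi//.
pose U x (w : config (E + E)%type) := infc (orc w) x /\ forall y, open_connected (orc w) x y -> ~ infc (lowc w) y.
pose J (y1 y2 : V) (w : config (E + E)%type) := (infc (lowc w) y1 /\ infc (lowc w) y2) /\ ~ open_connected (orc w) y1 y2.
have mU x : mea (U x).
  apply: mea_and; first exact: (mea_orc (mi x)).
  apply: (mea_all cV) => y; apply: mea_imp; first exact: (mea_orc (mc x y)).
  by apply: mea_not; exact: (mea_lowc (mi y)).
have mJ x y : mea (J x y).
  apply: mea_and; first by apply: mea_and; exact: (mea_lowc (mi _)).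
  by apply: mea_not; exact: (mea_orc (mc x y)).
have U0 : Pr PP (fun w => exists x, U x w) = 0.
  by apply: Pr_ex0 => // x; exact: (infinite_orc_avoiding_low0 connG lfG lPP s0 s1 t2 far_low).
have J0 : Pr PP (fun w => exists x y, J x y w) = 0.
  apply: Pr_ex0 => // [x|x]; first by apply: mea_ex.
  by apply: Pr_ex0 => // y; exact: (unjoined_low0 connG lfG lPP s0 s1 eps0 deep).
apply/le_anti; rewrite Pr_ge0 andbT.
have m1 : mea (fun w => exists x, U x w) by exact: mea_ex.
have m2 : mea (fun w => exists x y, J x y w) by apply: mea_ex => // x; exact: mea_ex.
have := Pr_or PP m1 m2; rewrite U0 J0 addr0; apply: le_trans; apply: Pr_mono.
- exact: (mea_orc mN).
- exact: mea_or.
move=> w [x [y [ix iy nxy]]].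
have low z : infc (orc w) z -> ~ (exists x, U x w) -> exists2 z', open_connected (orc w) z z' & infc (lowc w) z'.
  move=> iz nU; apply: contrapT => no; apply: nU; exists z; split=> // z' c' iz'.
  by apply: no; exists z'.
have [|nU] := pselect (exists x, U x w); [by left|right].
have [x' xx' ix'] := low x ix nU; have [y' yy' iy'] := low y iy nU.
exists x', y'; split=> // x'y'; apply: nxy.
exact: conn_trans xx' (conn_trans x'y' (conn_sym yy')).
Qed.

End uniqueness.

(** * Trifurcations and volume growth *)

Section branches.
Context {G : multigraph}.
Local Notation V := (vertex G).
Local Notation E := (edge G).
Context {w : E -> bool} {U : V -> set V}.
Implicit Types (s t u v z : V) (T : seq V).

Definition branch t z := Defs.cluster (rst (~` touch (U t)) w) z.

Definition has_branch t z := [/\ ~ U t z,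
  exists u e, [/\ U t u, joins e u z & w e] & infc (rst (~` touch (U t)) w) z].

Definition three_branches t := exists z1 z2 z3,
  [/\ has_branch t z1, has_branch t z2, has_branch t z3 &
   [/\ ~ branch t z1 z2, ~ branch t z1 z3 & ~ branch t z2 z3]].

Definition linked t := forall u v, U t u -> U t v ->
  open_connected (rst (~` touch (~` U t)) w) u v.

(** Free branches play the role of leaves in Burton and Keane's forest. *)
Definition free T t z := forall s v, s \in T -> U s v -> ~ branch t z v.

Lemma branch_disjoint t z z' v : ~ branch t z z' -> branch t z v -> branch t z' v -> False.
Proof. by move=> no c c'; apply: no; exact: conn_trans c (conn_sym c'). Qed.

Lemma branch_avoid t z v : has_branch t z -> branch t z v -> ~ U t v.
Proof. by move=> [nU _ _] c; exact: avoid_vertex c nU. Qed.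

Lemma touch_ends (K : set V) e x y : joins e x y -> touch K e -> K x \/ K y.
Proof. by move=> j [u [v [Ku j']]]; case: (joins_ends j j') => <-; [left|right]. Qed.

Section family.
Context {T : seq V}.
Hypothesis dis : forall s t v, s \in T -> t \in T -> U s v -> U t v -> s = t.
Hypothesis lnk : forall t, t \in T -> linked t.
Hypothesis thr : forall t, t \in T -> three_branches t.

Lemma linked_off s t u v : s \in T -> t \in T -> s <> t -> U s u -> U s v ->
  open_connected (rst (~` touch (U t)) w) u v.
Proof.
move=> sT tT st Uu Uv; apply: conn_mono (lnk sT Uu Uv) => e /rstE[we nt].
apply/rstE; split=> // -[a [b [Ua j]]]; apply: nt; exists a, b; split=> // Sa.
exact: st (dis sT tT Sa Ua).
Qed.

Lemma branch_off s t z u v : branch s z u -> branch s z v ->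
  (forall x, branch s z x -> ~ U t x) -> open_connected (rst (~` touch (U t)) w) u v.
Proof.
move=> zu zv avoid; have c := conn_trans (conn_sym zu) zv.
apply: (conn_ind (Q := open_connected (rst (~` touch (U t)) w) u) c); first exact: conn_refl.
move=> a b e ua ua' we j; apply: (conn_trans ua (conn_step (e := e) _ j)).
move/rstE: (we) => [we' _]; apply/rstE; split=> // te.
have za := conn_trans zu ua'.
by case: (touch_ends j te); apply: avoid => //; exact: conn_trans za (conn_step we j).
Qed.

(** [U s] is linked without touching [U t], so it lies entirely in the branch of [t] that meets it,
    and so does every branch of [s] that avoids [U t]. *)
Lemma branch_sub s t z z' v : s \in T -> t \in T -> s <> t -> has_branch s z' ->
  (forall x, branch s z' x -> ~ U t x) -> U s v -> branch t z v ->
  forall x, branch s z' x -> branch t z x.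
Proof.
move=> sT tT st [nUz' [u [e [Uu j we]]] inf] avoid Uv zv x z'x.
have zu : branch t z u := conn_trans zv (linked_off sT tT st Uv Uu).
have zz' : branch t z z'.
  apply: (conn_trans zu (conn_step (e := e) _ j)); apply/rstE; split=> // te.
  case: (touch_ends j te) => [Utu|]; first exact: st (dis sT tT Uu Utu).
  by apply: avoid; exact: conn_refl.
exact: conn_trans zz' (branch_off (conn_refl _ _) z'x avoid).
Qed.

(** If the branches met, the free branch at [s] could be followed back to [U s] without touching
    [U t], and the branch at [t] would meet [U s]. *)
Lemma free_disjoint s t z z' v : s \in T -> t \in T -> s <> t ->
  has_branch s z -> has_branch t z' -> free T s z -> free T t z' ->
  branch s z v -> branch t z' v -> False.
Proof.
move=> sT tT st bz bz' fz fz' zv z'v; have [_ [u [e [Uu j we]]] _] := bz.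
have avoid x : branch s z x -> ~ U t x by move=> zx Utx; exact: fz Utx zx.
have z'z : branch t z' z := conn_trans z'v (branch_off zv (conn_refl _ _) avoid).
apply: (fz' s u sT Uu); apply: (conn_trans z'z (conn_step (e := e) _ (joins_sym j))).
apply/rstE; split=> // te; case: (touch_ends j te) => [Utu|].
  exact: st (dis sT tT Uu Utu).
by apply: avoid; exact: conn_refl.
Qed.

Lemma count_leq (a b : pred V) l : {in l, forall x, a x -> b x} -> (count a l <= count b l)%N.
Proof.
elim: l => //= x l IH ab; apply: leq_add.
  by have := ab x (mem_head _ _); case: (a x) => // /(_ isT)->.
by apply: IH => y yl; apply: ab; rewrite inE yl orbT.
Qed.

Lemma count_ltn (a b : pred V) s l : {in l, forall x, a x -> b x} -> s \in l -> b s -> ~~ a s ->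
  (count a l < count b l)%N.
Proof.
elim: l => //= x l IH ab; rewrite inE => /orP[/eqP<-|sl] bs nas.
  rewrite bs (negbTE nas) add0n add1n ltnS; apply: count_leq => y yl.
  by apply: ab; rewrite inE yl orbT.
have lt : (count a l < count b l)%N by apply: IH => // y yl; apply: ab; rewrite inE yl orbT.
have := ab x (mem_head _ _); case: (a x) => [/(_ isT)->|_]; first by rewrite ltn_add2l.
by rewrite add0n; apply: leq_trans lt (leq_addl _ _).
Qed.

Definition hits t z := count (fun s => `[< exists v, U s v /\ branch t z v >]) T.

(** Take a branch of some [t] that is not free and meets the fewest [U s], and let it meet [U s].
    Since [U t] is linked off [U s], at most one of the three branches at [s] meets [U t]. The
    others lie in the chosen branch and miss [U s], hence are free by minimality. *)
Lemma two_free_branches : T <> [::] -> exists s z1 z2, [/\ s \in T, has_branch s z1, has_branch s z2,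
  ~ branch s z1 z2 & free T s z1 /\ free T s z2].
Proof.
move=> T0; pose bad t z := [/\ t \in T, has_branch t z & ~ free T t z].
have [[t0 [z0 b0]]|nobad] := pselect (exists t z, bad t z); last first.
  have [s sT] : exists s, s \in T by case: (T) T0 => // s l _; exists s; exact: mem_head.
  have [z1 [z2 [z3 [b1 b2 _ [n12 _ _]]]]] := thr sT.
  have fr z : has_branch s z -> free T s z.
    by move=> b; apply: contrapT => nf; apply: nobad; exists s, z.
  by exists s, z1, z2; split=> //; split; exact: fr.
have ex : exists n, `[< exists t z, bad t z /\ hits t z = n >].
  by exists (hits t0 z0); apply/asboolP; exists t0, z0.
case: (ex_minnP ex) => k /asboolP[t [z [[tT bz nf] tz]]] minimal.
have [s [v [sT Uv zv]]] : exists s v, [/\ s \in T, U s v & branch t z v].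
  apply: contrapT => no; apply: nf => s v sT Uv zv; apply: no; by exists s, v.
have st : s <> t by move=> e; apply: (branch_avoid bz zv); rewrite -e.
pose meets z' := exists2 x, branch s z' x & U t x.
have fr z' : has_branch s z' -> ~ meets z' -> free T s z'.
  move=> bz' nm; apply: contrapT => nfr.
  have avoid x : branch s z' x -> ~ U t x by move=> zx Ux; apply: nm; exists x.
  have sub := branch_sub sT tT st bz' avoid Uv zv.
  have : (k <= hits s z')%N by apply: minimal; apply/asboolP; exists s, z'.
  rewrite -tz leqNgt => /negP; apply; apply: (@count_ltn _ _ s) => //.
  - by move=> x _ /asboolP[y [Uy zy]]; apply/asboolP; exists y; split=> //; exact: sub.
  - by apply/asboolP; exists v.
  - by apply/negP => /asboolP[y [Uy zy]]; exact: branch_avoid bz' zy Uy.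
have both z1 z2 : ~ branch s z1 z2 -> meets z1 -> meets z2 -> False.
  move=> n12 [x1 c1 Ux1] [x2 c2 Ux2]; apply: (branch_disjoint n12 c1).
  exact: conn_trans c2 (linked_off tT sT (nesym st) Ux2 Ux1).
have [z1 [z2 [z3 [b1 b2 b3 [n12 n13 n23]]]]] := thr sT.
have [m1|nm1] := pselect (meets z1).
  have nm2 := both _ _ n12 m1; have nm3 := both _ _ n13 m1.
  by exists s, z2, z3; split=> //; split; exact: fr.
have [m2|nm2] := pselect (meets z2).
  have nm3 := both _ _ n23 m2.
  by exists s, z1, z3; split=> //; split; exact: fr.
by exists s, z1, z2; split=> //; split; exact: fr.
Qed.

End family.

(* Removing a centre frees at most one further branch, and a suitable centre has two free ones. *)
Lemma many_free_branches T : uniq T ->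
  (forall s t v, s \in T -> t \in T -> U s v -> U t v -> s = t) ->
  (forall t, t \in T -> linked t) -> (forall t, t \in T -> three_branches t) ->
  exists l : seq (V * V), [/\ (size T <= size l)%N, uniq l,
    forall b, b \in l -> [/\ b.1 \in T, has_branch b.1 b.2 & free T b.1 b.2] &
    forall b b' v, b \in l -> b' \in l -> branch b.1 b.2 v -> branch b'.1 b'.2 v -> b = b'].
Proof.
move: {2}(size T) (erefl (size T)) => n; elim: n T => [|n IH] T sz uT dis lnk thr.
  by exists [::]; split=> //; rewrite sz.
have T0 : T <> [::] by move=> e; rewrite e in sz.
have [s [z1 [z2 [sT b1 b2 n12 [f1 f2]]]]] := two_free_branches dis lnk thr T0.
pose T' := rem s T.
have T'T t : t \in T' -> t \in T by exact: mem_rem.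
have memT t : t \in T -> t <> s -> t \in T'.
  by move=> tT /eqP ts; rewrite /T' mem_rem_uniq// inE ts.
have sT' : s \notin T' by rewrite /T' mem_rem_uniq// inE eqxx.
have [|||||l [szl ul hl dl]] := IH T'.
- by rewrite size_rem// sz.
- exact: rem_uniq.
- by move=> a b v aT bT; apply: dis; exact: T'T.
- by move=> t /T'T; exact: lnk.
- by move=> t /T'T; exact: thr.
pose hit (b : V * V) := `[< exists v, U s v /\ branch b.1 b.2 v >].
pose l' := [seq b <- l | ~~ hit b].
have hit1 : (count hit l <= 1)%N.
  rewrite leqNgt; apply/negP => lt.
  have : (1 < size [seq b <- l | hit b])%N by rewrite size_filter.
  have uf : uniq [seq b <- l | hit b] by rewrite filter_uniq.
  case E : [seq b <- l | hit b] uf => [|b [|b' f]]//= /andP[bb' _] _.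
  have : b \in [seq b <- l | hit b] by rewrite E mem_head.
  have : b' \in [seq b <- l | hit b] by rewrite E inE mem_head orbT.
  rewrite !mem_filter => /andP[/asboolP[v' [Uv' c']] b'l] /andP[/asboolP[v [Uv c]] bl].
  have [bT bb _] := hl b bl.
  have bs : s <> b.1 by move=> e; move: sT'; rewrite e bT.
  have := dl b b' v' bl b'l (conn_trans c (linked_off dis lnk sT (T'T _ bT) bs Uv Uv')) c'.
  by move=> e; move: bb'; rewrite e inE eqxx.
have fl b : b \in l' -> [/\ b.1 \in T, b.1 <> s, has_branch b.1 b.2 & free T b.1 b.2].
  rewrite mem_filter => /andP[nh bl]; have [bT bb fb] := hl b bl; split=> //.
  - exact: T'T.
  - by move=> e; move: sT'; rewrite -e bT.
  - move=> t v tT Uv cv; have [ts|/eqP ts] := eqVneq t s.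
      by move/negP: nh; apply; apply/asboolP; exists v; rewrite -ts.
    by apply: (fb t v) => //; exact: memT.
exists [:: (s, z1), (s, z2) & l']; split.
- have : (size l <= 1 + size l')%N.
    by rewrite -(count_predC hit l) /l' size_filter leq_add2r.
  by move=> h; rewrite sz; rewrite size_rem// sz /= in szl; exact: leq_trans szl h.
- rewrite /= inE negb_or filter_uniq// andbT; apply/andP; split; last first.
    by apply/negP => /fl[_ /=].
  apply/andP; split; last by apply/negP => /fl[_ /=].
  by apply/eqP => -[e]; apply: n12; rewrite e; exact: conn_refl.
- move=> b; rewrite !inE => /or3P[/eqP->|/eqP->|/fl[]] //.
have cross b z v : b \in l' -> has_branch s z -> free T s z -> branch b.1 b.2 v -> branch s z v -> False.
  by move=> /fl[bT bs bb fb] bz fz; exact: (free_disjoint dis bT sT bs bb bz fb fz).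
move=> b b' v; rewrite !inE => /or3P[/eqP->|/eqP->|bl] /or3P[/eqP->|/eqP->|b'l] //= c c'.
- by case: (branch_disjoint n12 c c').
- by case: (cross _ _ _ b'l b1 f1 c' c).
- by case: (branch_disjoint n12 c' c).
- by case: (cross _ _ _ b'l b2 f2 c' c).
- by case: (cross _ _ _ bl b1 f1 c c').
- by case: (cross _ _ _ bl b2 f2 c c').
- by apply: dl c c'; [move: bl|move: b'l]; rewrite mem_filter => /andP[].
Qed.

End branches.

Section insertion.
Context {R : realType} {I : choiceType} {p : R} {P : probability (config I) R}.
Hypotheses (lP : blaw (fun=> p) P).

Definition opn (J : seq I) (w : config I) : config I := fun i => w i || (i \in J).

Lemma opn_le J (w : config I) i : w i -> opn J w i.
Proof. by rewrite /opn => ->. Qed.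

Lemma mea_opn J X : mea X -> mea (fun w => X (opn J w)).
Proof.
apply: mea_pre => i; apply: (@mea_ext _ _ (fun w : config I => w i \/ i \in J)).
  by move=> w; rewrite /opn; split=> /orP.
by apply: mea_or; [exact: mea_coord|exact: mea_cst].
Qed.

(** Finite energy: that [J] is already open has positive probability and is independent of
    [Y (opn J w)]; on it [opn J w] is [w]. *)
Lemma insertion_gt0 J X Y : 0 < p -> mea X -> mea Y -> (forall w, X w -> Y (opn J w)) ->
  0 < Pr P X -> 0 < Pr P Y.
Proof.
move=> p0 mX mY XY X0; pose K := undup J.
have mK := mea_cyl K (fun=> true); have mYJ := mea_opn J mY.
have : Pr P (fun w => cyl K (fun=> true) w /\ Y (opn J w)) <= Pr P Y.
  apply: Pr_mono => //; first exact: mea_and.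
  move=> w [c]; suff -> : opn J w = w by [].
  apply/funext => i; rewrite /opn; have [iJ|] := boolP (i \in J); last by rewrite orbF.
  by rewrite orbT c// mem_undup.
apply: lt_le_trans; rewrite (indep (A := [set` K]) lP mK mYJ).
- rewrite mulr_gt0//.
    by rewrite (Pr_cyl lP) ?undup_uniq// (weight_const (p := p))// exprn_gt0.
  by apply: lt_le_trans X0 _; apply: Pr_mono.
- by move=> w w' h c i iK; rewrite -h// c.
- move=> w w' h; suff -> : opn J w = opn J w' by [].
  apply/funext => i; rewrite /opn; have [iJ|iJ] := boolP (i \in J); first by rewrite !orbT.
  by rewrite !orbF h//= mem_undup; apply/negP.
Qed.

End insertion.

Section three_clusters.
Context {R : realType} {G : multigraph}.
Hypotheses (connG : connected_graph G) (lfG : locally_finite G).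
Local Notation V := (vertex G).
Local Notation E := (edge G).
Local Notation P_ p := (@bond_percolation R G p).
Context {p : R}.
Hypothesis p01 : 0 < p < 1.
Implicit Types (x y z : V) (w : config E).

Let p01' : 0 <= p <= 1. Proof. by case/andP: p01 => /ltW -> /ltW ->. Qed.
Let p0 : 0 < p. Proof. by case/andP: p01. Qed.
Let lP := lawP connG lfG p01'.

(** Leave the finite set of endpoints of [J] for the last time: beyond it no edge has been added,
    and the cluster is still infinite. *)
Lemma opn_infc (J : seq E) w a : infc (opn J w) a ->
  exists b, open_connected (opn J w) a b /\ infc w b.
Proof.
pose F := a |` \bigcup_(e in [set` J]) [set (ends e).1; (ends e).2].
have fF : finite_set F.
  rewrite finite_setU; split; first exact: finite_set1.
  by apply: bigcup_finite => [|e _]; [exact: finite_seq|exact: finite_set2].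
move=> inf; have Fa : F a by left.
have [u [v [e [_ _ _ av iv]]]] := infinite_exit lfG fF inf Fa.
exists v; split=> //; apply: infc_mono iv => f /rstE[/orP[//|fJ] nt]; exfalso; apply: nt.
exists (ends f).1, (ends f).2; split; last by left; exact: surjective_pairing.
by right; exists f => //; left.
Qed.

(** If there were almost surely two but never three infinite clusters, opening a finite box
    containing a path between them would leave only one with positive probability. *)
Lemma three_infinite :
  Pr (P_ p) (fun w => exists x y, [/\ infc w x, infc w y & ~ open_connected w x y]) = 1 ->
  exists x1 x2 x3, 0 < Pr (P_ p) (fun w => [/\ infc w x1, infc w x2 & infc w x3] /\
    [/\ ~ open_connected w x1 x2, ~ open_connected w x1 x3 & ~ open_connected w x2 x3]).
Proof.
move=> two.
pose N2 w := exists x y, (infc w x /\ infc w y) /\ ~ open_connected w x y.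
pose N3 w := exists x1 x2 x3, [/\ infc w x1, infc w x2 & infc w x3] /\
    [/\ ~ open_connected w x1 x2, ~ open_connected w x1 x3 & ~ open_connected w x2 x3].
have cV := countable_vertices connG lfG.
have mi x := mea_infc connG lfG x; have mc x y := mea_not (mea_conn connG lfG x y).
have m2 : mea N2.
  apply: (mea_ex cV) => x; apply: (mea_ex cV) => y.
  by apply: mea_and => //; exact: mea_and.
have m3' x1 x2 x3 : mea (fun w : config E => [/\ infc w x1, infc w x2 & infc w x3] /\
    [/\ ~ open_connected w x1 x2, ~ open_connected w x1 x3 & ~ open_connected w x2 x3]).
  apply: mea_and.
    apply: (@mea_ext _ _ (fun w : config E => infc w x1 /\ (infc w x2 /\ infc w x3))).
      by move=> w; split=> [[? []]|[]].
    by apply: mea_and => //; exact: mea_and.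
  apply: (@mea_ext _ _ (fun w : config E => ~ open_connected w x1 x2 /\
    (~ open_connected w x1 x3 /\ ~ open_connected w x2 x3))).
    by move=> w; split=> [[? []]|[]].
  by apply: mea_and => //; exact: mea_and.
have m3 : mea N3 by apply: (mea_ex cV) => x; apply: (mea_ex cV) => y; exact: (mea_ex cV).
have {}two : Pr (P_ p) N2 = 1.
  by rewrite -two; apply: Pr_ext => w; split=> -[x [y]]; [move=> [[]]|move=> []]; exists x, y.
suff : 0 < Pr (P_ p) N3.
  move=> /(Pr_ex_gt0 cV)[x|x1]; first by apply: (mea_ex cV) => y; exact: (mea_ex cV).
  move=> /(Pr_ex_gt0 cV)[y|x2]; first exact: (mea_ex cV).
  by move=> /(Pr_ex_gt0 cV)[z|x3] //; exists x1, x2, x3.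
rewrite lt_neqAle Pr_ge0 andbT; apply/eqP => /esym N30.
have h : 0 < Pr (P_ p) (fun w => exists x y, ((infc w x /\ infc w y) /\ ~ open_connected w x y) /\ ~ N3 w).
  have := Pr_split (P_ p) m2 m3; rewrite two.
  have : Pr (P_ p) (fun w => N2 w /\ N3 w) <= Pr (P_ p) N3.
    by apply: Pr_mono => [||w []] //; exact: mea_and.
  rewrite N30 => le0 s1; rewrite (@Pr_ext _ _ _ _ _ (fun w => N2 w /\ ~ N3 w)); first lra.
  by move=> w; split=> [[x [y [h n]]]|[[x [y h]] n]]; [split=> //; exists x, y|exists x, y].
have mX x y : mea (fun w : config E => ((infc w x /\ infc w y) /\ ~ open_connected w x y) /\ ~ N3 w).
  by apply: mea_and; [apply: mea_and => //; exact: mea_and|exact: mea_not].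
have {h} [x hx] := Pr_ex_gt0 cV (fun x => mea_ex cV (mX x)) h.
have {hx} [y hxy] := Pr_ex_gt0 cV (mX x) hx.
have [EL [mono ex]] := edge_exhaustion connG lfG.
have [n cxy] := conn_exhaust mono ex (connG x y).
suff : 0 < Pr (P_ p) (fun w => ~ N2 w) by rewrite Pr_not// two subrr ltxx.
apply: (insertion_gt0 (J := EL n) lP p0 (mX x y)) hxy; first exact: mea_not.
move=> w [[[ix iy] nxy] n3] [a [b [[ia ib] nab]]]; apply: nab.
have xy : open_connected (opn (EL n) w) x y.
  by apply: conn_mono cxy => e /rstE[_ eL]; apply/orP; right.
suff h c : infc (opn (EL n) w) c -> open_connected (opn (EL n) w) x c.
  exact: conn_trans (conn_sym (h a ia)) (h b ib).
move=> ic; have [d [cd id]] := opn_infc ic.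
have up : open_connected (opn (EL n) w) x d.
  have le u v : open_connected w u v -> open_connected (opn (EL n) w) u v.
    by apply: conn_mono => e; exact: opn_le.
  have [xd|nxd] := pselect (open_connected w x d); first exact: le.
  have [yd|nyd] := pselect (open_connected w y d); first exact: conn_trans xy (le _ _ yd).
  by case: n3; exists x, y, d.
exact: conn_trans up (conn_sym cd).
Qed.

(** The centre is a ball rather than a vertex, so that opening edges inside the ball suffices to
    create a trifurcation. *)
Definition trifurcation r w x := linked (w := w) (U := gball^~ r) x /\
  three_branches (w := w) (U := gball^~ r) x.

Lemma gball_linked r x y : gball x r y ->
  open_connected (rst (~` touch (~` gball x r)) (fun=> true)) x y.
Proof.
elim: r y => [y ->|r IH y]; first exact: conn_refl.
have sub : ~` touch (~` gball x r) `<=` ~` touch (~` gball x r.+1).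
  by apply: subsetC; apply: touchS; apply: subsetC; exact: gballS.
case=> [/IH|[u [e [bu j]]]]; first exact: conn_rstS.
apply: (conn_trans (conn_rstS sub (IH u bu)) (conn_step (e := e) _ j)).
apply/rstE; split=> // te; case: (touch_ends j te); apply; first by left.
exact: gball_joins bu j.
Qed.

Lemma aut_trifurcation f g r w x : automorphism f g ->
  trifurcation r (w \o g) x -> trifurcation r w (f x).
Proof.
move=> fg [lnk thr]; have [[f' ff' f'f] bg h] := fg; have gi := bij_inj bg.
have tE K : g @` (~` touch K) = ~` touch (f @` K).
  have [g' gg' g'g] := bg; apply/seteqP; split=> [_ [e ne <-] [_ [v [[u Ku <-] j]]]|e ne].
    by apply: ne; exists u, (f' v); split=> //; apply/h; rewrite f'f.
  exists (g' e) => // -[u [v [Ku j]]]; apply: ne; exists (f u), (f v); split; first by exists u.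
  by rewrite -(g'g e); exact: (proj1 (h _ _ _) j).
have bE : f @` (gball x r) = gball (f x) r.
  apply/seteqP; split=> [_ [y b <-]|y b]; first exact: (proj1 (aut_ball _ _ _ fg) b).
  by exists (f' y) => //; apply: (proj2 (aut_ball _ _ _ fg)); rewrite f'f.
have bCE : f @` (~` gball x r) = ~` gball (f x) r.
  apply/seteqP; split=> [_ [y b <-]|y b]; first by move=> /(proj2 (aut_ball _ _ _ fg)).
  by exists (f' y) => //= /(proj1 (aut_ball _ _ _ fg)); rewrite f'f.
have cE K (y z : V) : open_connected (rst (~` touch K) (w \o g)) y z <->
    open_connected (rst (~` touch (f @` K)) w) (f y) (f z).
  by rewrite (aut_conn_rst fg) tE.
split=> [u v bu bv|].
  rewrite -bCE -(f'f u) -(f'f v); apply/cE; apply: lnk.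
    by apply: (proj2 (aut_ball _ _ _ fg)); rewrite f'f.
  by apply: (proj2 (aut_ball _ _ _ fg)); rewrite f'f.
have hb z : has_branch (w := w \o g) (U := gball^~ r) x z -> has_branch (w := w) (U := gball^~ r) (f x) (f z).
  move=> [nb [u [e [bu j we]]] inf]; split.
  - by move=> /(proj2 (aut_ball _ _ _ fg)).
  - exists (f u), (g e); split=> //; first exact: (proj1 (aut_ball _ _ _ fg) bu).
    exact: (proj1 (h _ _ _) j).
  - move=> fin; apply: inf; apply: sub_finite_set (finite_image f' fin) => y c.
    by exists (f y); rewrite ?ff'// -bE; exact: (proj1 (cE _ _ _) c).
have nb z z' : ~ branch (w := w \o g) (U := gball^~ r) x z z' -> ~ branch (w := w) (U := gball^~ r) (f x) (f z) (f z').
  by move=> n c; apply: n; apply/cE; rewrite bE.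
have [z1 [z2 [z3 [b1 b2 b3 [n12 n13 n23]]]]] := thr.
by exists (f z1), (f z2), (f z3); split; [exact: hb|exact: hb|exact: hb|split; exact: nb].
Qed.

Lemma mea_trifurcation r x : mea (fun w : config E => trifurcation r w x).
Proof.
have cV := countable_vertices connG lfG; have cE := countable_edges connG lfG.
have mcr A u v : mea (fun w : config E => open_connected (rst A w) u v) by exact: mea_conn_rst.
apply: mea_and.
  by apply: (mea_all cV) => u; apply: (mea_all cV) => v; do 2 apply: mea_impl => ?.
have mb z : mea (fun w : config E => has_branch (w := w) (U := gball^~ r) x z).
  apply: (@mea_ext _ _ (fun w : config E => (~ gball x r z /\
    exists u e, (gball x r u /\ joins e u z) /\ w e) /\ infc (rst (~` touch (gball x r)) w) z)).
    move=> w; split=> [[[nz [u [e [[bu j] we]]]] inf]|[nz [u [e [bu j we]]] inf]].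
      by split=> //; exists u, e.
    by split=> //; split=> //; exists u, e.
  apply: mea_and.
    apply: mea_and; first exact: mea_cst.
    apply: (mea_ex cV) => u; apply: (mea_ex cE) => e.
    by apply: mea_and; [exact: mea_cst|exact: mea_coord].
  exact: (mea_rst _ (X := fun w : config E => infc w z) (mea_infc connG lfG z)).
apply: (mea_ex cV) => z1; apply: (mea_ex cV) => z2; apply: (mea_ex cV) => z3.
pose b w z := has_branch (w := w) (U := gball^~ r) x z.
pose c (w : config E) z z' := branch (w := w) (U := gball^~ r) x z z'.
apply: (@mea_ext _ _ (fun w : config E => (b w z1 /\ (b w z2 /\ b w z3)) /\
  (~ c w z1 z2 /\ (~ c w z1 z3 /\ ~ c w z2 z3)))).
  by move=> w; split=> [[[? [? ?]] [? [? ?]]]|[? ? ? [? ? ?]]].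
have mnc z z' : mea (fun w => ~ c w z z') by apply: mea_not; exact: mcr.
exact: (mea_and (mea_and (mb z1) (mea_and (mb z2) (mb z3)))
  (mea_and (mnc z1 z2) (mea_and (mnc z1 z3) (mnc z2 z3)))).
Qed.

Lemma trifurcation_gt0 :
  Pr (P_ p) (fun w => exists x y, [/\ infc w x, infc w y & ~ open_connected w x y]) = 1 ->
  exists o r, 0 < Pr (P_ p) (fun w => trifurcation r w o).
Proof.
move=> /three_infinite[x1 [x2 [x3]]]; set X := (fun w => _) => X0.
have [r2 b2] := gball_ex connG x1 x2; have [r3 b3] := gball_ex connG x1 x3.
pose r := maxn r2 r3; exists x1, r.
have {}b2 : gball x1 r x2 by apply: gball_mono b2; exact: leq_maxl.
have {}b3 : gball x1 r x3 by apply: gball_mono b3; exact: leq_maxr.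
have b1 : gball x1 r x1 by exact: gball0.
have mi x := mea_infc connG lfG x; have mc x y := mea_not (mea_conn connG lfG x y).
have mX : mea X.
  apply: (@mea_ext _ _ (fun w : config E => (infc w x1 /\ (infc w x2 /\ infc w x3)) /\
    (~ open_connected w x1 x2 /\ (~ open_connected w x1 x3 /\ ~ open_connected w x2 x3)))).
    by move=> w; split=> [[[? [? ?]] [? [? ?]]]|[[? ? ?] [? ? ?]]].
  exact: (mea_and (mea_and (mi _) (mea_and (mi _) (mi _))) (mea_and (mc _ _) (mea_and (mc _ _) (mc _ _)))).
pose A := ~` touch (~` gball x1 r).
(* The edges inside the ball: opening them links the ball and leaves the configuration off the ball
   unchanged, so the branches of the three clusters stay distinct. *)
have /finite_seqP[J JE] : finite_set (A `&` touch (gball x1 r)).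
  by apply: sub_finite_set (finite_touch lfG (finite_ball lfG x1 r)) => e [].
have JA e : e \in J -> A e by move=> eJ; have [] : (A `&` touch (gball x1 r)) e by rewrite JE.
apply: (insertion_gt0 (J := J) lP p0 mX (mea_trifurcation r x1) _ X0).
move=> w [[i1 i2 i3] [n12 n13 n23]]; split.
  have lk y : gball x1 r y -> open_connected (rst A (opn J w)) x1 y.
    move=> by_; have [->|ne] := pselect (y = x1); first exact: conn_refl.
    have := gball_linked by_; rewrite -/A => c.
    apply: (conn_ind (Q := open_connected (rst A (opn J w)) x1) c); first exact: conn_refl.
    move=> u v e xu _ /rstE[_ Ae] j; apply: (conn_trans xu (conn_step (e := e) _ j)).
    apply/rstE; split=> //; apply/orP; right.
    suff : [set` J] e by []. rewrite -JE; split=> //; exists u, v; split=> //.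
    by apply: contrapT => nu; apply: Ae; exists u, v.
  by move=> u v bu bv; exact: conn_trans (conn_sym (lk u bu)) (lk v bv).
have offE : rst (~` touch (gball x1 r)) (opn J w) = rst (~` touch (gball x1 r)) w.
  apply/funext => e; apply/idP/idP => /rstE[we nt]; apply/rstE; split=> //; last exact: opn_le.
  case/orP: we => // eJ; exfalso; apply: nt.
  by have [] : (A `&` touch (gball x1 r)) e by rewrite JE.
have ext x : gball x1 r x -> infc w x -> exists z, open_connected w x z /\
    has_branch (w := opn J w) (U := gball^~ r) x1 z.
  move=> bx ix; have [u [v [e [bu nv [we j] xv iv]]]] := infinite_exit lfG (finite_ball lfG x1 r) ix bx.
  exists v; split=> //; split=> //; last by rewrite offE.
  by exists u, e; split=> //; exact: opn_le.
have [z1 [c1 h1]] := ext x1 b1 i1; have [z2 [c2 h2]] := ext x2 b2 i2; have [z3 [c3 h3]] := ext x3 b3 i3.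
have nb x y z z' : open_connected w x z -> open_connected w y z' -> ~ open_connected w x y ->
    ~ branch (w := opn J w) (U := gball^~ r) x1 z z'.
  move=> xz yz' nxy; rewrite /branch offE => zz'; apply: nxy.
  exact: conn_trans xz (conn_trans (conn_rst zz') (conn_sym yz')).
exists z1, z2, z3; split=> //; split.
- exact: nb c1 c2 n12.
- exact: nb c1 c3 n13.
- exact: nb c2 c3 n23.
Qed.

End three_clusters.

(** * Exponential growth of balls *)

Section growth.
Context {R : realType} {G : multigraph}.
Hypotheses (connG : connected_graph G) (lfG : locally_finite G) (qtG : quasi_transitive G).
Local Notation V := (vertex G).
Local Notation E := (edge G).
Local Notation P_ p := (@bond_percolation R G p).
Implicit Types (x y z o : V) (T s l : seq V).

Definition ball_seq x n : seq V :=
  xget [::] [set s | uniq s /\ forall y, y \in s <-> gball x n y].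

Lemma ball_seqP x n : uniq (ball_seq x n) /\ forall y, y \in ball_seq x n <-> gball x n y.
Proof.
rewrite /ball_seq; case: xgetP => [s _ []//|no]; exfalso.
have /finite_seqP[s sE] := finite_ball lfG x n.
apply: (no (undup s)); split; first exact: undup_uniq.
by move=> y; rewrite mem_undup sE.
Qed.

Lemma mem_ball_seq x n y : y \in ball_seq x n <-> gball x n y.
Proof. by case: (ball_seqP x n). Qed.

Lemma ball_seq_uniq x n : uniq (ball_seq x n).
Proof. by case: (ball_seqP x n). Qed.

Definition volume x n := size (ball_seq x n).

Lemma aut_volume f g x n : automorphism f g -> (volume (f x) n <= volume x n)%N.
Proof.
move=> fg; have [[f' ff' f'f] _ _] := fg.
rewrite /volume -[X in (_ <= X)%N](size_map f); apply: uniq_leq_size; first exact: ball_seq_uniq.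
move=> y /mem_ball_seq b; apply/mapP; exists (f' y); last by rewrite f'f.
by apply/mem_ball_seq; apply: (proj2 (aut_ball _ _ _ fg)); rewrite f'f.
Qed.

Lemma volume_bound n : exists D, forall x, (volume x n <= D)%N.
Proof.
apply: (qt_uniform qtG (U := fun x D => (volume x n <= D)%N)).
- by move=> f g x D fg; apply: leq_trans; exact: aut_volume fg.
- by move=> x D D' le /leq_trans; apply.
- by move=> x; exists (volume x n).
Qed.

Lemma volume_mono x n m : (n <= m)%N -> (volume x n <= volume x m)%N.
Proof.
move=> nm; apply: uniq_leq_size; first exact: ball_seq_uniq.
by move=> y /mem_ball_seq b; apply/mem_ball_seq; exact: gball_mono b.
Qed.

(* Each trifurcation ball inside the ball of radius [n] owns a branch crossing the sphere. *)
Lemma trifurcations_boundary (w : config E) r o n T : uniq T ->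
  (forall t, t \in T -> trifurcation r w t) ->
  (forall x y v, x \in T -> y \in T -> gball x r v -> gball y r v -> x = y) ->
  (forall t, t \in T -> gball t r `<=` gball o n) ->
  (volume o n + size T <= volume o n.+1)%N.
Proof.
move=> uT tri dis sub.
have [l [szl ul hl dl]] := many_free_branches uT dis (fun t tT => proj1 (tri t tT))
  (fun t tT => proj2 (tri t tT)).
have /choice[v hv] : forall b : V * V, exists v, b \in l ->
    [/\ branch (w := w) (U := gball^~ r) b.1 b.2 v, gball o n.+1 v & ~ gball o n v].
  move=> b; have [bl|nbl] := boolP (b \in l); last by exists o.
  have [bT [nz [u [e [bu j we]]] inf] _] := hl b bl.
  have z1 : gball o n.+1 b.2 by exact: gball_joins (sub _ bT _ bu) j.
  have [zn|nzn] := pselect (gball o n b.2); last by exists b.2; split=> //; exact: conn_refl.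
  have [y [zy ny]] : exists y, open_connected (rst (~` touch (gball b.1 r)) w) b.2 y /\ ~ gball o n y.
    apply: contrapT => no; apply: inf; apply: sub_finite_set (finite_ball lfG o n) => y c.
    by apply: contrapT => ny; apply: no; exists y.
  have [u' [v' [e' [bu' nv' [we' j'] c]]]] := first_exit zy zn ny.
  exists v'; split=> //; first exact: conn_trans (conn_rst c) (conn_step we' j').
  exact: gball_joins bu' j'.
apply: leq_trans (_ : size (ball_seq o n ++ map v l) <= _)%N.
  by rewrite size_cat size_map leq_add2l.
apply: uniq_leq_size.
  rewrite cat_uniq ball_seq_uniq map_inj_in_uniq ?ul ?andbT /=.
    apply/hasPn => _ /mapP[b bl ->]; apply/negP => /mem_ball_seq.
    by have [_ _] := hv b bl.
  move=> b b' bl b'l e; have [c _ _] := hv b bl; have [c' _ _] := hv b' b'l.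
  by apply: dl bl b'l c _; rewrite e.
move=> y; rewrite mem_cat => /orP[/mem_ball_seq b|/mapP[b bl ->]]; apply/mem_ball_seq.
  exact: gballS.
by have [] := hv b bl.
Qed.

(** Greedy selection: a point is kept unless it is close to one already kept. *)
Lemma separated_net (Q : V -> V -> Prop) l : (forall x, Q x x) -> (forall x y, Q x y -> Q y x) ->
  exists s, [/\ uniq s, {subset s <= l}, forall x y, x \in s -> y \in s -> Q x y -> x = y &
    forall x, x \in l -> exists2 y, y \in s & Q x y].
Proof.
move=> Qr Qs; elim: l => [|x l [s [us sl sep net]]]; first by exists [::].
have [[y ys Qxy]|no] := pselect (exists2 y, y \in s & Q x y).
  exists s; split=> //; first by move=> z /sl zl; rewrite inE zl orbT.
  by move=> z; rewrite inE => /orP[/eqP->|/net//]; exists y.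
exists (x :: s); split.
- by rewrite /= us andbT; apply/negP => xs; apply: no; exists x.
- by move=> z; rewrite !inE => /orP[->//|/sl->]; rewrite orbT.
- move=> y z; rewrite !inE => /orP[/eqP->|ys] /orP[/eqP->|zs] // q.
  + by case: no; exists z.
  + by case: no; exists y => //; exact: Qs.
  + exact: sep.
- move=> z; rewrite inE => /orP[/eqP->|/net[y ys q]]; first by exists x; rewrite ?mem_head.
  by exists y => //; rewrite inE ys orbT.
Qed.

Section trifurcations.
Context {p : R} {o : V} {r : nat}.
Hypotheses (p01 : 0 <= p <= 1) (tri : 0 < Pr (P_ p) (fun w => trifurcation r w o)).

Lemma aut_trifurcation_ge f g : automorphism f g ->
  Pr (P_ p) (fun w => trifurcation r w o) <= Pr (P_ p) (fun w => trifurcation r w (f o)).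
Proof.
move=> fg; have mt x := mea_trifurcation connG lfG r x; have [_ bg _] := fg.
rewrite -(law_reindex (lawP connG lfG p01) (bij_inj bg) (mt o)); apply: Pr_mono => //.
  exact: (mea_pre (F := fun w : config E => (w \o g : config E)) (fun e => mea_coord (g e)) (mt o)).
by move=> w; exact: aut_trifurcation.
Qed.

(** A net of images of [o] contains a fixed proportion of the volume, and each net point is a
    trifurcation with probability at least [t]. [trifurcations_boundary] bounds their number by the
    gain in volume for every configuration; taking means, this gain is at least [t * size s]. *)
Lemma volume_grows : exists2 a : R, 0 < a & exists k, forall n,
  (1 + a) * (volume o n)%:R <= (volume o (n + k))%:R.
Proof.
have [r0 dense] := orbit_dense connG qtG o.
(* Every vertex is within [r0] of an image of [o], itself within [r + r] of the net; separation at
   [r + r] makes the trifurcation balls disjoint. *)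
have [D hD] := volume_bound (r0 + (r + r)).
have t0 := tri; move: t0; set t := Pr _ _ => t0; exists (t / D.+1%:R); first by rewrite divr_gt0.
exists (r0 + r).+1 => n; pose N := (n + (r0 + r))%N; rewrite addnS -/N.
pose orb x := exists f g, automorphism f g /\ f o = x.
pose l := [seq x <- ball_seq o (n + r0) | `[< orb x >]].
have [s [us sl sep net]] := separated_net (Q := fun x y => gball x (r + r) y) l
  (fun x => gball0 x _) (fun x y => @gball_sym _ x y _).
have sP x : x \in s -> orb x /\ gball o (n + r0) x.
  by move=> /sl; rewrite mem_filter => /andP[/asboolP ? /mem_ball_seq].
have cover : (volume o n <= size s * D)%N.
  apply: (@leq_trans (size (flatten [seq ball_seq z (r0 + (r + r)) | z <- s]))).
    apply: uniq_leq_size; first exact: ball_seq_uniq.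
    move=> y /mem_ball_seq b; have [f [g [fg yfo]]] := dense y.
    have [|z zs bz] := net (f o).
      rewrite mem_filter; apply/andP; split; first by apply/asboolP; exists f, g.
      by apply/mem_ball_seq; exact: gball_trans b yfo.
    apply/flattenP; exists (ball_seq z (r0 + (r + r))); first by apply/mapP; exists z.
    by apply/mem_ball_seq; apply: gball_sym; exact: gball_trans yfo bz.
  rewrite size_flatten /shape -map_comp sumnE big_map.
  by rewrite -sum1_size big_distrl /=; apply: leq_sum => z _; rewrite mul1n; exact: hD.
have few w : (count (fun x => `[< trifurcation r w x >]) s <= volume o N.+1 - volume o N)%N.
  rewrite -size_filter leq_subRL; last by apply: volume_mono.
  apply: (trifurcations_boundary (w := w) (r := r)); first exact: filter_uniq.
  - by move=> x; rewrite mem_filter => /andP[/asboolP].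
  - move=> x y v; rewrite !mem_filter => /andP[_ xs] /andP[_ ys] xv yv.
    by apply: sep => //; exact: gball_trans xv (gball_sym yv).
  - move=> x; rewrite mem_filter => /andP[_ /sP[_ b]] y xy.
    by have := gball_trans b xy; rewrite -addnA.
have sum_le := Pr_count (P_ p) (fun x => mea_trifurcation connG lfG r x) few.
have : t * (size s)%:R <= \sum_(x <- s) Pr (P_ p) (fun w => trifurcation r w x).
  rewrite -sum1_size natr_sum mulr_sumr !big_seq; apply: ler_sum => x /sP[[f [g [fg <-]]] _].
  by rewrite mulr1; exact: aut_trifurcation_ge fg.
move=> le1; have le2 := le_trans le1 sum_le.
have vN : (volume o N <= volume o N.+1)%N by exact: volume_mono.
rewrite natrB// in le2.
have vn : (volume o n)%:R <= (volume o N)%:R :> R by rewrite ler_nat; apply: volume_mono; exact: leq_addr.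
have cover' : (volume o n)%:R <= (size s)%:R * D.+1%:R :> R.
  by rewrite -natrM ler_nat; apply: leq_trans cover _; rewrite leq_mul2l leqnSn orbT.
have : t / D.+1%:R * (volume o n)%:R <= t * (size s)%:R.
  rewrite mulrAC ler_pdivrMr// -mulrA ler_wpM2l//; exact: ltW.
by rewrite mulrDl mul1r => h; apply: le_trans (lerD vn (le_trans h le2)) _; rewrite subrKC.
Qed.

Lemma volume_exp : exists2 a : R, 0 < a & exists k, forall j, (1 + a) ^+ j <= (volume o (j * k))%:R.
Proof.
have [a a0 [k h]] := volume_grows; exists a => //; exists k; elim=> [|j IH].
  rewrite expr0 ler1n; have : o \in ball_seq o (0 * k) by apply/mem_ball_seq; exact: gball0.
  by rewrite /volume; case: (ball_seq _ _).
rewrite exprS mulSn addnC; apply: le_trans (h _); rewrite ler_wpM2l//; lra.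
Qed.

End trifurcations.
End growth.

(** * The two-point function at a slightly lower level *)

Section continuity.
Context {R : realType} {G : multigraph}.
Hypotheses (connG : connected_graph G) (lfG : locally_finite G) (qtG : quasi_transitive G).
Local Notation V := (vertex G).
Local Notation E := (edge G).
Local Notation P_ p := (@bond_percolation R G p).
Implicit Types (x y z : V) (p q c : R) (L : seq E).

Lemma Pr_some_open (I : choiceType) (r : I -> R) (P : probability (config I) R) (s : R) (L : seq I) :
  blaw r P -> (forall i, i \in L -> r i <= s) ->
  Pr P (fun w => exists2 i, i \in L & w i) <= (size L)%:R * s.
Proof.
move=> lP; elim: L => [_|i L IH rs]; first by rewrite mul0r Pr_false// => w [].
have mi (l : seq I) : mea (fun w : config I => exists2 i, i \in l & w i).
  by apply: mea_ex_seq => j _; exact: mea_coord.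
have h1 : Pr P (fun w : config I => w i) <= s by rewrite (Pr_coord lP) rs ?mem_head.
have h2 : Pr P (fun w => exists2 i, i \in L & w i) <= (size L)%:R * s.
  by apply: IH => j jL; apply: rs; rewrite inE jL orbT.
rewrite [size _]/= -addn1 natrD mulrDl mul1r addrC.
apply: le_trans (lerD h1 h2); apply: le_trans (Pr_or P (mea_coord i) (mi L)).
apply: Pr_mono; [exact: mi|by apply: mea_or; [exact: mea_coord|exact: mi]|].
move=> w [j + wj]; rewrite inE => /orP[/eqP e|jL]; [left; rewrite -e|right] => //.
by exists j.
Qed.

(** In the coupling the two levels agree on [L] unless some edge of [L] is sprinkled: a union
    bound. *)
Lemma tau_in_diff p q A L x y : 0 <= p -> p < q -> q <= 1 -> A `<=` [set` L] ->
  tau_in q A x y <= tau_in p A x y + (size L)%:R * ((q - p) / (1 - p)).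
Proof.
move=> p0 pq q1 AL; have [PP [lPP lo hi]] := coupling connG lfG p0 pq q1.
have mc := mea_conn_rst connG lfG A x y.
rewrite /tau_in -(lo _ mc) -(hi _ mc).
pose O (w : config (E + E)%type) := exists2 i, i \in map inr L & w i.
have mO : mea O by apply: mea_ex_seq => j _; exact: mea_coord.
have h : Pr PP O <= (size L)%:R * ((q - p) / (1 - p)).
  by rewrite -(size_map (@inr E E)); apply: (Pr_some_open lPP) => _ /mapP[e eL ->] /=.
apply: le_trans (lerD (lexx _) h); apply: le_trans (Pr_or PP (mea_lowc mc) mO).
apply: Pr_mono; [exact: (mea_orc mc)|exact: (mea_or (mea_lowc mc) mO)|].
move=> w c; have [Ow|no] := pselect (O w); [by right|left].
apply: conn_mono c => e /rstE[/orP[we|we] Ae]; apply/rstE; split=> //.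
exfalso; apply: no; exists (inr e) => //; apply/mapP; exists e => //; exact: AL.
Qed.

Lemma touch_seq_bound m : exists D, forall x, exists2 L : seq E, touch (gball x m) `<=` [set` L] & (size L <= D)%N.
Proof.
apply: (qt_uniform qtG (U := fun x D => exists2 L : seq E, touch (gball x m) `<=` [set` L] & (size L <= D)%N)).
- move=> f g x D fg [L sub sz]; exists (map g L); last by rewrite size_map.
  have [_ [g' gg' g'g] _] := fg.
  move=> e te; apply/mapP; exists (g' e); last by rewrite g'g.
  by apply: sub; apply: (proj2 (aut_touch _ _ _ fg)); rewrite g'g.
- by move=> x D D' le [L sub sz]; exists L => //; exact: leq_trans sz le.
move=> x; have /finite_seqP[L LE] := finite_touch lfG (finite_ball lfG x m).
by exists (size L), L => //; rewrite LE.
Qed.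

Lemma tau_nearby p c k (o : V) : 0 < p < 1 -> 0 < c -> (forall x y, c <= tau p x y) ->
  exists2 q, 0 < q < p & forall x y, gball x k y -> c / 4 <= tau q x y.
Proof.
move=> /andP[p0 p1] c0 tc; have p01 : 0 <= p <= 1 by lra.
have c1 : c <= 1 by apply: le_trans (tc o o) _; exact: tau_le1.
have [m hm] := tau_near connG lfG qtG (n := k) p01 c0 (fun x y _ => tc x y).
have [D hD] := touch_seq_bound m.
have D0 : 0 < D.+1%:R :> R by [].
(* The sprinkling of at most [D] edges costs at most [c / 8], which leaves [3 * c / 8] of the
   [c / 2] kept by [tau_near]. The factor [p] keeps [p - d] positive and [1 - p] absorbs the
   denominator. *)
pose d := p * (1 - p) * (c / (8 * D.+1%:R)).
have cD : 0 < c / (8 * D.+1%:R) by rewrite divr_gt0// mulr_gt0.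
have p1' : 0 < 1 - p by lra.
have d0 : 0 < d by rewrite /d !mulr_gt0.
have cD1 : c / (8 * D.+1%:R) <= 1 / 8.
  rewrite ler_pdivrMr ?mulr_gt0// mulrA div1r mulVf// mul1r.
  by apply: le_trans c1 _; rewrite ler1n.
have dp : d <= p * (1 / 8).
  rewrite /d -mulrA ler_wpM2l ?(ltW p0)//; apply: (le_trans _ cD1).
  by rewrite ler_piMl ?(ltW cD)//; lra.
exists (p - d) => [|x y b]; first by apply/andP; split; lra.
have [L sub sz] := hD x.
have q0 : 0 <= p - d by lra. have qp : p - d < p by lra.
have := tau_in_diff x y q0 qp (ltW p1) sub; have := hm x y b.
have -> : p - (p - d) = d by ring.
have le1 : tau_in (p - d) (touch (gball x m)) x y <= tau (p - d) x y.
  apply: Pr_mono; [exact: mea_conn_rst|exact: mea_conn|by move=> w; exact: conn_rst].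
have dd : d / (1 - (p - d)) <= c / (8 * D.+1%:R).
  rewrite ler_pdivrMr; last lra.
  rewrite {1}/d mulrC ler_wpM2l ?(ltW cD)//; have : p * (1 - p) <= 1 * (1 - p) by rewrite ler_wpM2r ?(ltW p1')//; lra.
  by lra.
have le2 : (size L)%:R * (d / (1 - (p - d))) <= c / 8.
  apply: (@le_trans _ _ (D.+1%:R * (c / (8 * D.+1%:R)))).
    apply: ler_pM => //; first by rewrite divr_ge0 ?(ltW d0)//; lra.
    by rewrite ler_nat; apply: leq_trans sz _.
  move: (D.+1%:R : R) D0 => X X0.
  by rewrite le_eqVlt; apply/orP; left; apply/eqP; field; rewrite gt_eqF.
lra.
Qed.

Lemma gball_split x y n m : gball x (n + m) y -> exists2 z, gball x n z & gball z m y.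
Proof.
elim: m y => [y|m IH y]; first by rewrite addn0 => b; exists y => //; exact: gball0.
rewrite addnS => -[/IH[z xz zy]|[u [e [/IH[z xz zu] j]]]]; exists z => //; first exact: gballS.
exact: gball_joins zu j.
Qed.

Lemma tau_chain q t k n x y : 0 <= q <= 1 -> 0 <= t -> (forall x y, gball x k y -> t <= tau q x y) ->
  gball x (n * k) y -> t ^+ n <= tau q x y.
Proof.
move=> q01 t0 h; elim: n x => [|n IH] x.
  by rewrite mul0n expr0 => ->; rewrite /tau Pr_true// => w; exact: conn_refl.
rewrite mulSn exprS => /gball_split[z xz zy].
apply: le_trans (tau_trans connG lfG x z y q01); apply: ler_pM => //.
- exact: exprn_ge0.
- exact: h.
- exact: IH.
Qed.

End continuity.

(** * Susceptibility below the threshold *)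

Section exits.
Context {R : realType} {G : multigraph}.
Hypotheses (connG : connected_graph G) (lfG : locally_finite G).
Local Notation V := (vertex G).
Local Notation E := (edge G).
Local Notation P_ p := (@bond_percolation R G p).
Implicit Types (x y z o : V) (e : E) (p q h c : R) (S F : seq V).

Lemma Pr_sum_disj {d} {T : measurableType d} (P : probability T R) (A : eqType) (s : seq A)
    (X : A -> T -> Prop) : uniq s -> (forall a, mea (X a)) ->
  (forall a b w, a \in s -> b \in s -> X a w -> X b w -> a = b) ->
  \sum_(a <- s) Pr P (X a) = Pr P (fun w => exists2 a, a \in s & X a w).
Proof.
move=> + mX; elim: s => [_ _|a s IH /= /andP[nas us] dis].
  by rewrite big_nil Pr_false// => w [].
have ms (l : seq A) : mea (fun w => exists2 a, a \in l & X a w) by exact: mea_ex_seq.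
rewrite big_cons IH//; last first.
  by move=> b b' w bs b's; apply: dis; rewrite inE ?bs ?b's orbT.
rewrite -Pr_disj//; last first.
  move=> w Xa [b bs Xb]; move/negP: nas; apply.
  by rewrite (dis a b w) ?mem_head// inE bs orbT.
apply: Pr_ext => w; split=> [[Xa|[b bs Xb]]|[b]].
- by exists a; rewrite ?mem_head.
- by exists b; rewrite // inE bs orbT.
- by rewrite inE => /orP[/eqP->|bs Xb]; [left|right; exists b].
Qed.

Definition edge_seq S : seq E := xget [::] [set L | uniq L /\ forall e, e \in L <-> touch [set` S] e].

Lemma edge_seqP S : uniq (edge_seq S) /\ forall e, e \in edge_seq S <-> touch [set` S] e.
Proof.
rewrite /edge_seq; case: xgetP => [L _ []//|no]; exfalso.
have /finite_seqP[L LE] := finite_touch lfG (finite_seq S).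
apply: (no (undup L)); split; first exact: undup_uniq.
by move=> e; rewrite mem_undup LE.
Qed.

Definition inside S : set E := ~` touch (~` [set` S]).

Lemma insideP S e x y : joins e x y -> inside S e <-> x \in S /\ y \in S.
Proof.
move=> j; split=> [ins|[xS yS] te].
  by split; apply: contrapT => n; apply: ins; [exists x, y|exists y, x; split=> //; exact: joins_sym].
by case: (touch_ends j te).
Qed.

Definition exits x S e (w : config E) := exists a b, [/\ a \in S, b \notin S & joins e a b] /\
  open_connected (rst (inside S) w) x a.

(** Duminil-Copin and Tassion's functional without its factor [p], which reappears in [tau_exit_le].
    Edges inside [S] contribute zero, since [exits] asks for an endpoint off [S]. *)
Definition phi p x S := \sum_(e <- edge_seq S) Pr (P_ p) (exits x S e).

Lemma mea_exits x S e : mea (exits x S e).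
Proof.
have cV := countable_vertices connG lfG.
apply: (mea_ex cV) => a; apply: (mea_ex cV) => b.
by apply: mea_and; [exact: mea_cst|exact: mea_conn_rst].
Qed.

Lemma up_exits x S e : up (exits x S e).
Proof.
move=> w w' h [a [b [st c]]]; exists a, b; split=> //.
by apply: conn_mono c => f; exact: rst_mono.
Qed.

Lemma dep_exits x S e : dep (inside S) (exits x S e).
Proof.
move=> w w' h [a [b [st c]]]; exists a, b; split=> //.
by apply: conn_mono c => f /rstE[wf If]; apply/rstE; rewrite -h.
Qed.

Lemma phi_mono p q x S : 0 <= p -> p <= q -> q <= 1 -> phi p x S <= phi q x S.
Proof.
move=> p0 pq q1; apply: ler_sum => e _; apply: Pr_param_mono => //; first exact: mea_exits.
exact: up_exits.
Qed.

Lemma bernoulli_le h n : 0 <= h <= 1 -> 1 - n%:R * h <= (1 - h) ^+ n.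
Proof.
move=> /andP[h0 h1]; elim: n => [|n IH]; first by rewrite mul0r subr0 expr0.
have n0 : 0 <= n%:R :> R by [].
have nh : 0 <= n%:R * h * h by rewrite !mulr_ge0.
apply: (@le_trans _ _ ((1 - n%:R * h) * (1 - h))); first by rewrite -addn1 natrD; nra.
by rewrite exprSr ler_wpM2r// subr_ge0.
Qed.

Lemma prod_cond_ge (A : Type) (s : seq A) (Q : pred A) c : 0 <= c <= 1 ->
  c ^+ size s <= \prod_(a <- s | Q a) c.
Proof.
move=> /andP[c0 c1]; elim: s => [|a s IH]; first by rewrite big_nil expr0.
rewrite big_cons /= exprS; case: (Q a); first by rewrite ler_wpM2l.
apply: le_trans IH; rewrite ler_piMl// exprn_ge0//.
Qed.

Section sprinkling.
Context {p h : R} {o : V} {n : nat} {PP : probability (config (E + E)%type) R}.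
Hypotheses (p01 : 0 <= p <= 1) (lPP : blaw (pair_par p h) PP) (h01 : 0 <= h <= 1).
Local Notation Z := (ball_seq o n).
Hypothesis hm : (size (edge_seq Z))%:R * h <= 1 / 2.
Hypothesis phi1 : forall S, o \in S -> 1 <= phi p o S.

Let esc v (w : config E) := exists y, ~ gball o n y /\ open_connected w v y.

(** What is left of the ball after exploring the lower clusters from outside. *)
Let trapped (w : config (E + E)%type) := [seq v <- Z | `[< ~ esc v (lowc w) >]].

Let crossed F (w : config (E + E)%type) := exists2 e, e \in edge_seq F & exits o F e (lowc w) /\ w (inr e).

Let mem_trapped v w : v \in trapped w <-> gball o n v /\ ~ esc v (lowc w).
Proof.
rewrite mem_filter; split=> [/andP[/asboolP ? /(mem_ball_seq lfG)]//|[b ne]].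
by apply/andP; split; [exact/asboolP|exact/(mem_ball_seq lfG)].
Qed.

Let mem_esc v : mea (esc v).
Proof.
apply: (mea_ex (countable_vertices connG lfG)) => y.
by apply: mea_and; [exact: mea_cst|exact: mea_conn].
Qed.

Let seen F : set (E + E) := [set i | if i is inl e then ~ inside F e else False].

(** Escaping clusters stay off [F], so the edges of their paths are seen. Conversely, a path of [w']
    from [F] out of the ball crosses an edge leaving [F], which is seen and open in both
    configurations, and its start in [F] would escape in [w]. *)
Let dep_trapped F : dep (seen F) (fun w => trapped w = F).
Proof.
move=> w w' agree wF; rewrite -wF; apply: eq_in_filter => v /(mem_ball_seq lfG) vZ.
congr asbool; apply/propext.
have agr e x y : joins e x y -> x \notin F \/ y \notin F -> lowc w e = lowc w' e.
  move=> j nF; apply: agree => /= ins; have [xF yF] := proj1 (insideP F j) ins.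
  by case: nF => /negP.
have nF x : x \notin F <-> ~ gball o n x \/ esc x (lowc w).
  rewrite -wF; split=> [/negP nx|[nb|ex]]; last 2 first.
  - by apply/negP => /mem_trapped[].
  - by apply/negP => /mem_trapped[_].
  by have [b|] := pselect (gball o n x); [right|left] => //; apply: contrapT => ne; apply: nx; exact/mem_trapped.
suff H : esc v (lowc w) <-> esc v (lowc w') by split=> ne /H.
split=> -[y [ny c]].
  exists y; split=> //.
  apply: (conn_ind (Q := open_connected (lowc w') v) c); first exact: conn_refl.
  move=> u z e vu' vu we j; apply: (conn_trans vu' (conn_step (e := e) _ j)).
  rewrite -(agr _ _ _ j)//; left; apply/nF; right; exists y; split=> //.
  exact: conn_trans (conn_sym vu) c.
apply: contrapT => ne.
have vF : [set` F] v by rewrite /= -wF; apply/mem_trapped.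
have yF : ~ [set` F] y by rewrite /= -wF => /mem_trapped[].
have [u [b [e [/= uF /negP bF [we j] _]]]] := first_exit c vF yF.
have : ~ esc u (lowc w) by move: uF; rewrite -wF => /mem_trapped[].
have we' : lowc w e by rewrite (agr _ _ _ j)//; right.
apply; case: (proj1 (nF b) bF) => [nb|[z [nz bz]]].
  by exists b; split=> //; exact: conn_step we' j.
by exists z; split=> //; exact: conn_trans (conn_step we' j) bz.
Qed.

Let dep_crossed F : dep (~` (seen F `|` set0)) (crossed F).
Proof.
move=> w w' agree [e eL [ex we]]; exists e => //; split; last by rewrite -agree//= => -[].
by apply: dep_exits ex => f ins; apply: agree => -[].
Qed.

Let mea_crossed F : mea (crossed F).
Proof.
apply: mea_ex_seq => e _; apply: mea_and; last exact: mea_coord.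
exact: (mea_lowc (mea_exits o F e)).
Qed.

Let mea_trapped F : mea (fun w => trapped w = F).
Proof.
apply: mea_filter_eq => v; apply: mea_not; exact: (mea_lowc (mem_esc v)).
Qed.

Let h0 : 0 <= h. Proof. by case/andP: h01. Qed.

(* The events that a given exit is the only sprinkled edge of [F] are disjoint, so that their
   probabilities add up to a multiple of [phi]. *)
Let crossed_ge F : o \in F -> (size (edge_seq F) <= size (edge_seq Z))%N -> h / 2 <= Pr PP (crossed F).
Proof.
move=> oF le; set L := edge_seq F; have [uL _] := edge_seqP F.
pose X e (w : config (E + E)%type) := exits o F e (lowc w) /\ cyl (map inr L) (fun i => i == inr e) w.
have mX e : mea (X e) by apply: mea_and (mea_lowc (mea_exits o F e)) (mea_cyl _ _).
have : Pr PP (fun w => exists2 e, e \in L & X e w) <= Pr PP (crossed F).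
  apply: Pr_mono => //; first by apply: mea_ex_seq => e _; exact: mX.
  move=> w [e eL [ex c]]; exists e => //; split=> //.
  by rewrite c ?eqxx//; apply/mapP; exists e.
apply: le_trans; rewrite -Pr_sum_disj//; last first.
  move=> a b w aL bL [_ ca] [_ cb].
  have aL' : inr a \in map (@inr E E) L by apply/mapP; exists a.
  by have := ca _ aL'; rewrite cb// eqxx => /eqP[].
have c01 : 0 <= 1 - h <= 1 by case/andP: h01 => ? ?; apply/andP; split; lra.
have uI : uniq (map (@inr E E) L) by rewrite map_inj_uniq// => a b [].
have hX e : e \in L -> Pr (P_ p) (exits o F e) * (h / 2) <= Pr PP (X e).
  move=> eL; rewrite (indep (A := range inl) lPP (mea_lowc (mea_exits o F e)) (mea_cyl _ _)).
  - rewrite (law_lowc lPP (lawP connG lfG p01) (mea_exits o F e)).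
    rewrite ler_wpM2l ?Pr_ge0// (Pr_cyl lPP)// /weight big_map /= (bigD1_seq e)//= eqxx ler_wpM2l//.
    rewrite (eq_bigr (fun=> 1 - h)); last first.
      move=> a ae; have -> // : (inr a == inr e :> E + E) = false.
      by apply/eqP => -[]; exact/eqP.
    (* No other edge of [L] is sprinkled with probability at least [1 - size L * h], which is at
       least one half by [hm]. *)
    apply: le_trans (prod_cond_ge L _ c01); apply: le_trans (bernoulli_le (size L) h01).
    have : (size L)%:R * h <= (size (edge_seq Z))%:R * h by rewrite ler_wpM2r// ler_nat.
    by move: hm; lra.
  - move=> w w' agree; apply: dep_exits => f _; apply: agree; by exists f.
  - by move=> w w' agree c i iL; rewrite -agree ?c// => -[f _ fi]; move: iL; rewrite -fi => /mapP[].
apply: (@le_trans _ _ (phi p o F * (h / 2))); last first.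
  by rewrite /phi mulr_suml !big_seq; apply: ler_sum => e; exact: hX.
by rewrite -[X in X <= _]mul1r ler_wpM2r ?phi1// divr_ge0.
Qed.

(** If [o] is trapped, a sprinkled exit of the trapped set leads to a vertex that is outside the
    ball or escapes it. The edges inside the trapped set and the sprinkling are still fresh, so
    [crossed_ge] applies given the exploration. *)
Lemma sprinkling_gain : h / 2 * Pr PP (fun w => ~ reach n (lowc w) o) <=
  Pr PP (fun w => reach n (orc w) o) - Pr PP (fun w => reach n (lowc w) o).
Proof.
have oZ : gball o n o by exact: gball0.
have [cs hcs] := filter_code Z.
have hc w : trapped w \in cs by exact: hcs.
have dT : dep set0 (fun w : config (E + E)%type => True) by [].
have hQ w : o \in trapped w -> h / 2 <= Pr PP (crossed (trapped w)).
  move=> oT; apply: crossed_ge => //; have [u1 m1] := edge_seqP (trapped w).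
  have [_ m2] := edge_seqP Z; apply: uniq_leq_size => // e /m1 te; apply/m2; apply: touchS te => v.
  by rewrite /= mem_filter => /andP[].
have := explore_ge lPP hc mea_trapped dep_trapped (mea_cst True) dT mea_crossed dep_crossed
  (Q := fun F => o \in F) hQ.
have ml := mea_lowc (mea_reach connG lfG n o); have mo := mea_orc (mea_reach connG lfG n o).
rewrite (@Pr_ext _ _ _ _ _ (fun w => ~ reach n (lowc w) o)); last first.
  by move=> w; split=> [[_ /mem_trapped[]]//|ne]; split=> //; exact/mem_trapped.
move=> le1; apply: le_trans le1 _.
rewrite (Pr_split PP mo ml) (@Pr_ext _ _ _ _ (fun w => reach n (orc w) o /\ reach n (lowc w) o)
  (fun w => reach n (lowc w) o)); last first.
  by move=> w; split=> [[]//|c]; split=> //; apply: reach_mono c; exact: lowc_orc.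
rewrite addrAC subrr add0r; apply: Pr_mono.
- apply: mea_and; first exact: mea_cst.
  apply: mea_and; last exact: (mea_code hc mea_trapped mea_crossed).
  by apply: (mea_code hc mea_trapped (F := fun F _ => o \in F)) => F; exact: mea_cst.
- by apply: mea_and => //; exact: mea_not.
- move=> w [_ [/mem_trapped[_ ne] [e eL [[a [b [[aT bT j] oa]]] we]]]]; split=> //.
  have oa' := conn_lowc_orc (conn_rst oa).
  have we' : orc w e by rewrite /orc we orbT.
  have [bZ|nbZ] := pselect (gball o n b); last first.
    by exists b; split=> //; exact: conn_trans oa' (conn_step we' j).
  have : esc b (lowc w).
    by apply: contrapT => nb; move/negP: bT; apply; exact/mem_trapped.
  move=> [y [ny c]]; exists y; split=> //.
  exact: conn_trans oa' (conn_trans (conn_step we' j) (conn_lowc_orc c)).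
Qed.

End sprinkling.

(* The criterion of Duminil-Copin and Tassion; their differential inequality is replaced by many
   small sprinkling steps. *)
Lemma phi_percolates p0 p1 o : 0 <= p0 -> p0 < p1 -> p1 < 1 ->
  (forall S, o \in S -> 1 <= phi p0 o S) -> 0 < theta p1 o.
Proof.
move=> p00 p01 p11 phi1.
pose d := (p1 - p0) / (1 - p0).
have /andP[d0 d1] : 0 < d <= 1 by apply: coupling_par => //; exact: ltW.
(* [K] steps of size [h] with [K * h = d] leave a failure probability of at most [(1 - h / 2) ^+ K],
   hence at most [(1 + d / 2)^-1]. This does not depend on [n], whereas [K] does. *)
pose b := 1 - (1 + d / 2)^-1.
have d2 : 0 < 1 + d / 2 by lra.
have b0 : 0 < b by rewrite subr_gt0 invf_lt1//; lra.
suff H n : b <= Pr (P_ p1) (fun w => reach n w o).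
  apply: (lt_le_trans b0); rewrite /theta (@Pr_ext _ _ _ _ _ (fun w : config E => forall n, reach n w o)).
    apply: Pr_down_ge => // [n|n w]; [exact: mea_reach|exact: reachS].
  by move=> w; rewrite infcP.
pose m := size (edge_seq (ball_seq o n)).
(* The smallness required by [sprinkling_gain] is [m * d / K <= 1 / 2]. *)
pose K := (Num.truncn (2 * d * m%:R)).+1.
have K0 : 0 < K%:R :> R by [].
pose h := d / K%:R.
have h0 : 0 < h by rewrite divr_gt0.
have hd : h <= d by rewrite ler_pdivrMr// ler_peMr ?(ltW d0)// ler1n.
have h01 : 0 <= h <= 1 by apply/andP; split; lra.
have hm : m%:R * h <= 1 / 2.
  have /andP[_ lt] : (Num.truncn (2 * d * m%:R))%:R <= 2 * d * m%:R < K%:R.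
    by apply: truncn_itv; rewrite mulr_ge0// mulr_ge0// ltW.
  by rewrite /h mulrA ler_pdivrMr//; lra.
(* The level reached after [k] sprinklings; Bernoulli's inequality keeps [q K] at most [p1]. *)
pose q k := 1 - (1 - p0) * (1 - h) ^+ k.
have hk k : 0 <= (1 - h) ^+ k <= 1.
  by rewrite exprn_ge0 ?exprn_ile1//; lra.
have p0' : 0 < 1 - p0 by lra.
have q01 k : 0 <= q k <= 1.
  have /andP[a1 a2] := hk k; have : 0 <= (1 - p0) * (1 - h) ^+ k by rewrite mulr_ge0// ltW.
  have : (1 - p0) * (1 - h) ^+ k <= (1 - p0) * 1 by rewrite ler_wpM2l// ltW.
  by rewrite /q; lra.
have q0 k : p0 <= q k.
  have /andP[a1 a2] := hk k.
  have : (1 - p0) * (1 - h) ^+ k <= (1 - p0) * 1 by rewrite ler_wpM2l// ltW.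
  by rewrite /q; lra.
pose f k := Pr (P_ (q k)) (fun w => reach n w o).
have step k : 1 - f k.+1 <= (1 - f k) * (1 - h / 2).
  have lh := lawP connG lfG h01; have lq := lawP connG lfG (q01 k).
  have [PP lPP] := pair_law_exists lq lh.
  have mr := mea_reach connG lfG n o.
  have qS : q k.+1 = 1 - (1 - q k) * (1 - h) by rewrite /q exprSr; ring.
  have := sprinkling_gain (n := n) (q01 k) lPP h01 hm.
  have phik S : o \in S -> 1 <= phi (q k) o S.
    move=> oS; apply: le_trans (phi1 S oS) _; apply: phi_mono => //.
    by case/andP: (q01 k).
  move=> /(_ phik); rewrite Pr_not; last exact: (mea_lowc mr).
  rewrite (law_lowc lPP lq mr) -/(f k).
  have lq1 : blaw (fun=> 1 - (1 - q k) * (1 - h)) (P_ (q k.+1)).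
    by rewrite -qS; exact: lawP.
  by rewrite (law_orc lPP lq1 mr) -/(f k.+1); lra.
have iter k : 1 - f k <= (1 - h / 2) ^+ k.
  elim: k => [|k IH]; first by rewrite expr0; have := Pr_ge0 (P_ (q 0)) (fun w => reach n w o); rewrite -/(f 0%N); lra.
  by apply: le_trans (step k) _; rewrite exprSr ler_wpM2r//; lra.
have qK : q K <= p1.
  have := bernoulli_le K h01; have -> : K%:R * h = d by rewrite /h mulrC divfK// gt_eqF.
  move=> le; have : (1 - p0) * (1 - d) <= (1 - p0) * (1 - h) ^+ K by rewrite ler_wpM2l// ltW.
  have -> : (1 - p0) * (1 - d) = 1 - p1 by rewrite /d; field; rewrite gt_eqF.
  by rewrite /q; lra.
have fK : b <= f K.
  have h2 : 0 <= h / 2 <= 1 by apply/andP; split; lra.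
  have := inv_one_plus_ge K h2.
  have -> : K%:R * (h / 2) = d / 2 by rewrite /h; field; rewrite gt_eqF.
  have := iter K; set x := _ ^+ K => le1 le2.
  have : x <= (1 + d / 2)^-1 by rewrite -[X in _ <= X]mul1r ler_pdivlMr.
  by rewrite /b; lra.
apply: le_trans fK _; apply: Pr_param_mono => //.
- by case/andP: (q01 K).
- exact: ltW.
- exact: mea_reach.
- by move=> w w' le; exact: reach_mono.
Qed.

End exits.

(** * Finite susceptibility *)

Section susceptibility.
Context {R : realType} {G : multigraph}.
Hypotheses (connG : connected_graph G) (lfG : locally_finite G) (qtG : quasi_transitive G).
Local Notation V := (vertex G).
Local Notation E := (edge G).
Local Notation P_ p := (@bond_percolation R G p).
Context {p : R}.
Hypothesis p01 : 0 <= p < 1.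
Implicit Types (x y z : V) (e : E) (S F s : seq V) (M : R).

Let p01' : 0 <= p <= 1. Proof. by case/andP: p01 => -> /ltW ->. Qed.

(** The endpoint off [S] of a boundary edge. The default [x] is harmless: for other edges [exits] is
    impossible. *)
Definition outer S e x : V := xget x [set b | b \notin S /\ exists2 a, a \in S & joins e a b].

Lemma outerP S e x a b : a \in S -> b \notin S -> joins e a b -> outer S e x = b.
Proof.
move=> aS bS j; rewrite /outer; case: xgetP => [c _ [cS [d dS j']]|no]; last first.
  by case: (no b); split=> //; exists a.
case: (joins_ends j (joins_sym j')) => // ca; by rewrite ca aS in cS.
Qed.

(* Explore the cluster of [x] inside [S]: a path to [y] leaves it through an open boundary edge,
   whose outer endpoint is joined to [y] by fresh edges. *)
Lemma tau_exit_le x y S : x \in S -> y \notin S ->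
  tau p x y <= \sum_(e <- edge_seq S) Pr (P_ p) (exits x S e) * (p * tau p (outer S e x) y).
Proof.
move=> xS yS; have lP := lawP connG lfG p01'.
have [uL mL] := edge_seqP lfG S.
have /finite_seqP[L LE] : finite_set (inside S `&` touch [set` S]).
  by apply: sub_finite_set (finite_touch lfG (finite_seq S)) => e [].
have insE : inside S = [set` L].
  rewrite -LE; apply/seteqP; split=> [e ins|e []//]; split=> //.
  have j : joins e (ends e).1 (ends e).2 by left; exact: surjective_pairing.
  have [eS _] := proj1 (insideP S j) ins.
  by exists (ends e).1, (ends e).2.
pose C := explored L x.
have memC w v : v \in C w <-> open_connected (rst (inside S) w) x v.
  by rewrite mem_explored insE.
have CS w v : v \in C w -> v \in S.
  move=> /memC c; apply: (conn_ind (Q := fun v => v \in S) c) => // a b e _ _ /rstE[_ ins] j.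
  by have [] := proj1 (insideP S j) ins.
pose bd e F := exists a b, [/\ a \in F, b \notin S & joins e a b].
pose Lk e F (w : config E) := w e /\ open_connected (rst (~` touch [set` F]) w) (outer S e x) y.
have mrc F u v : mea (fun w : config E => open_connected (rst (~` touch [set` F]) w) u v) by exact: mea_conn_rst.
have mLk e F : mea (Lk e F) by apply: mea_and => //; exact: mea_coord.
have [codes hc] := explored_code L x.
have mC F : mea (fun w => C w = F) by exact: mea_explored.
have mbd e : mea (fun w => bd e (C w)).
  by apply: (mea_code hc mC (F := fun F _ => bd e F)) => F; exact: mea_cst.
have mLC e : mea (fun w => Lk e (C w) w) by exact: (mea_code hc mC (mLk e)).
have mEv e : mea (fun w => bd e (C w) /\ Lk e (C w) w) by exact: mea_and.
apply: (@le_trans _ _ (\sum_(e <- edge_seq S) Pr (P_ p) (fun w => bd e (C w) /\ Lk e (C w) w))).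
  have union (l : seq E) : Pr (P_ p) (fun w => exists2 e, e \in l & bd e (C w) /\ Lk e (C w) w) <=
      \sum_(e <- l) Pr (P_ p) (fun w => bd e (C w) /\ Lk e (C w) w).
    elim: l => [|e l IH]; first by rewrite big_nil Pr_false// => w [].
    have ml : mea (fun w => exists2 e, e \in l & bd e (C w) /\ Lk e (C w) w) by exact: mea_ex_seq.
    rewrite big_cons; apply: le_trans (lerD (lexx _) IH).
    apply: le_trans (Pr_or (P_ p) (mEv e) ml); apply: Pr_mono; [exact: mea_ex_seq|exact: mea_or|].
    by move=> w [f]; rewrite inE => /orP[/eqP->|fl] h; [left|right; exists f].
  apply: le_trans (union _); apply: Pr_mono; [exact: mea_conn|exact: mea_ex_seq|].
  move=> w c; have xC : [set` C w] x by apply/memC; exact: conn_refl.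
  have yC : ~ [set` C w] y by move=> /CS; exact/negP.
  have [u [v [e [uC vC [we j] vy]]]] := last_exit c xC yC.
  have uS := CS w u uC.
  have vS : v \notin S.
    apply/negP => vS; apply: vC; apply/memC; move/memC: uC => xu.
    by apply: (conn_trans xu (conn_step (e := e) _ j)); apply/rstE; split=> //; apply/(insideP S j).
  exists e; first by apply/mL; exists u, v.
  split; first by exists u, v.
  by split=> //; rewrite (outerP x uS vS j).
rewrite !big_seq; apply: ler_sum => e eS.
have [[a0 [b0 [a0S b0S j0]]]|nbd] := pselect (exists a b, [/\ a \in S, b \notin S & joins e a b]); last first.
  rewrite [X in X <= _]Pr_false ?mulr_ge0 ?Pr_ge0//; first by case/andP: p01.
  by move=> w [[a [b [aC bS j]]] _]; apply: nbd; exists a, b; split=> //; exact: CS aC.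
have nins : ~ inside S e by move=> /(insideP S j0)[_]; exact/negP.
have dC F : dep ([set` L] `&` touch [set` F]) (fun w => C w = F).
  move=> w w' h eF; rewrite -eF; apply: explored_local => f fL tf.
  by apply: h; split=> //; rewrite -eF.
have dT : dep set0 (fun w : config E => True) by [].
have dLk F : dep (~` (([set` L] `&` touch [set` F]) `|` set0)) (Lk e F).
  move=> w w' h [we c]; split.
    by rewrite -h// => -[[eL _]|//]; apply: nins; rewrite insE.
  apply: conn_mono c => f /rstE[wf nt]; apply/rstE; split=> //.
  by rewrite -h// => -[[_ /nt]|].
have hQ w : bd e (C w) -> Pr (P_ p) (Lk e (C w)) <= p * tau p (outer S e x) y.
  move=> [a [b [aC bS j]]].
  rewrite (indep (A := [set e]) lP (mea_coord e) (mrc _ _ _)).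
  - rewrite (Pr_coord lP) ler_wpM2l//; first by case/andP: p01.
    by apply: Pr_mono => //; [exact: mea_conn|move=> w'; exact: conn_rst].
  - by move=> w1 w2 h; rewrite h.
  - move=> w1 w2 h; apply: conn_mono => f /rstE[wf nt]; apply/rstE; split=> //.
    by rewrite -h// => fe; apply: nt; rewrite fe; exists a, b.
have := explore_le lP hc mC dC (mea_cst True) dT (mLk e) dLk (Q := bd e) hQ.
rewrite (@Pr_ext _ _ _ _ _ (fun w => bd e (C w) /\ Lk e (C w) w)); last by move=> w; split=> [[]|].
move=> /le_trans; apply; rewrite mulrC le_eqVlt; apply/orP; left; apply/eqP; congr (_ * _).
apply: Pr_ext => w; split=> [[_ [a [b [aC bS j]]]]|[a [b [[aS bS j] c]]]].
  by exists a, b; split; [split=> //; exact: CS aC|exact/memC].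
by split=> //; exists a, b; split=> //; exact/memC.
Qed.

(** Uniform in the start and the list, so that it can be applied again at the outer endpoints.
    [M = N] always works, which gives the recursion a finite start. *)
Let sums_le N M := forall z s, uniq s -> size s = N -> \sum_(y <- s) tau p z y <= M.

Lemma sum_step x S N M : x \in S -> phi p x S < 1 -> sums_le N M ->
  forall s, uniq s -> size s = N -> \sum_(y <- s) tau p x y <= (size S)%:R + p * M.
Proof.
move=> xS phi1 hM s us sN; have [p0 p1] := andP p01.
have M0 : 0 <= M by apply: le_trans (hM x s us sN); apply: sumr_ge0 => y _; exact: Pr_ge0.
pose Y y := \sum_(e <- edge_seq S) Pr (P_ p) (exits x S e) * (p * tau p (outer S e x) y).
have Y0 y : 0 <= Y y by apply: sumr_ge0 => e _; rewrite !mulr_ge0 ?Pr_ge0.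
apply: (@le_trans _ _ (\sum_(y <- s) ((y \in S)%:R + Y y))).
  apply: ler_sum => y _; have [yS|yS] := boolP (y \in S).
    by have := tau_le1 connG lfG p x y; have := Y0 y; rewrite /=; lra.
  by rewrite add0r; exact: tau_exit_le.
rewrite big_split /= lerD//.
  rewrite -natr_sum ler_nat.
  have -> : (\sum_(y <- s) (y \in S) = size [seq y <- s | y \in S])%N.
    by rewrite size_filter; elim: (s) => [|y l IH]; rewrite ?big_nil// big_cons IH.
  apply: uniq_leq_size; rewrite ?filter_uniq// => y.
  by rewrite mem_filter => /andP[].
rewrite exchange_big /=.
apply: (@le_trans _ _ (\sum_(e <- edge_seq S) Pr (P_ p) (exits x S e) * (p * M))).
  apply: ler_sum => e _; rewrite -mulr_sumr ler_wpM2l ?Pr_ge0// -mulr_sumr ler_wpM2l//.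
  exact: hM.
rewrite -mulr_suml -/(phi p x S) -[X in _ <= X]mul1r ler_wpM2r ?mulr_ge0//.
exact: ltW.
Qed.

(** [sum_step] sends a bound [M] to [D + p * M]. Iterating from the trivial bound [N] gives
    [D / (1 - p) + p ^+ k * N], and [k] is chosen after the list to make the last term at most
    one. *)
Lemma susceptibility_bound : (forall x, exists2 S, x \in S & phi p x S < 1) ->
  exists B : R, forall x s, uniq s -> \sum_(y <- s) tau p x y <= B.
Proof.
move=> hS; have [p0 p1] := andP p01.
have [|||D hD] := qt_uniform qtG (U := fun x D => forall N M, sums_le N M ->
    forall s, uniq s -> size s = N -> \sum_(y <- s) tau p x y <= D%:R + p * M).
- move=> f g x D fg U N M hM s us sN; have [[f' ff' f'f] _ _] := fg.
  have := U N M hM (map f' s); rewrite map_inj_uniq ?size_map; last exact: can_inj f'f.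
  move=> /(_ us sN); rewrite big_map; congr (_ <= _); apply: eq_bigr => y _.
  by rewrite -(aut_tau connG lfG x (f' y) p01' fg) f'f.
- move=> x D D' le U N M hM s us sN; apply: le_trans (U N M hM s us sN) _.
  by rewrite lerD2r ler_nat.
- move=> x; have [S xS phi1] := hS x; exists (size S) => N M hM.
  exact: sum_step.
exists (D%:R / (1 - p) + 1) => x s us.
have q0 : 0 < 1 - p by rewrite subr_gt0.
have iter k N : sums_le N (D%:R / (1 - p) + p ^+ k * N%:R).
  elim: k => [|k IH] z s' us' sN.
    rewrite expr0 mul1r -[X in X <= _]add0r lerD//; first by rewrite divr_ge0// ltW.
    rewrite -sN -sum1_size natr_sum; apply: ler_sum => y _; exact: tau_le1.
  apply: le_trans (hD z _ _ IH _ us' sN) _.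
  rewrite le_eqVlt; apply/orP; left; apply/eqP; rewrite exprS; field.
  by rewrite gt_eqF.
have [k hk] : exists k, p ^+ k * (size s)%:R <= 1.
  pose k := (Num.truncn ((size s)%:R / (1 - p))).+1; exists k.
  have /andP[_ lt] : (Num.truncn ((size s)%:R / (1 - p)))%:R <= (size s)%:R / (1 - p) < k%:R.
    by apply: truncn_itv; rewrite divr_ge0// ltW.
  have q01 : 0 <= 1 - p <= 1 by apply/andP; split; lra.
  have := inv_one_plus_ge k q01; have -> : 1 - (1 - p) = p by ring.
  apply: le_trans; rewrite ler_wpM2l ?exprn_ge0//.
  by rewrite ltr_pdivrMr// in lt; lra.
apply: le_trans (iter k _ x s us erefl) _; lra.
Qed.

End susceptibility.

Section below.
Context {R : realType} {G : multigraph}.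
Hypotheses (connG : connected_graph G) (lfG : locally_finite G) (qtG : quasi_transitive G).
Local Notation V := (vertex G).
Local Notation E := (edge G).
Local Notation P_ p := (@bond_percolation R G p).

Definition two_infinite (w : config E) := exists x y : V,
  [/\ infc w x, infc w y & ~ open_connected w x y].

Lemma exp_ge (a M : R) : 0 < a -> exists n, M <= (1 + a) ^+ n.
Proof.
move=> a0; pose n := (Num.truncn (`|M| / a)).+1; exists n.
have bern : forall k, 1 + k%:R * a <= (1 + a) ^+ k.
  elim=> [|k IH]; first by rewrite mul0r addr0 expr0.
  have k0 : 0 <= k%:R * a * a by rewrite !mulr_ge0// ltW.
  apply: (@le_trans _ _ ((1 + k%:R * a) * (1 + a))); first by rewrite -addn1 natrD; nra.
  by rewrite exprSr ler_wpM2r//; lra.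
apply: le_trans (bern n).
have /andP[_ lt] : (Num.truncn (`|M| / a))%:R <= `|M| / a < n%:R.
  by apply: truncn_itv; rewrite divr_ge0// ltW.
rewrite ltr_pdivrMr// in lt.
by have := ler_norm M; lra.
Qed.

Lemma percolates_below (p c : R) : 0 < p < 1 -> 0 < c -> (forall x y : V, c <= tau p x y) ->
  Pr (P_ p) two_infinite = 1 -> exists2 q, 0 < q < p & exists x : V, 0 < theta q x.
Proof.
move=> /andP[p0 p1] c0 tc two; apply: contrapT => none.
have p01 : 0 < p < 1 by rewrite p0.
have p01' : 0 <= p <= 1 by rewrite !ltW.
have [z [r tri]] := trifurcation_gt0 connG lfG p01 two.
have [a a0 [k hk]] := volume_exp connG lfG qtG p01' tri.
(* Then [(1 + a) ^+ j * (c / 4)] is at least [2]: the volume gained over a distance [j * k]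
   outweighs the factor [c / 4] lost by the two-point function. *)
have [j hj] := exp_ge (8 / c) a0.
have [q /andP[q0 qp] hq] := tau_nearby connG lfG qtG (j * k) z p01 c0 tc.
have q01 : 0 <= q < 1 by apply/andP; split; lra.
have q01' : 0 <= q <= 1 by apply/andP; split; lra.
have [|B hB] := susceptibility_bound connG lfG qtG q01.
  move=> x; apply: contrapT => no.
  (* If [phi] were at least one for every finite set containing [x], the midpoint would percolate
     while still below [p]. *)
  have qm : q < (q + p) / 2 by lra.
  have m1 : (q + p) / 2 < 1 by lra.
  apply: none; exists ((q + p) / 2); first by apply/andP; split; lra.
  exists x; apply: (phi_percolates connG lfG (ltW q0) qm m1) => S xS.
  by rewrite leNgt; apply/negP => lt; apply: no; exists S.
have h n : 2 ^+ n <= B.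
  apply: le_trans (hB z (ball_seq z (n * (j * k))) (ball_seq_uniq lfG _ _)).
  apply: (@le_trans _ _ (\sum_(y <- ball_seq z (n * (j * k))) (c / 4) ^+ n)); last first.
    rewrite !big_seq; apply: ler_sum => y /(mem_ball_seq lfG) b.
    apply: (tau_chain connG lfG q01' _ hq b); lra.
  rewrite big_const_seq count_predT iter_addr_0 -[X in _ <= X]mulr_natl.
  apply: (@le_trans _ _ ((1 + a) ^+ (n * j) * (c / 4) ^+ n)).
    rewrite mulnC exprM -exprMn; apply: lerXn2r; rewrite ?nnegrE//.
      by rewrite mulr_ge0// ?exprn_ge0//; lra.
    apply: (@le_trans _ _ (8 / c * (c / 4))).
      have -> : 8 / c * (c / 4) = 2 by field; rewrite gt_eqF.
      exact: lexx.
    by rewrite ler_wpM2r//; lra.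
  rewrite ler_wpM2r//; first by rewrite exprn_ge0//; lra.
  by rewrite mulnA; exact: hk.
have [n hn] := exp_ge (B + 1) (ltr01 : 0 < 1 :> R).
have := h n; have -> : 2 = 1 + 1 :> R by []; lra.
Qed.

End below.

(** * Thresholds *)

Section main.
Context {R : realType} {G : multigraph}.
Hypotheses (connG : connected_graph G) (lfG : locally_finite G) (infG : infinite_graph G)
  (qtG : quasi_transitive G).
Local Notation V := (vertex G).
Local Notation E := (edge G).
Local Notation P_ p := (@bond_percolation R G p).
Local Notation two_infinite := (@two_infinite G).
Implicit Types (x y o : V) (p q c : R) (w : config E).

Lemma ae_Pr p (X : config E -> Prop) : mea X ->
  {ae P_ p, forall w, X w} <-> Pr (P_ p) X = 1.
Proof.
move=> mX; have mN := mea_not mX.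
have -> : {ae P_ p, forall w, X w} = (P_ p).-negligible (fun w => ~ X w) by [].
split=> [/(proj1 (negligibleP (P_ p) mN)) h|h].
  have : Pr (P_ p) (fun w => ~ X w) = 0 by rewrite /Pr; move: h => /= ->.
  by rewrite Pr_not//; lra.
apply: (proj2 (negligibleP (P_ p) mN)); apply: (etrans (PrE (P_ p) mN)).
by rewrite Pr_not// h subrr.
Qed.

Lemma infinite_clusterP w C : infinite_cluster w C <-> exists2 x, C = Defs.cluster w x & infc w x.
Proof. by split=> [[[x ->] inf]|[x -> inf]]; [exists x|split=> //; exists x]. Qed.

Lemma many_infiniteP w : many_infinite_clusters w <-> two_infinite w.
Proof.
split=> [[C1 [C2 [/infinite_clusterP[x -> ix] /infinite_clusterP[y -> iy] ne]]]|[x [y [ix iy n]]]].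
  by exists x, y; split=> // c; apply: ne; exact: cluster_eq.
exists (Defs.cluster w x), (Defs.cluster w y); split; [by apply/infinite_clusterP; exists x|
  by apply/infinite_clusterP; exists y|].
move=> e; apply: n; have : Defs.cluster w y y by exact: conn_refl.
by rewrite -e.
Qed.

Lemma unique_infiniteP w : unique_infinite_cluster w <-> (exists x, infc w x) /\ ~ two_infinite w.
Proof.
split=> [[C [/infinite_clusterP[x Cx ix] uni]]|[[x ix] n]].
  split; first by exists x.
  move=> /many_infiniteP[C1 [C2 [i1 i2 ne]]]; apply: ne.
  by rewrite -(uni _ i1) -(uni _ i2).
exists (Defs.cluster w x); split; first by apply/infinite_clusterP; exists x.
move=> _ /infinite_clusterP[y -> iy]; apply: cluster_eq; apply: contrapT => nc.
by apply: n; exists x, y.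
Qed.

Lemma mea_two : mea two_infinite.
Proof.
have cV := countable_vertices connG lfG; have mi x := mea_infc connG lfG x.
apply: (mea_ex cV) => x; apply: (mea_ex cV) => y.
apply: (@mea_ext _ _ (fun w : config E => (infc w x /\ infc w y) /\ ~ open_connected w x y)).
  by move=> w; split=> [[[]]|[]].
apply: mea_and; first exact: (mea_and (mi x) (mi y)).
by apply: mea_not; exact: mea_conn.
Qed.

Lemma mea_some : mea (fun w => exists x, infc w x).
Proof. by apply: mea_ex => [|x]; [exact: countable_vertices|exact: mea_infc]. Qed.

Lemma other_vertex x : exists y, x <> y.
Proof.
apply: contrapT => no; apply: infG; apply: sub_finite_set (finite_set1 x) => y _ /=.
by apply: contrapT => ne; apply: no; exists y => e; apply: ne.
Qed.

Lemma tau0 x y : x <> y -> tau (0 : R) x y = 0.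
Proof.
move=> xy; have p01 : 0 <= (0 : R) <= 1 by apply/andP; split; lra.
have lP := lawP connG lfG p01.
have o0 : Pr (P_ (0 : R)) (fun w : config E => exists e, w e) = 0.
  apply: Pr_ex0 => [|e|e]; [exact: countable_edges|exact: mea_coord|exact: (Pr_coord lP)].
apply/le_anti; rewrite Pr_ge0 andbT -[X in _ <= X]o0; apply: Pr_mono.
- exact: mea_conn.
- by apply: mea_ex => [|e]; [exact: countable_edges|exact: mea_coord].
- by move=> w [[|[e z] s] /= h]; [case: xy|exists e; case: h].
Qed.

Lemma some_closed0 : Pr (P_ (1 : R)) (fun w : config E => exists e, ~ w e) = 0.
Proof.
have p01 : 0 <= (1 : R) <= 1 by apply/andP; split; lra.
apply: Pr_ex0 => [|e|e]; first exact: countable_edges.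
  by apply: mea_not; exact: mea_coord.
by rewrite Pr_not ?(Pr_coord (lawP connG lfG p01)) ?subrr//; exact: mea_coord.
Qed.

Lemma mea_some_closed : mea (fun w : config E => exists e, ~ w e).
Proof.
by apply: mea_ex => [|e]; [exact: countable_edges|apply: mea_not; exact: mea_coord].
Qed.

Lemma all_open_conn w x y : ~ (exists e, ~ w e) -> open_connected w x y.
Proof.
move=> no; apply: conn_mono (connG x y) => e _.
by apply/negPn/negP => ne; apply: no; exists e; exact/negP.
Qed.

Lemma two1 : Pr (P_ (1 : R)) two_infinite = 0.
Proof.
apply/le_anti; rewrite Pr_ge0 andbT -[X in _ <= X]some_closed0; apply: Pr_mono.
- exact: mea_two.
- exact: mea_some_closed.
by move=> w [x [y [_ _ n]]]; apply: contrapT => /all_open_conn c; exact: n (c x y).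
Qed.

Lemma mea_unique : mea (fun w => unique_infinite_cluster w).
Proof.
apply: (@mea_ext _ _ (fun w => (exists x, infc w x) /\ ~ two_infinite w)).
  by move=> w; rewrite unique_infiniteP.
by apply: mea_and; [exact: mea_some|apply: mea_not; exact: mea_two].
Qed.

Lemma exists_vertex : exists x : V, True.
Proof.
apply: contrapT => no; apply: infG; apply: sub_finite_set (finite_set0 _) => x _.
by apply: no; exists x.
Qed.

Lemma unique1 : {ae P_ (1 : R), forall w, unique_infinite_cluster w}.
Proof.
apply/(ae_Pr _ mea_unique); have mn := mea_not mea_unique.
suff : Pr (P_ (1 : R)) (fun w => ~ unique_infinite_cluster w) <= 0.
  rewrite Pr_not; last exact: mea_unique.
  by have := Pr_le1 (P_ (1 : R)) mea_unique; lra.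
rewrite -some_closed0; apply: Pr_mono => //; first exact: mea_some_closed.
move=> w nu; apply: contrapT => /all_open_conn c; apply: nu; apply/unique_infiniteP.
have [x _] := exists_vertex; split; last by move=> [y [z [_ _ n]]]; exact: n (c y z).
by exists x; apply: sub_infinite_set infG => y _; exact: c.
Qed.

(** In an infinite graph some vertex lies outside each ball, so [o] leaves the ball with probability
    at least [c]; let the radius grow. *)
Lemma theta_ge p o c : 0 <= p <= 1 -> (forall x, c <= tau p o x) -> c <= theta p o.
Proof.
move=> p01 h; rewrite /theta (@Pr_ext _ _ _ _ _ (fun w : config E => forall r, reach r w o)); last first.
  by move=> w; rewrite infcP.
apply: Pr_down_ge => [r|r w|r]; [exact: mea_reach|exact: reachS|].
have [x nx] : exists x, ~ gball o r x.
  apply: contrapT => no; apply: infG; apply: sub_finite_set (finite_ball lfG o r) => y _.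
  by apply: contrapT => ny; apply: no; exists y.
apply: le_trans (h x) _; apply: Pr_mono; [exact: mea_conn|exact: mea_reach|].
by move=> w c'; exists x.
Qed.

(** A tail event, since by [opn_infc] the states of finitely many edges cannot affect it. *)
Lemma some_infinite_zero_one p : 0 <= p <= 1 -> 0 < Pr (P_ p) (fun w => exists x, infc w x) ->
  Pr (P_ p) (fun w => exists x, infc w x) = 1.
Proof.
move=> p01 gt; have [||//] := zero_one (lawP connG lfG p01) mea_some.
  move=> J w w' agree [x ix].
  have : infc (opn J w') x.
    apply: infc_mono ix => e we; apply/orP; have [eJ|eJ] := boolP (e \in J); [by right|left].
    by rewrite -agree//=; exact/negP.
  by move=> /(opn_infc lfG)[y [_ iy]]; exists y.
by move=> e0; rewrite e0 ltxx in gt.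
Qed.

(** Almost sure non-uniqueness would force percolation below [p], and then gluing makes it a null
    event. The endpoints are excluded beforehand: at [1] all edges are open, and at [0] distinct
    vertices are not joined. *)
Lemma tau_lower_unique p c : 0 <= p <= 1 -> 0 < c -> (forall x y, c <= tau p x y) ->
  Pr (P_ p) two_infinite != 1.
Proof.
move=> p01 c0 tc; apply/eqP => two.
have p1 : p < 1.
  rewrite lt_neqAle; have /andP[_ ->] := p01; rewrite andbT; apply/eqP => e.
  by have := oner_eq0 R; rewrite -two e two1 eqxx.
have p0 : 0 < p.
  rewrite lt_neqAle; have /andP[-> _] := p01; rewrite andbT; apply/eqP => e.
  have [x _] := exists_vertex.
  have [y xy] := other_vertex x; have := tc x y; rewrite -e tau0// leNgt c0.
  by [].
have p01' : 0 < p < 1 by rewrite p0.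
have [q /andP[q0 qp] tq] := percolates_below connG lfG qtG p01' c0 tc two.
have := no_two_infinite connG lfG qtG q0 qp p1 tq c0 tc; rewrite -/two_infinite => e.
by have := oner_eq0 R; rewrite -two e eqxx.
Qed.

Lemma connected_above p q o c : 0 <= p -> p < q -> q < 1 -> 0 < c -> (forall x, c <= tau p o x) ->
  {ae P_ q, forall w, unique_infinite_cluster w}.
Proof.
move=> p0' pq q1 c0 tc; have p01 : 0 <= p <= 1 by apply/andP; split; lra.
have q01 : 0 <= q <= 1 by apply/andP; split; lra.
have p0 : 0 < p.
  rewrite lt_neqAle p0' andbT; apply/eqP => e; have [y oy] := other_vertex o.
  by have := tc y; rewrite -e tau0// leNgt c0.
have tp : 0 < theta p o by apply: lt_le_trans c0 _; exact: theta_ge.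
(* The assumption only concerns connections from [o]; passing through [o] makes it uniform in both
   vertices. *)
have tq x y : c ^+ 2 <= tau q x y.
  apply: (@le_trans _ _ (tau p x y)); last by apply: tau_mono => //; lra.
  apply: le_trans (tau_trans connG lfG x o y p01).
  by rewrite expr2; apply: ler_pM => //; rewrite ?(ltW c0)// 1?tau_sym.
have c20 : 0 < c ^+ 2 by rewrite exprn_gt0.
have two0 := no_two_infinite connG lfG qtG p0 pq q1 (ex_intro _ o tp) c20 tq.
have some1 : Pr (P_ q) (fun w => exists x, infc w x) = 1.
  apply: some_infinite_zero_one => //; apply: (@lt_le_trans _ _ (theta q o)).
    by apply: lt_le_trans tp _; apply: theta_mono => //; lra.
  by apply: Pr_mono; [exact: mea_infc|exact: mea_some|move=> w i; exists o].
apply/(ae_Pr _ mea_unique); rewrite (@Pr_ext _ _ _ _ _ (fun w => (exists x, infc w x) /\ ~ two_infinite w)); last first.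
  by move=> w; rewrite unique_infiniteP.
have := Pr_split (P_ q) mea_some mea_two; rewrite some1.
have : Pr (P_ q) (fun w => (exists x, infc w x) /\ two_infinite w) <= Pr (P_ q) two_infinite.
  by apply: Pr_mono => [||w []] //; [apply: mea_and; [exact: mea_some|exact: mea_two]|exact: mea_two].
have -> : Pr (P_ q) two_infinite = 0 by exact: two0.
have := Pr_ge0 (P_ q) (fun w => (exists x, infc w x) /\ two_infinite w); lra.
Qed.

Lemma unique_tau_lower p o : 0 <= p <= 1 -> {ae P_ p, forall w, unique_infinite_cluster w} ->
  exists2 c, 0 < c & forall x, c <= tau p o x.
Proof.
move=> p01.
have mu := mea_unique; move=> /(ae_Pr _ mu) uni.
have cV := countable_vertices connG lfG; have mi x := mea_infc connG lfG x.
have some1 : 0 < Pr (P_ p) (fun w => exists x, infc w x).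
  apply: (lt_le_trans ltr01); rewrite -uni; apply: Pr_mono => //; first exact: mea_some.
  by move=> w /unique_infiniteP[].
have [z tz] := Pr_ex_gt0 cV mi some1.
(* At [p = 0] the cluster of [z] would have to contain a second vertex, an event of probability
   zero. *)
have p0 : 0 < p.
  rewrite lt_neqAle; have /andP[-> _] := p01; rewrite andbT; apply/eqP => e.
  have : Pr (P_ p) (fun w => infc w z) <= 0; last by rewrite leNgt tz.
  rewrite -(Pr_ex0 (P := P_ p) (Q := fun y w => z <> y /\ open_connected w z y) cV).
  - apply: Pr_mono => //.
      by apply: (mea_ex cV) => y; apply: mea_and; [exact: mea_cst|exact: mea_conn].
    move=> w /(infcP connG lfG) /(_ 0%N)[y [nb c]]; exists y; split=> // zy; apply: nb.
    by rewrite zy.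
  - by move=> y; apply: mea_and; [exact: mea_cst|exact: mea_conn].
  move=> y; have [zy|zy] := pselect (z = y).
    by apply: Pr_false => w [].
  apply/le_anti; rewrite Pr_ge0 andbT -(tau0 zy) /tau -e; apply: Pr_mono; last by move=> w [].
    by apply: mea_and; [exact: mea_cst|exact: mea_conn].
  exact: mea_conn.
have p01' : 0 < p <= 1 by rewrite p0; case/andP: p01.
have [t t0 ht] := theta_lower connG lfG qtG p01' (ex_intro _ z tz).
exists (t ^+ 2) => [|x]; first by rewrite exprn_gt0.
apply: (@le_trans _ _ (theta p o * theta p x)).
  by rewrite expr2; apply: ler_pM => //; rewrite ltW.
have ai y := assoc_infc connG lfG (P := P_ p) y.
apply: le_trans (harrisP (lawP connG lfG p01) (ai o) (ai x)) _.
have mI : mea (fun w : config E => infc w o /\ infc w x) by exact: mea_and.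
rewrite (Pr_split (P_ p) mI mu).
have -> : Pr (P_ p) (fun w => (infc w o /\ infc w x) /\ ~ unique_infinite_cluster w) = 0.
  apply/le_anti; rewrite Pr_ge0 andbT.
  apply: (@le_trans _ _ (Pr (P_ p) (fun w => ~ unique_infinite_cluster w))).
    by apply: Pr_mono => [||w []] //; [apply: mea_and => //; exact: mea_not|exact: mea_not].
  by rewrite Pr_not// uni subrr.
rewrite addr0; apply: Pr_mono; [exact: mea_and|exact: mea_conn|].
by move=> w [[i1 i2] /unique_infiniteP[_ n]]; apply: contrapT => nc; apply: n; exists o, x.
Qed.

End main.

Theorem theorem1p3 (R : realType) (G : multigraph)
    (connG : connected_graph G) (lfG : locally_finite G)
    (infG : infinite_graph G) (qtG : quasi_transitive G) :
  (forall p : R, 0 <= p <= 1 ->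
     {ae bond_percolation G p, forall w, many_infinite_clusters w} ->
     ereal_inf [set two_point p x y | x in [set: vertex G] & y in [set: vertex G]]
       = 0%E)
  /\ (forall o : vertex G, p_u R G = p_conn R o).
Proof.
split=> [p p01 many|o].
  have [v0 _] := exists_vertex infG.
  set I := ereal_inf _.
  have I0 : (0 <= I)%E.
    by apply: le_ereal_inf_tmp => _ [x _ [y _ <-]]; rewrite tauE// lee_fin Pr_ge0.
  have Ile (x y : vertex G) : (I <= (tau p x y)%:E)%E.
    by apply: ereal_inf_lbound; exists x => //; exists y => //; rewrite tauE.
  apply/eqP; rewrite eq_le I0 andbT leNgt; apply/negP => Igt.
  have If : I \is a fin_num.
    by rewrite ge0_fin_numE//; apply: le_lt_trans (Ile v0 v0) (ltry _).
  have c0 : 0 < fine I by rewrite -lte_fin fineK.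
  have tc (x y : vertex G) : fine I <= tau p x y by rewrite -lee_fin fineK.
  have /eqP := tau_lower_unique connG lfG infG qtG p01 c0 tc; apply.
  apply/(ae_Pr p (mea_two connG lfG)).
  have -> // : @two_infinite G = fun w => many_infinite_clusters w.
  by apply/funext => w; apply/propext; rewrite many_infiniteP.
have conn_lower (p : R) : (0 < ereal_inf (range (two_point p o)))%E ->
    exists2 c : R, 0 < c & forall x, c <= tau p o x.
  set I := ereal_inf _ => Igt.
  have Ile (x : vertex G) : (I <= (tau p o x)%:E)%E.
    by apply: ereal_inf_lbound; exists x => //; rewrite tauE.
  have If : I \is a fin_num.
    by rewrite ge0_fin_numE ?(ltW Igt)//; apply: le_lt_trans (Ile o) (ltry _).
  by exists (fine I) => [|x]; rewrite -?lte_fin -?lee_fin fineK.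
have lower_conn (p c : R) : 0 < c -> (forall x, c <= tau p o x) -> (0 < ereal_inf (range (two_point p o)))%E.
  move=> c0 h; apply: (@lt_le_trans _ _ c%:E); first by rewrite lte_fin.
  by apply: le_ereal_inf_tmp => _ [x _ <-]; rewrite tauE// lee_fin.
rewrite /p_u /p_conn; set A := [set p | _]; set B := [set p | _].
have AB : A `<=` B.
  move=> p [p01 uni]; split=> //.
  by have [c c0 h] := unique_tau_lower connG lfG qtG o p01 uni; exact: lower_conn h.
have lbB : has_lbound B by exists 0 => p [/andP[]].
have lbA : has_lbound A by exists 0 => p [/andP[]].
have A1 : A 1.
  by split; [apply/andP; split; lra|exact: unique1].
have B0 : B !=set0 by exists 1; exact: AB.
apply/le_anti/andP; split; last first.
  by apply: lb_le_inf; [exists 1|move=> p /AB Bp; exact: ge_inf].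
apply: lb_le_inf => // p [/andP[p0 p1] cp].
have [c c0 tc] := conn_lower p cp.
have [->|pn1] := eqVneq p 1; first exact: ge_inf.
have {pn1} p1' : p < 1 by rewrite lt_neqAle pn1.
(* A level strictly between [p] and [inf A] and also below [1], as [connected_above] requires; it
   would belong to [A]. *)
rewrite leNgt; apply/negP => lt; pose q := (p + Num.min 1 (inf A)) / 2.
have pm : p < Num.min 1 (inf A) by rewrite lt_min p1'.
have qm : q < Num.min 1 (inf A) by rewrite /q; lra.
have pq : p < q by rewrite /q; lra.
move: qm; rewrite lt_min => /andP[q1 qA].
have : inf A <= q.
  apply: ge_inf => //; split; first by apply/andP; split; lra.
  exact: (connected_above connG lfG infG qtG p0 pq q1 c0 tc).
by rewrite leNgt qA.
Qed.
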